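(* Let $n\ge 3$ be an integer, and suppose that a preference relation $\succsim$ on $\mathcal X_{[a,b]}$ admits an RDU representation with $u\in\mathcal U$ (increasing) and $h\in\mathcal H$, that is, $X\succsim Y \iff R_{u,h}(X)\ge R_{u,h}(Y)$ for all $X,Y\in\mathcal X_{[a,b]}$. Then $\succsim$ is consistent with $n$th-order stochastic dominance ($n$SD) if and only if one of the following two cases holds: (i) $u\in\mathcal U$ is increasing and $h(s)=\mathbf 1_{\{s=1\}}$ for all $s\in[0,1]$. In this case, $R_{u,h}(X)=\min u(X)$ for all $X\in\mathcal X_{[a,b]}$. (ii) $u$ is an $n$-monotone function and there is some $\lambda\in(0,1]$ such that $h(s)=\lambda s\,\mathbf 1_{\{s<1\}}+\mathbf 1_{\{s=1\}}$ for all $s\in[0,1]$. In this case, $R_{u,h}(X)=\lambda\,\mathbb E[u(X)]+(1-\lambda)\min u(X)$ for all $X\in\mathcal X_{[a,b]}$.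
   Context: Fix real numbers $a<b$. $\mathcal X_{[a,b]}$ is the space of all random variables with values in $[a,b]$ on a fixed atomless probability space (so every distribution on $[a,b]$ is the distribution of some element of $\mathcal X_{[a,b]}$). $F_X$ is the distribution function of $X$ and $\overline F_X=1-F_X$. For a bounded random variable $Z$, $\min Z=\inf\{x: F_Z(x)>0\}$ denotes the essential infimum; in particular $\min u(X)$ is the essential infimum of the random variable $u(X)$. ''Increasing'', ''decreasing'', ''convex'', ''concave'' are all in the weak sense. $[m]=\{1,\dots,m\}$, with $[0]=\emptyset$. A preference relation $\succsim$ on $\mathcal X_{[a,b]}$ is a weak order (complete and transitive). $n$SD: for a distribution function $F$ put $F^{[1]}=F$ and $F^{[k]}(\eta)=\int_{-\infty}^{\eta}F^{[k-1]}(\xi)\,d\xi$ for $k\ge2$. Write $X\ge_n Y$ if $F_X^{[n]}(\eta)\le F_Y^{[n]}(\eta)$ for all $\eta\in[a,b]$ and $F_X^{[k]}(b)\le F_Y^{[k]}(b)$ for all $k\in[n]$. A preference relation $\succsim$ is consistent with $n$SD if $X\succsim Y$ for all $X,Y\in\mathcal X_{[a,b]}$ with $X\ge_nY$. $\mathcal U$ is the set of nonconstant functions $u:[a,b]\to\mathbb R$. $\mathcal H$ is the set of increasing functions $h:[0,1]\to[0,1]$ with $h(0)=0$ and $h(1)=1$ (no continuity is assumed). For increasing $u\in\mathcal U$ and $h\in\mathcal H$, the rank-dependent utility (RDU) function is $$R_{u,h}(X)=\int_0^\infty h(\overline F_{u(X)}(\eta))\,d\eta+\int_{-\infty}^0\big(h(\overline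 F_{u(X)}(\eta))-1\big)\,d\eta .$$ In an RDU representation the utility function $u$ is always assumed to be increasing. $n$-monotone functions: let $f:[a,b]\to\mathbb R$ and $f^{(0)}=f$. For $n\ge2$, $f$ is $n$-monotone if $(-1)^{k-1}f^{(k)}\ge0$ for $k\in[n-2]$ and $(-1)^{n-1}f^{(n-2)}$ is decreasing and convex, where $f^{(k)}$ is the $k$th derivative of $f$ (whenever $f^{(k)}$ is written, it is understood that it exists). For $n=1$, $f$ is $1$-monotone if it is increasing.
   Formalization: In the ''only if'' part u is assumed nonconstant on (a,b] (else u=1_{(a,b]} with any h is a counterexample); n-monotone asks for derivatives only on (a,b], with u increasing on [a,b], since u'(a) may be infinite, as for u=sqrt(x-a), h(s)=s. *)

(* Defs.v *)
From HB Require Import structures.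
From mathcomp Require Import all_boot all_order all_algebra.
From mathcomp Require Import all_classical all_reals all_analysis.
From mathcomp Require Import measurable_realfun.

Set Implicit Arguments.
Unset Strict Implicit.
Unset Printing Implicit Defensive.

Import Order.TTheory GRing.Theory Num.Theory.
Import numFieldNormedType.Exports.

Local Open Scope classical_set_scope.
Local Open Scope ring_scope.

Definition atomless d (T : measurableType d) (R : realType)
    (P : probability T R) : Prop :=
  forall A : set T, measurable A -> (0 < P A)%E ->
  exists B : set T, [/\ measurable B, B `<=` A, (0 < P B)%E & (P B < P A)%E].

Definition weak_order (S : Type) (pref : S -> S -> Prop) : Prop :=
  (forall X Y, pref X Y \/ pref Y X) /\
  (forall X Y Z, pref X Y -> pref Y Z -> pref X Z).

(* Functions on an interval are total functions on R of which only the values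
   on that interval are ever used. *)
Definition increasing_on (R : realType) (I : interval R) (f : R -> R) : Prop :=
  {in I &, {homo f : x y / x <= y}}.

Definition decreasing_on (R : realType) (I : interval R) (f : R -> R) : Prop :=
  {in I &, {homo f : x y /~ x <= y}}.

Definition nonconstant_on (R : realType) (I : interval R) (f : R -> R) : Prop :=
  exists x y : R, [/\ x \in I, y \in I & f x != f y].

Definition distortion (R : realType) (h : R -> R) : Prop :=
  [/\ forall s : R, s \in `[0, 1] -> h s \in `[0, 1],
      increasing_on `[0, 1] h, h 0 = 0 & h 1 = 1].

Record rv_on d (T : measurableType d) (R : realType) (P : probability T R)
    (a b : R) := RvOn {
  rv :> {RV P >-> R};
  rv_itv : forall t, rv t \in `[a, b] }.

(* F^[k] for k >= 1, with values in the extended reals so that the integrals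
   of the nonnegative functions F^[k-1] need no integrability assumption. *)
Definition icdf d (T : measurableType d) (R : realType) (P : probability T R)
    (X : {RV P >-> R}) (k : nat) : R -> \bar R :=
  iter k.-1
    (fun (G : R -> \bar R) (eta : R) =>
       \int[lebesgue_measure]_(xi in `]-oo, eta]) G xi)%E
    (cdf X).

Definition sd_ge d (T : measurableType d) (R : realType) (P : probability T R)
    (a b : R) (n : nat) (X Y : rv_on P a b) : Prop :=
  (forall eta : R, eta \in `[a, b] -> (icdf X n eta <= icdf Y n eta)%E) /\
  (forall k : nat, (1 <= k <= n)%N -> (icdf X k b <= icdf Y k b)%E).

Definition sd_consistent d (T : measurableType d) (R : realType)
    (P : probability T R) (a b : R) (n : nat)
    (pref : rv_on P a b -> rv_on P a b -> Prop) : Prop :=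
  forall X Y : rv_on P a b, sd_ge n X Y -> pref X Y.

Section UtilityOfRV.
Context d (T : measurableType d) (R : realType) (P : probability T R).
Context (a b : R) (u : R -> R) (hu : increasing_on `[a, b] u) (X : rv_on P a b).

Definition util_fun (t : T) : R := u (rv X t).

Lemma measurable_util_fun : measurable_fun setT util_fun.
Proof.
pose v (x : R) := u (Order.max a (Order.min x b)).
have -> : util_fun = v \o rv X.
  apply/funext => t; rewrite /util_fun /v /=.
  have := rv_itv X t; rewrite in_itv /= => /andP[aX Xb].
  by rewrite (min_idPl Xb) (max_idPr aX).
apply: measurableT_comp => //.
have [[t _]|T0] := pselect (exists t : T, True); last first.
  have PT := probability_setT P.
  have T0' : [set: T] = set0.
    by apply/seteqP; split => // t _; apply: T0; exists t.
  move: PT; rewrite T0' measure0 => /eqP.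
  by rewrite eq_sym onee_eq0.
have ab : a <= b.
  by have := rv_itv X t; rewrite in_itv /= => /andP[aX /(le_trans aX)].
apply: nondecreasing_measurable => // x y xy; apply: hu.
- by rewrite in_itv /= le_max lexx /= ge_max ab ge_min lexx orbT.
- by rewrite in_itv /= le_max lexx /= ge_max ab ge_min lexx orbT.
- rewrite ge_max le_max lexx /= le_max; apply/orP; right.
  by rewrite le_min !ge_min xy lexx !orbT.
Qed.

Definition util : {RV P >-> R} := mfun_Sub (mem_set measurable_util_fun).

End UtilityOfRV.

(* R_{u,h}(X); [hu] makes u(X) a random variable. *)
Definition rdu d (T : measurableType d) (R : realType) (P : probability T R)
    (a b : R) (u : R -> R) (hu : increasing_on `[a, b] u) (h : R -> R)
    (X : rv_on P a b) : R :=
  (\int[lebesgue_measure]_(eta in `[0%R, +oo[)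
      h (1 - fine (cdf (util hu X) eta))) +
  (\int[lebesgue_measure]_(eta in `]-oo, 0%R])
      (h (1 - fine (cdf (util hu X) eta)) - 1)).

Definition ess_min d (T : measurableType d) (R : realType)
    (P : probability T R) (Z : {RV P >-> R}) : R :=
  inf [set x : R | (0 < cdf Z x)%E].

(* Derivatives relative to a set D: at an endpoint of an interval D that
   belongs to D they are one-sided. *)
Definition slope (R : realType) (f : R -> R) (x y : R) : R :=
  (f y - f x) / (y - x).

Definition derivable_on (R : realType) (D : set R) (f : R -> R) (x : R) : Prop :=
  cvg (slope f x y @[y --> within D x^']).

Definition deriv_on (R : realType) (D : set R) (f : R -> R) (x : R) : R :=
  lim (slope f x y @[y --> within D x^']).

Definition nderiv_on (R : realType) (D : set R) (k : nat) (f : R -> R) : R -> R :=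
  iter k (deriv_on D) f.

(* The derivatives are taken on ]a, b], one-sided at b. No finite derivative is
   required at a: it may be infinite there, as for the square root of x - a.
   The value at a is constrained by monotonicity on [a, b], which for n >= 2
   follows on ]a, b] from the remaining clauses. For n = 2 the clauses amount
   to f being increasing and concave on [a, b]. *)
Definition n_monotone (R : realType) (a b : R) (n : nat) (f : R -> R) : Prop :=
  let D : set R := [set` `]a, b]] in
  increasing_on `[a, b] f /\
  ((2 <= n)%N ->
    [/\ forall (k : nat) (x : R), (k < n - 2)%N -> x \in `]a, b] ->
          derivable_on D (nderiv_on D k f) x,
        forall (k : nat) (x : R), (1 <= k <= n - 2)%N -> x \in `]a, b] ->
          0 <= (-1) ^+ (k - 1) * nderiv_on D k f x,
        decreasing_on `]a, b]
          (fun x => (-1) ^+ (n - 1) * nderiv_on D (n - 2) f x) &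
        convex_function (D : set (R^o : lmodType R))
          (fun x => (-1) ^+ (n - 1) * nderiv_on D (n - 2) f x)]).

(* Main.v *)
(* Necessity. Laws that are uniform on N points suffice, and on such a law the
   utility is a sum of utilities with weights h((i+1)/N) - h(i/N). Unless h
   vanishes on [0, 1[, two consecutive weights can have a ratio close to 1, and
   second-order contractions then make u concave. Contractions at a point where
   u is almost linear make the weights increase; third-order comparisons, in
   which a spread of size eps is paid for by a displacement of order eps ^ 2
   lower down, make them decrease except at the top. Hence h is linear on
   [0, 1[. Expectations are then compared on all pairs of laws whose difference
   is a mixed finite difference (B-splines are nonnegative), so that the mixed
   differences of u alternate in sign up to order n. The left derivative of such
   a function exists by concavity, inherits the property one order lower, and is
   continuous because it is convex, hence it is the derivative.

   Sufficiency. Comparing the n-th iterated distribution functions just above the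
   bottom of the support gives the inequality of essential minima, and that of
   the masses at a. After a contraction of [a, b] towards b, an n-monotone u is a
   uniform limit of splines whose expectations n-th order dominance controls;
   letting the contraction tend to the identity handles a possibly infinite
   derivative at a, and the masses at a handle a jump of u there. *)

Require Import Defs.
From mathcomp Require Import all_boot all_order all_algebra.
From mathcomp Require Import all_classical all_reals all_analysis.
From mathcomp Require Import measurable_realfun ring lra zify.
Set Implicit Arguments.
Unset Strict Implicit.
Unset Printing Implicit Defensive.
Import Order.TTheory GRing.Theory Num.Theory.
Import numFieldNormedType.Exports.
Local Open Scope classical_set_scope.
Local Open Scope ring_scope.

(** * Functions with alternating mixed differences *)

Section Slopes.
Context {R : realType}.
Implicit Types f g : R -> R.

(** The necessity assumes u nonconstant on []a, b]] for this reason: if u is constant there and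
    jumps at a, [rdu hu h X] is a weakly increasing function of the probability of X > a, and
    dominance of order at least 2 orders the masses at a ([sd_mass_at_min]), so every distortion
    would be consistent. The obstacle throughout is regularity: h may jump and u is merely
    increasing. Limits are therefore taken on finite grids, in the form N A <= C for every N. The
    weights are compared without a derivative of u, through bounds c (y - x) <= u y - u x <= L (y -
    x) on a small interval; nonconstancy supplies c > 0. A third-order comparison occupies four
    consecutive ranks, two for the spread and two below to pay for it. On a grid of N ranks the two
    worst weights thus escape the equality of weights, and refining the grid moves them into the
    single point s = 1: this is where a jump of h survives. The coefficient lambda is 2 h(1/2), read
    off at a point common to all even grids. *)

Lemma archimedean_le0 (A C : R) : (forall N : nat, N%:R * A <= C) -> A <= 0.
Proof.
move=> h; rewrite leNgt; apply/negP => A0.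
have C0 : 0 <= C by have := h 0%N; rewrite mul0r.
have := h (Num.bound (C / A)); apply/negP; rewrite -ltNge.
by rewrite -ltr_pdivrMr// archi_boundP// divr_ge0// ltW.
Qed.

(* Splitting [x, y] into N equal steps, each step right of y rises by at most
   the last step left of y, and every step left of y by at least that. *)
Lemma wright_concave_slope f (x y z : R) : x < y -> y < z ->
  (forall s t, x <= s -> s <= t -> t <= z -> f s <= f t) ->
  (forall s t e, x <= s -> s <= t -> 0 <= e -> t + e <= z ->
     f (t + e) - f t <= f (s + e) - f s) ->
  (f z - f y) * (y - x) <= (f y - f x) * (z - y).
Proof.
move=> xy yz mono wright.
rewrite -subr_le0; apply: (@archimedean_le0 _ ((f y - f x) * (y - x))) => -[|N].
  by rewrite mul0r mulr_ge0// subr_ge0 ?mono// ltW.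
set c := y - x; have c0 : 0 < c by rewrite subr_gt0.
pose e := c / N.+1%:R; have e0 : 0 < e by rewrite divr_gt0.
have Ne : N.+1%:R * e = c by rewrite /e mulrC divfK// pnatr_eq0.
pose M := Num.truncn ((z - y) / e).
have /andP[Mle ltM] : M%:R <= (z - y) / e < M.+1%:R.
  by apply: truncn_itv; rewrite divr_ge0 ?subr_ge0// ltW.
rewrite ler_pdivlMr// in Mle; rewrite ltr_pdivrMr// in ltM.
rewrite -natr1 in ltM.
pose s := f y - f (y - e).
have ec : e <= c by rewrite -Ne ler_peMl ?ler1n// ltW.
have left_steps k : (k <= N.+1)%N -> k%:R * s <= f (x + k%:R * e) - f x.
  elim: k => [_|k IH kN]; first by rewrite !mul0r addr0 subrr.
  have ke0 : 0 <= k%:R * e by rewrite mulr_ge0// ltW.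
  have kNe : k.+1%:R * e <= c by rewrite -Ne ler_wpM2r ?ler_nat// ltW.
  have := wright (x + k%:R * e) (y - e) e; rewrite subrK -/s.
  move: kNe; rewrite -natr1 mulrDl mul1r addrA /c => kNe.
  move=> /(_ _ _ _ _); have := IH (ltnW kN); rewrite mulrDl mul1r.
  move=> ? W; suff : s <= f (x + k%:R * e + e) - f (x + k%:R * e) by lra.
  by apply: W; lra.
have right_steps k : (k <= M)%N -> f (y + k%:R * e) - f y <= k%:R * s.
  elim: k => [_|k IH kM]; first by rewrite !mul0r addr0 subrr.
  have ke0 : 0 <= k%:R * e by rewrite mulr_ge0// ltW.
  have kMe : k.+1%:R * e <= M%:R * e by rewrite ler_wpM2r ?ler_nat// ltW.
  have W := wright (y - e) (y + k%:R * e) e.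
  move: kMe; rewrite -natr1 !mulrDl !mul1r addrA => kMe.
  rewrite subrK -/s in W; have := IH (ltnW kM).
  suff : f (y + k%:R * e + e) - f (y + k%:R * e) <= s by lra.
  by apply: W; rewrite /c in ec; lra.
have Me0 : 0 <= M%:R * e by rewrite mulr_ge0// ltW.
(* The remaining piece of [y, z] is shorter than e; moved to y - e it ends before y, so monotonicity
   bounds its rise by s. Some regularity has to enter: discontinuous additive functions satisfy
   [wright] too. *)
have last_step : f z - f (y + M%:R * e) <= s.
  have := wright (y - e) (y + M%:R * e) (z - y - M%:R * e).
  have -> : y + M%:R * e + (z - y - M%:R * e) = z by ring.
  have := mono (y - e + (z - y - M%:R * e)) y.
  rewrite /c in ec; rewrite /s => m W.
  have := W _ _ _ _; have := m _ _ _; lra.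
have := left_steps N.+1 (leqnn _); have := right_steps M (leqnn _).
rewrite Ne {2}/c (addrC x) subrK => rs ls.
have s0 : 0 <= s by rewrite /s subr_ge0; apply: mono; rewrite /c in ec; lra.
have fzy : f z - f y <= (M%:R + 1) * s by lra.
have MNc : M%:R * c <= N.+1%:R * (z - y).
  by rewrite -Ne mulrCA ler_wpM2l.
have : N.+1%:R * (f z - f y) * c <= (M%:R + 1) * (f y - f x) * c.
  apply: ler_wpM2r; first exact: ltW.
  apply: (@le_trans _ _ (N.+1%:R * ((M%:R + 1) * s))); first by rewrite ler_wpM2l.
  by rewrite mulrCA ler_wpM2l// addr_ge0.
have fyx : 0 <= f y - f x by rewrite subr_ge0 mono// ltW.
have := ler_wpM2l fyx MNc.
by rewrite -/c; move: (f y - f x) (f z - f y) (z - y) => p q w; lra.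
Qed.

End Slopes.

Section MixedDifferences.
Context {R : realType}.
Implicit Types (f g : R -> R) (ds : seq R).

(** Each step contributes the left value minus the right one, so a mixed difference of order k
    carries the sign (-1)^k and [alternating] is one inequality for all orders. *)
Fixpoint mixed_diff f ds (x : R) : R :=
  if ds is d :: ds' then mixed_diff f ds' x - mixed_diff f ds' (x + d) else f x.

(** Base points stay strictly right of a, which leaves room for a jump or an infinite slope at a. *)
Definition alternating (a b : R) (m : nat) f :=
  forall ds x, (1 <= size ds <= m)%N -> all (fun d => 0 <= d) ds ->
    a < x -> x + \sum_(d <- ds) d <= b -> mixed_diff f ds x <= 0.

Lemma sum_steps_ge0 ds : all (fun d => 0 <= d) ds -> 0 <= \sum_(d <- ds) d.
Proof. by move=> /allP h; rewrite big_seq; apply: sumr_ge0 => d /h. Qed.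

Lemma eq_mixed_diff a b f g ds x : {in `]a, b], f =1 g} ->
  all (fun d => 0 <= d) ds -> a < x -> x + \sum_(d <- ds) d <= b ->
  mixed_diff f ds x = mixed_diff g ds x.
Proof.
move=> fg; elim: ds x => [|d ds IH] x /=.
  by rewrite big_nil addr0 => _ ax xb; apply: fg; rewrite in_itv /= ax.
move=> /andP[d0 ds0] ax; rewrite big_cons => xb.
by have := sum_steps_ge0 ds0; rewrite !IH//; lra.
Qed.

Lemma mixed_diff_shift f e ds x :
  mixed_diff (fun z => f (z - e) - f z) ds x = mixed_diff f (e :: ds) (x - e).
Proof.
elim: ds x => [|d ds IH] x /=; first by rewrite subrK.
rewrite !IH /= !subrK.
by rewrite (_ : x + d - e = x - e + d); ring.
Qed.

Lemma mixed_diffZ f c ds x :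
  mixed_diff (fun z => c * f z) ds x = c * mixed_diff f ds x.
Proof. by elim: ds x => [//|d ds IH] x /=; rewrite !IH; ring. Qed.

Lemma alternating_homo a b m f : (0 < m)%N -> alternating a b m f ->
  forall s t, a < s -> s <= t -> t <= b -> f s <= f t.
Proof.
move=> m0 alt s t hs st tb; have := alt [:: t - s] s.
by rewrite /= big_seq1 subr_ge0 st addrC subrK m0 => /(_ isT isT hs tb); lra.
Qed.

Lemma alternating_wright a b m f : (1 < m)%N -> alternating a b m f ->
  forall s t e, a < s -> s <= t -> 0 <= e -> t + e <= b ->
  f (t + e) - f t <= f (s + e) - f s.
Proof.
move=> m1 alt s t e hs st e0 tb; have := alt [:: t - s; e] s.
rewrite /= big_cons big_seq1 subr_ge0 st e0 m1 addrA (addrC s) subrK.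
by move=> /(_ isT isT hs tb); lra.
Qed.

Lemma alternating_slope a b m f x y z : (1 < m)%N -> alternating a b m f ->
  a < x -> x < y -> y < z -> z <= b ->
  (f z - f y) * (y - x) <= (f y - f x) * (z - y).
Proof.
move=> m1 alt ax xy yz zb; apply: wright_concave_slope => //.
  by move=> s t xs st tz; apply: (alternating_homo (ltnW m1) alt) => //; lra.
by move=> s t e xs st e0 tz; apply: (alternating_wright m1 alt) => //; lra.
Qed.

End MixedDifferences.

(** * Left derivatives of functions with alternating differences *)

Section LeftDerivative.
Context {R : realType} (a b : R).
Implicit Types (f g : R -> R) (ds : seq R).

(** For concave f the left slopes decrease as y increases to x, so their infimum is their limit; as
    an infimum it can be named before any convergence is proved. *)
Definition left_derivative f (x : R) : R :=
  inf [set (f x - f y) / (x - y) | y in [set` `]a, x[]].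

Lemma left_derivative_le f m x y : (1 < m)%N -> alternating a b m f ->
  a < y -> y < x -> x <= b -> left_derivative f x * (x - y) <= f x - f y.
Proof.
move=> m1 alt ay yx xb; rewrite -ler_pdivlMr ?subr_gt0//.
apply: ge_inf; last by exists y => //=; rewrite in_itv /= ay.
exists 0 => _ [z zax <-]; move: zax; rewrite /= in_itv /= => /andP[az zx].
by rewrite divr_ge0// subr_ge0 ?(ltW zx)// (alternating_homo (ltnW m1) alt)// ltW.
Qed.

Lemma left_derivative_near f m x e : (1 < m)%N -> alternating a b m f ->
  a < x -> x <= b -> 0 < e ->
  exists2 z, a < z < x & forall y, z <= y -> y < x ->
    f x - f y <= (left_derivative f x + e) * (x - y).
Proof.
move=> m1 alt ax xb e0.
have hi : has_inf [set (f x - f y) / (x - y) | y in [set` `]a, x[]].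
  split.
    exists ((f x - f ((a + x) / 2)) / (x - (a + x) / 2)).
    by exists ((a + x) / 2) => //=; rewrite in_itv /= midf_lt// midf_lt.
  exists 0 => _ [z zax <-]; move: zax; rewrite /= in_itv /= => /andP[az zx].
  by rewrite divr_ge0// subr_ge0 ?(ltW zx)// (alternating_homo (ltnW m1) alt)// ltW.
have [_ [z zax <-] hz] := inf_adherent e0 hi.
move: zax; rewrite /= in_itv /= => /andP[az zx]; exists z; first by rewrite az.
move=> y zy yx.
move: hz; rewrite ltr_pdivrMr ?subr_gt0// -/(left_derivative f x) => hz.
have [->|zy'] := eqVneq y z; first exact: ltW.
have := alternating_slope m1 alt az _ yx xb; rewrite lt_neqAle eq_sym zy' zy.
move=> /(_ isT) h.
rewrite -(@ler_pM2r _ (x - z)) ?subr_gt0//.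
have := ler_wpM2r (ltW (_ : 0 < x - y)) (ltW hz); rewrite subr_gt0 => /(_ yx).
lra.
Qed.

Lemma left_derivative_ge f m x y : (1 < m)%N -> alternating a b m f ->
  a < x -> x < y -> y <= b -> f y - f x <= left_derivative f x * (y - x).
Proof.
move=> m1 alt ax xy yb; rewrite -ler_pdivrMr ?subr_gt0//.
apply: lb_le_inf.
  exists ((f x - f ((a + x) / 2)) / (x - (a + x) / 2)).
  by exists ((a + x) / 2) => //=; rewrite in_itv /= midf_lt// midf_lt.
move=> _ [z /= zax <-]; move: zax; rewrite in_itv /= => /andP[az zx].
rewrite ler_pdivrMr ?subr_gt0// mulrAC ler_pdivlMr ?subr_gt0//.
exact: (alternating_slope m1 alt).
Qed.

Lemma left_derivative_cvg f m x : (1 < m)%N -> alternating a b m f ->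
  a < x -> x <= b ->
  e^-1 * (f (x - e) - f x) @[e --> 0^'+] --> - left_derivative f x.
Proof.
move=> m1 alt ax xb; apply/cvgrPdist_le => e e0.
have [z /andP[az zx] hz] := left_derivative_near m1 alt ax xb e0.
near=> t.
have t0 : 0 < t by near: t; exact: nbhs_right_gt.
have tz : t <= x - z by near: t; apply: nbhs_right_le; rewrite subr_gt0.
have E : x - (x - t) = t by ring.
have atx : a < x - t by lra.
have txx : x - t < x by lra.
have := left_derivative_le m1 alt atx txx xb; rewrite E => h3.
have := hz (x - t); rewrite E => /(_ _ txx) h2.
have {}h2 : f x - f (x - t) <= (left_derivative f x + e) * t by apply: h2; lra.
rewrite -(@ler_pM2r _ t)// -[X in _ * X <= _](gtr0_norm t0) -normrM mulrBl mulrAC mulVf ?gt_eqF//.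
by rewrite ler_norml; apply/andP; split; lra.
Unshelve. all: by end_near.
Qed.

(** A mixed difference of the quotient (f(z - e) - f z) / e is, up to the positive factor 1 / e, a
    mixed difference of f with the additional step e based at x - e, hence nonpositive; e then tends
    to 0 from the right. *)
Lemma alternating_left_derivative f m : (1 < m)%N -> alternating a b m f ->
  alternating a b m.-1 (fun x => - left_derivative f x).
Proof.
move=> m1 alt ds x /andP[ds1 dsm] ds0 ax xb.
have cv : mixed_diff (fun z => e^-1 * (f (z - e) - f z)) ds x @[e --> 0^'+] -->
    mixed_diff (fun z => - left_derivative f z) ds x.
  elim: ds ds0 x ax xb {ds1 dsm} => [_|d ds IH /= /andP[d0 ds0]] x ax.
    by rewrite big_nil addr0 => xb /=; exact: (left_derivative_cvg m1 alt).
  rewrite big_cons => xb; have s0 := sum_steps_ge0 ds0.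
  by apply: cvgB; apply: IH => //; lra.
rewrite -(cvg_lim _ cv)//; apply: limr_le; first by apply/cvg_ex; eexists; exact: cv.
near=> e.
have e0 : 0 < e by near: e; exact: nbhs_right_gt.
have ex : e < x - a by near: e; apply: nbhs_right_lt; rewrite subr_gt0.
rewrite mixed_diffZ mixed_diff_shift pmulr_rle0 ?invr_gt0//.
apply: alt => /=; first by lia.
- by rewrite ltW.
- lra.
- by rewrite big_cons addrA subrK.
Unshelve. all: by end_near.
Qed.

Lemma left_derivative_ge0 f m x : (1 < m)%N -> alternating a b m f ->
  a < x -> x <= b -> 0 <= left_derivative f x.
Proof.
move=> m1 alt ax xb; apply: lb_le_inf.
  exists ((f x - f ((a + x) / 2)) / (x - (a + x) / 2)).
  by exists ((a + x) / 2) => //=; rewrite in_itv /= midf_lt// midf_lt.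
move=> _ [z /= zax <-]; move: zax; rewrite in_itv /= => /andP[az zx].
by rewrite divr_ge0// subr_ge0 ?(ltW zx)// (alternating_homo (ltnW m1) alt)// ltW.
Qed.

(* Convexity of the left derivative makes it right-continuous, so that the
   right slopes, squeezed between two left derivatives, converge to it too. *)
Lemma left_derivative_slope_cvg f m x : (2 < m)%N -> alternating a b m f ->
  a < x -> x <= b ->
  slope f x y @[y --> within [set` `]a, b]] x^'] --> left_derivative f x.
Proof.
move=> m2 alt ax xb.
have m1 := ltnW m2.
have altg := alternating_left_derivative m1 alt.
have m2' : (1 < m.-1)%N by lia.
set g := left_derivative f in altg *.
pose x' := (a + x) / 2.
have [ax' x'x] : a < x' /\ x' < x by rewrite /x'; lra.
(* -K is the slope of the chord of g over [x', x]. As g is convex, right of x it lies above the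
   extension of this chord, which bounds the right slopes of f from below. *)
pose K := (g x' - g x) / (x - x').
have gK y : x < y -> y <= b -> g x - K * (y - x) <= g y.
  move=> xy yb; have := alternating_slope m2' altg ax' x'x xy yb.
  rewrite -ler_pdivlMr ?subr_gt0// /K => h.
  have := h; rewrite mulrAC; lra.
apply/cvgrPdist_le => e e0.
have [z /andP[az zx] hz] := left_derivative_near m1 alt ax xb e0.
have K0 : 0 < `|K| + 1 by rewrite ltr_wpDl.
rewrite near_withinE; near=> y.
rewrite /= in_itv /= => /andP[ay yb].
have yx : y != x by near: y; exact: nbhs_dnbhs_neq.
have dy : `|x - y| < Num.min (x - z) (e / (`|K| + 1)).
  near: y; apply: nbhs_dnbhs; apply: nbhsx_ballx; rewrite lt_min subr_gt0 zx divr_gt0//.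
move: dy; rewrite lt_min => /andP[dz dK].
have [yltx|xlty|E] := ltgtP y x; last by rewrite E eqxx in yx.
- have h1 := left_derivative_le m1 alt ay yltx xb.
  have h2 : f x - f y <= (g x + e) * (x - y).
    by apply: hz => //; move: dz; rewrite gtr0_norm ?subr_gt0//; lra.
  rewrite /slope -(opprB x y) -(opprB (f x)) invrN mulrNN.
  rewrite -(@ler_pM2r _ (x - y)) ?subr_gt0// -[X in _ * X <= _](gtr0_norm (_ : 0 < x - y)) ?subr_gt0//.
  rewrite -normrM mulrBl divfK ?subr_eq0 1?eq_sym//.
  by rewrite ler_norml; apply/andP; split; rewrite /g in h1 h2 *; lra.
- have h1 := left_derivative_le m1 alt ax xlty yb.
  have h2 := left_derivative_ge m1 alt ax xlty yb.
  have h3 := gK _ xlty yb.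
  have h4 : K * (y - x) <= e.
    have : K * (y - x) <= `|K| * (y - x).
      by rewrite ler_wpM2r ?ler_norm// subr_ge0 ltW.
    move: dK; rewrite distrC gtr0_norm ?subr_gt0// ltr_pdivlMr//.
    by move: xlty; rewrite -subr_gt0; lra.
  have := ler_wpM2r (ltW (_ : 0 < y - x)) h3; rewrite subr_gt0 => /(_ xlty) h5.
  have := ler_wpM2r (ltW (_ : 0 < y - x)) h4; rewrite subr_gt0 => /(_ xlty) h6.
  rewrite /slope -(@ler_pM2r _ (y - x)) ?subr_gt0// -[X in _ * X <= _](gtr0_norm (_ : 0 < y - x)) ?subr_gt0//.
  rewrite -normrM mulrBl divfK ?subr_eq0//.
  by rewrite ler_norml; apply/andP; split; rewrite /g in h1 h2 h5 h6 *; lra.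
Unshelve. all: by end_near.
Qed.

(** Points just left of x lie in []a, b]] even when x = b. Properness is what lets [lim] in
    [deriv_on] return the limit found. *)
Lemma within_dnbhs_proper (x : R) : a < x -> x <= b ->
  ProperFilter (within [set` `]a, b]] x^').
Proof.
move=> ax xb; split; last exact: within_filter.
rewrite /within /= => h.
have : \forall y \near x^'-, False.
  have h' : \forall y \near x^'-, `]a, b]%classic y -> set0 y.
    have [e /= e0 he] := h; exists e => //= y xye yx; apply: he => //.
    by rewrite lt_eqF.
  near=> y; suff : set0 y by [].
  have : `]a, b]%classic y -> set0 y by near: y.
  apply; rewrite /= in_itv /=; apply/andP; split.
    by near: y; exact: nbhs_left_gt.
  apply/ltW/(lt_le_trans _ xb); near: y; exact: nbhs_left_lt.
by move=> /filter_ex[].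
Unshelve. all: by end_near.
Qed.

Lemma deriv_on_cvg f x l : a < x -> x <= b ->
  slope f x y @[y --> within [set` `]a, b]] x^'] --> l ->
  deriv_on [set` `]a, b]] f x = l.
Proof.
move=> ax xb h; have pf := within_dnbhs_proper ax xb.
by apply: cvg_lim => //.
Qed.

End LeftDerivative.

Section ConvexSlopes.
Context {R : realType} (a b : R).
Implicit Types f : R -> R.

Lemma convex_function_slope f x y z :
  convex_function ([set` `]a, b]] : set (R^o : lmodType R)) f ->
  a < x -> x < y -> y < z -> z <= b ->
  (f y - f x) * (z - y) <= (f z - f y) * (y - x).
Proof.
move=> cf ax xy yz zb.
have zx : 0 < z - x by lra.
pose t := (z - y) / (z - x).
have t0 : 0 <= t by rewrite divr_ge0//; lra.
have t1 : t <= 1 by rewrite ler_pdivrMr//; lra.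
have := cf (Itv01 t0 t1) x z.
have [az xb] : a < z /\ x <= b by split; lra.
rewrite !inE /= !in_itv /= ax zb az xb.
move=> /(_ isT isT); rewrite convRE => le.
have {}le : f (t * x + (1 - t) * z) <= t * f x + (1 - t) * f z by exact: le.
have ty : t * x + (1 - t) * z = y by rewrite /t; field; rewrite gt_eqF.
rewrite ty in le; have := ler_wpM2l (ltW zx) le.
have tzx : (z - x) * t = z - y by rewrite /t mulrC divfK// gt_eqF.
have -> : (z - x) * (t * f x + (1 - t) * f z) =
  (z - x) * t * f x + (z - x - (z - x) * t) * f z by ring.
by rewrite tzx; lra.
Qed.

Lemma slope_convex_function f :
  (forall x y z, a < x -> x < y -> y < z -> z <= b ->
    (f y - f x) * (z - y) <= (f z - f y) * (y - x)) ->
  convex_function ([set` `]a, b]] : set (R^o : lmodType R)) f.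
Proof.
move=> h t x z; rewrite !inE /= !in_itv /= => /andP[ax xb] /andP[az zb].
rewrite convRE; change (f (t%:num * x + (1 - t%:num) * z) <=
  t%:num * f x + (1 - t%:num) * f z).
have t0 : 0 <= t%:num by [].
have t1 : t%:num <= 1 by [].
move: (t%:num) t0 t1 => s.
rewrite le_eqVlt => /predU1P[<- _|s0]; first by rewrite !subr0 !mul0r !mul1r !add0r.
rewrite le_eqVlt => /predU1P[->|s1]; first by rewrite !subrr !mul0r !mul1r !addr0.
have [xz|zx|->] := ltgtP x z; last first.
- by rewrite -!mulrDl addrC subrK !mul1r.
- have zx0 := zx; rewrite -subr_gt0 in zx0.
  have p1 := mulr_gt0 s0 zx0; have p2 : 0 < (1 - s) * (x - z) by rewrite mulr_gt0 ?subr_gt0.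
  have := h z (s * x + (1 - s) * z) x az _ _ xb.
  have -> : (z < s * x + (1 - s) * z) by lra.
  have -> : (s * x + (1 - s) * z < x) by lra.
  move=> /(_ isT isT); set w := f _; set p := f x; set q := f z => ineq.
  have : (x - z) * (w - (s * p + (1 - s) * q)) <= 0 by lra.
  by rewrite pmulr_rle0 ?subr_gt0// subr_le0.
- have zx0 := xz; rewrite -subr_gt0 in zx0.
  have p1 := mulr_gt0 s0 zx0; have p2 : 0 < (1 - s) * (z - x) by rewrite mulr_gt0 ?subr_gt0.
  have := h x (s * x + (1 - s) * z) z ax _ _ zb.
  have -> : (x < s * x + (1 - s) * z) by lra.
  have -> : (s * x + (1 - s) * z < z) by lra.
  move=> /(_ isT isT); set w := f _; set p := f x; set q := f z => ineq.
  have : (z - x) * (w - (s * p + (1 - s) * q)) <= 0 by lra.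
  by rewrite pmulr_rle0 ?subr_gt0// subr_le0.
Qed.

End ConvexSlopes.

Section AlternatingMonotone.
Context {R : realType} (a b : R).
Implicit Types f u : R -> R.

Lemma eq_alternating m f g : {in `]a, b], f =1 g} ->
  alternating a b m f -> alternating a b m g.
Proof.
move=> fg alt ds x dsm ds0 ax xb.
by rewrite -(eq_mixed_diff fg)//; exact: alt.
Qed.

Lemma slopeZ c f x y : slope (fun z => c * f z) x y = c * slope f x y.
Proof. by rewrite /slope -mulrBr mulrA. Qed.

Lemma alternating_deriv f m x : (2 < m)%N -> alternating a b m f ->
  x \in `]a, b] -> slope f x y @[y --> within [set` `]a, b]] x^'] -->
    deriv_on [set` `]a, b]] f x /\ 0 <= deriv_on [set` `]a, b]] f x.
Proof.
move=> m2 alt; rewrite in_itv /= => /andP[ax xb].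
have c := left_derivative_slope_cvg m2 alt ax xb.
by rewrite (deriv_on_cvg ax xb c); split => //; apply: (left_derivative_ge0 (ltnW m2) alt).
Qed.

(** Passing to minus the left derivative turns (-1)^k u^(k) into (-1)^(k+1) u^(k+1) at the cost of
    one order of alternation. The left derivative is a derivative while the order exceeds 2, that is
    for k < n - 2; the order 2 left at k = n - 2 yields the monotonicity and convexity clauses. *)
Lemma alternating_n_monotone u n : (2 < n)%N -> increasing_on `[a, b] u ->
  alternating a b n u -> n_monotone a b n u.
Proof.
move=> n2 incu altu; split=> // _.
set D := [set` `]a, b]].
pose f k x := (-1) ^+ k * nderiv_on D k u x.
have sgnK k (r : R) : (-1) ^+ k * ((-1) ^+ k * r) = r.
  by rewrite mulrA -expr2 sqrr_sign mul1r.
have fE k : nderiv_on D k u = (fun x => (-1) ^+ k * f k x).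
  by apply/funext => x; rewrite /f sgnK.
have nS k : nderiv_on D k.+1 u = deriv_on D (nderiv_on D k u) by [].
have step k : (k <= n - 2)%N -> alternating a b (n - k) (f k).
  elim: k => [|k IH] kn.
    by rewrite subn0; apply: eq_alternating altu => x _; rewrite /f expr0 mul1r.
  have altk := IH (ltnW kn).
  have nk : (2 < n - k)%N by lia.
  have := alternating_left_derivative (ltnW nk) altk; rewrite -subnS.
  apply: eq_alternating => x; rewrite in_itv /= => /andP[ax xb].
  have c := left_derivative_slope_cvg nk altk ax xb.
  have c' : slope (nderiv_on D k u) x y @[y --> within D x^'] -->
      (-1) ^+ k * left_derivative a (f k) x.
    rewrite fE (_ : slope _ x = fun y => (-1) ^+ k * slope (f k) x y); last first.
      by apply/funext => y; rewrite slopeZ.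
    by apply: cvgM => //; exact: cvg_cst.
  rewrite /f nS (deriv_on_cvg ax xb c').
  by rewrite exprS -mulrA sgnK mulN1r.
have main k x : (k < n - 2)%N -> x \in `]a, b] ->
    slope (nderiv_on D k u) x y @[y --> within D x^'] -->
      nderiv_on D k.+1 u x /\ 0 <= (-1) ^+ k * nderiv_on D k.+1 u x.
  move=> kn xab.
  have nk : (2 < n - k)%N by lia.
  have [c c0] := alternating_deriv nk (step k (ltnW kn)) xab.
  move: (xab); rewrite in_itv /= => /andP[ax xb].
  have c' : slope (nderiv_on D k u) x y @[y --> within D x^'] -->
      (-1) ^+ k * deriv_on D (f k) x.
    rewrite fE (_ : slope _ x = fun y => (-1) ^+ k * slope (f k) x y); last first.
      by apply/funext => y; rewrite slopeZ.
    by apply: cvgM => //; exact: cvg_cst.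
  by rewrite (deriv_on_cvg ax xb c') sgnK.
have alt2 : alternating a b 2 (f (n - 2)%N).
  by have := step _ (leqnn _); rewrite subKn// ltnW.
have gE : (fun x => (-1) ^+ (n - 1) * nderiv_on D (n - 2) u x) =
    (fun x => - f (n - 2)%N x).
  apply/funext => x; rewrite /f.
  have -> : (n - 1)%N = (n - 2).+1 by lia.
  by rewrite exprS -mulrA mulN1r.
split.
- by move=> k x kn xab; have [c _] := main k x kn xab; apply/cvg_ex; eexists; exact: c.
- move=> [//|k] x /andP[_ kn] xab; rewrite subn1 /=.
  by have [_] := main k x kn xab.
- rewrite gE => x y; rewrite !in_itv /= => /andP[ax xb] /andP[ay yb] xy.
  by rewrite lerN2; apply: (alternating_homo _ alt2).
- rewrite gE; apply: slope_convex_function => x y z ax xy yz zb.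
  by have := alternating_slope (ltnSn 1) alt2 ax xy yz zb; lra.
Qed.

End AlternatingMonotone.

(** * One-sided slopes and truncated powers *)

Section HasSlope.
Context {R : realType}.
Implicit Types (D : set R) (f g : R -> R).

(** The quotient is cleared, so y = x need not be excluded and no properness of a filter enters; at
    an endpoint of an interval D the slope is one-sided. *)
Definition has_slope D f (x l : R) := forall e, 0 < e ->
  exists2 r, 0 < r & forall y, D y -> `|y - x| < r ->
    `|f y - f x - l * (y - x)| <= e * `|y - x|.

Lemma sub_has_slope D D' f x l : D' `<=` D -> has_slope D f x l ->
  has_slope D' f x l.
Proof.
by move=> DD' h e /h[r r0 hr]; exists r => // y /DD'; exact: hr.
Qed.

Lemma has_slope_eq D f g x l : f =1 g -> has_slope D f x l -> has_slope D g x l.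
Proof. by move=> /funext ->. Qed.

Lemma has_slope_cst D c x : has_slope D (fun=> c) x 0.
Proof. by move=> e e0; exists 1 => // y _ _; rewrite subrr mul0r subrr normr0 mulr_ge0// ltW. Qed.

Lemma has_slope_id D x : has_slope D id x 1.
Proof. by move=> e e0; exists 1 => // y _ _; rewrite mul1r subrr normr0 mulr_ge0// ltW. Qed.

Lemma has_slopeD D f g x k l : has_slope D f x k -> has_slope D g x l ->
  has_slope D (fun y => f y + g y) x (k + l).
Proof.
move=> hf hg e e0; have e2 : 0 < e / 2 by rewrite divr_gt0.
have [r r0 hr] := hf _ e2; have [s s0 hs] := hg _ e2.
exists (Num.min r s); first by rewrite lt_min r0.
move=> y Dy; rewrite lt_min => /andP[/(hr _ Dy) h1 /(hs _ Dy) h2].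
have -> : f y + g y - (f x + g x) - (k + l) * (y - x) =
  (f y - f x - k * (y - x)) + (g y - g x - l * (y - x)) by ring.
by apply: le_trans (ler_normD _ _) _; lra.
Qed.

Lemma has_slopeZ D c f x l : has_slope D f x l ->
  has_slope D (fun y => c * f y) x (c * l).
Proof.
move=> hf e e0; have c0 : 0 < `|c| + 1 by rewrite ltr_wpDl.
have [r r0 hr] := hf _ (divr_gt0 e0 c0).
exists r => // y Dy /(hr _ Dy) h.
have -> : c * f y - c * f x - c * l * (y - x) = c * (f y - f x - l * (y - x)) by ring.
rewrite normrM; apply: (@le_trans _ _ ((`|c| + 1) * `|f y - f x - l * (y - x)|)).
  by rewrite ler_wpM2r// lerDl.
by have := ler_wpM2l (ltW c0) h; rewrite mulrA [X in _ <= X * _]mulrC divfK ?gt_eqF.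
Qed.

Lemma has_slopeB D f g x k l : has_slope D f x k -> has_slope D g x l ->
  has_slope D (fun y => f y - g y) x (k - l).
Proof.
move=> hf /(has_slopeZ (-1)) hg; have := has_slopeD hf hg.
by rewrite mulN1r; apply: has_slope_eq => y; rewrite mulN1r.
Qed.

Lemma has_slope_mulid D f x l : has_slope D f x l ->
  has_slope D (fun y => y * f y) x (f x + x * l).
Proof.
move=> hf e e0.
have [r r0 hr] := has_slopeZ x hf (divr_gt0 e0 (ltr0n R 2)).
have [s s0 hs] := hf _ ltr01.
have l0 : 0 < `|l| + 1 by rewrite ltr_wpDl.
exists (Num.min (Num.min r s) (e / 2 / (`|l| + 1))).
  by rewrite !lt_min r0 s0 !divr_gt0.
move=> y Dy; rewrite !lt_min => /andP[/andP[/(hr _ Dy) h1 /(hs _ Dy) h2]].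
rewrite ltr_pdivlMr// => h3.
have -> : y * f y - x * f x - (f x + x * l) * (y - x) =
  (x * f y - x * f x - x * l * (y - x)) + (f y - f x) * (y - x) by ring.
apply: le_trans (ler_normD _ _) _.
suff : `|(f y - f x) * (y - x)| <= e / 2 * `|y - x| by lra.
rewrite normrM ler_wpM2r//.
have : `|f y - f x| <= (`|l| + 1) * `|y - x|.
  rewrite -[X in `|X|](subrK (l * (y - x))).
  by apply: le_trans (ler_normD _ _) _; rewrite normrM; lra.
lra.
Qed.

Lemma has_slope_shift f c x l : has_slope setT f (x - c) l ->
  has_slope setT (fun y => f (y - c)) x l.
Proof.
move=> hf e /hf[r r0 hr]; exists r => // y _ yx.
have E : y - x = (y - c) - (x - c) by ring.
by rewrite E; apply: hr => //; rewrite -E.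
Qed.

Lemma has_slope_reflect f c x l : has_slope setT f (c - x) l ->
  has_slope setT (fun y => f (c - y)) x (- l).
Proof.
move=> hf e /hf[r r0 hr]; exists r => // y _ yx.
have E : c - y - (c - x) = - (y - x) by ring.
by have := hr (c - y) I; rewrite E !mulrN normrN mulNr; apply.
Qed.

Lemma has_slope_within D f x l :
  slope f x y @[y --> within D x^'] --> l -> has_slope D f x l.
Proof.
move=> /cvgrPdist_le h e e0.
have [r /= r0 hr] := h _ e0; exists r => // y Dy yx.
have [->|nyx] := eqVneq y x; first by rewrite !subrr mulr0 subrr normr0 mulr0.
have := hr y; rewrite /= distrC => /(_ yx nyx Dy).
rewrite /slope distrC => h1.
have yx0 : y - x != 0 by rewrite subr_eq0.
have -> : f y - f x - l * (y - x) = ((f y - f x) / (y - x) - l) * (y - x).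
  by rewrite mulrBl divfK.
by rewrite normrM ler_wpM2r.
Qed.

(* The supremum of the points up to which f stays above the line of slope -e
   through (p, f p) can only be q. *)
Lemma has_slope_homo f (df : R -> R) p q : p <= q ->
  (forall x, p <= x <= q -> has_slope [set` `[p, q]] f x (df x)) ->
  (forall x, p <= x <= q -> 0 <= df x) -> f p <= f q.
Proof.
move=> pq hf df0.
have step e x : 0 < e -> p <= x <= q -> exists2 r, 0 < r & forall y,
    p <= y <= q -> `|y - x| < r ->
    if x <= y then f x - e * (y - x) <= f y else f y <= f x + e * (x - y).
  move=> e0 xpq; have [r r0 hr] := hf x xpq e e0; exists r => // y ypq yx.
  have := hr y; rewrite /= in_itv /= => /(_ ypq yx); have := df0 x xpq.
  case: (leP x y) => xy d0 /=; rewrite ler_norml => /andP[h1 h2].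
    have h3 : 0 <= df x * (y - x) by rewrite mulr_ge0// subr_ge0.
    by move: h1 h2; rewrite ger0_norm ?subr_ge0//; lra.
  have h3 : 0 <= df x * (x - y) by rewrite mulr_ge0// subr_ge0 ltW.
  have E : `|y - x| = x - y by rewrite distrC ger0_norm// subr_ge0 ltW.
  by move: h1 h2; rewrite E; lra.
suff close e : 0 < e -> f p - e * (q - p) <= f q.
  rewrite -subr_le0; apply: (@archimedean_le0 _ _ (q - p)) => -[|N].
    by rewrite mul0r subr_ge0.
  have N0 : 0 < N.+1%:R :> R by [].
  have := close N.+1%:R^-1; rewrite invr_gt0 N0 => /(_ isT) h.
  have := ler_wpM2l (ltW N0) h; rewrite mulrBr mulrA divff ?gt_eqF// mul1r.
  by rewrite mulrBr; lra.
move=> e0.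
pose S := [set x | p <= x <= q /\ f p - e * (x - p) <= f x].
have Sp : S p by split; rewrite ?lexx ?pq// subrr mulr0 subr0.
have Sub : has_ubound S by exists q => x [/andP[]].
have hS : has_sup S by split; [exists p|].
set s := sup S.
have ps : p <= s by apply: ub_le_sup.
have sq : s <= q by apply: sup_le_ub; [exists p|move=> x [/andP[]]].
have spq : p <= s <= q by rewrite ps.
have [r r0 hr] := step e s e0 spq.
(* S has points within r left of its supremum s, and the local estimate at s carries membership over
   to s. The same estimate to the right then pushes beyond s unless s = q. *)
have Ss : f p - e * (s - p) <= f s.
  have [t [/andP[pt tq] ft] st] := sup_adherent r0 hS.
  have ts : t <= s by apply: ub_le_sup => //; split=> //; rewrite pt.
  have := hr t; rewrite pt tq => /(_ isT); rewrite distrC ger0_norm ?subr_ge0//.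
  rewrite -/s in st.
  have -> : s - t < r by lra.
  move=> /(_ isT); case: (leP s t) => [st'|_]; last by lra.
  by have -> : s = t by apply/eqP; rewrite eq_le st' ts.
move: sq; rewrite le_eqVlt => /predU1P[<-//|sq].
pose t := Num.min q (s + r / 2).
have st : s < t by rewrite lt_min sq; lra.
have tq : t <= q by rewrite ge_min lexx.
have tr : t <= s + r / 2 by rewrite ge_min lexx orbT.
have := hr t; rewrite (le_trans ps (ltW st)) tq => /(_ isT).
rewrite ger0_norm ?subr_ge0 ?(ltW st)//.
have -> : t - s < r by lra.
move=> /(_ isT) ft.
suff : t <= s by rewrite leNgt st.
apply: ub_le_sup => //; split; first by rewrite tq andbT; lra.
lra.
Qed.

Lemma has_slope_homoT f (df : R -> R) : (forall x, has_slope setT f x (df x)) ->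
  (forall x, 0 <= df x) -> {homo f : x y / x <= y}.
Proof.
move=> hf df0 x y xy; apply: (@has_slope_homo _ df) => // z _.
exact: sub_has_slope (hf z).
Qed.

End HasSlope.

Section PositivePart.
Context {R : realType}.

Definition pospow (k : nat) (y : R) : R := Num.max 0 y ^+ k.

(* The k-th iterated primitive of the unit step at 0. *)
Definition kern (k : nat) (y : R) : R :=
  if k is 0%N then (0 <= y)%R%:R else pospow k y / k`!%:R.

Lemma pospow_ge0 k y : 0 <= pospow k y.
Proof. by rewrite exprn_ge0// le_max lexx. Qed.

Lemma kern_ge0 k y : 0 <= kern k y.
Proof. by case: k => [|k] /=; rewrite ?ler0n// divr_ge0 ?pospow_ge0. Qed.

Lemma pospowS k y : pospow k.+2 y = y * pospow k.+1 y.
Proof.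
rewrite /pospow; case: (leP 0 y) => y0; first by rewrite -exprS.
by rewrite !expr0n /= mulr0.
Qed.

Lemma has_slope_pospow k x : has_slope setT (pospow k.+2) x (k.+2%:R * pospow k.+1 x).
Proof.
elim: k x => [|k IH] x; last first.
  have := has_slope_mulid (IH x).
  rewrite mulrCA -!pospowS -[X in X + _]mul1r -mulrDl nat1r.
  by apply: has_slope_eq => y; rewrite [in RHS]pospowS.
move=> e e0; exists e => // y _ yx.
apply: (@le_trans _ _ (`|y - x| * `|y - x|)); last by rewrite ler_wpM2r// ltW.
rewrite -normrM /pospow expr1 ger0_norm; last by rewrite -expr2 sqr_ge0.
have q1 := sqr_ge0 (y - x); have q2 := sqr_ge0 x; have q3 := sqr_ge0 y.
rewrite ler_norml; case: (leP 0 x) => x0; case: (leP 0 y) => y0; apply/andP; split; nra.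
Qed.

End PositivePart.

(** * Mixed differences of truncated powers and of polynomials *)

Section MixedDifferencesOfKernels.
Context {R : realType}.
Implicit Types (F : R -> R) (ds : seq R).

Lemma has_slope_kern k (x : R) : has_slope setT (kern k.+2) x (kern k.+1 x).
Proof.
have -> : kern k.+1 x = k.+2`!%:R^-1 * (k.+2%:R * pospow k.+1 x).
  rewrite /kern (factS k.+1) natrM.
  have : k.+2%:R != 0 :> R by rewrite pnatr_eq0.
  have : k.+1`!%:R != 0 :> R by rewrite pnatr_eq0 -lt0n fact_gt0.
  by move: (k.+2%:R : R) (k.+1`!%:R : R) => p q q0 p0; field; rewrite q0 p0.
apply: has_slope_eq (has_slopeZ _ (has_slope_pospow k x)) => y.
by rewrite /kern mulrC.
Qed.

Lemma has_slope_exp k (x : R) : has_slope setT (fun y => y ^+ k.+1) x (k.+1%:R * x ^+ k).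
Proof.
elim: k => [|k IH]; first by rewrite mul1r; exact: has_slope_id.
have := has_slope_mulid IH.
rewrite mulrCA -exprS -[X in X + _]mul1r -mulrDl nat1r.
by apply: has_slope_eq => y; rewrite -exprS.
Qed.

Lemma mixed_diff_shiftr F e ds x d :
  mixed_diff (fun y => F (e - y)) ds (x + d) = mixed_diff (fun y => F (e - d - y)) ds x.
Proof.
elim: ds x => [|c ds IH] x /=; first by congr F; ring.
by rewrite -!IH addrAC.
Qed.

Lemma has_slope_mixed_diff F (F' : R -> R) ds x e :
  (forall x, has_slope setT F x (F' x)) ->
  has_slope setT (fun e => mixed_diff (fun y => F (e - y)) ds x) e
    (mixed_diff (fun y => F' (e - y)) ds x).
Proof.
move=> hF; elim: ds x => [|d ds IH] x /=; first exact: has_slope_shift.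
exact: has_slopeB.
Qed.

(** Orders 0 and 1 are checked by hand, as these kernels are not differentiable at 0. Beyond, the
    derivative in e is the mixed difference of the next lower kernel; its outermost step d amounts
    to comparing the parameters e and e - d in a function that is increasing by induction. *)
Lemma mixed_diff_kern_homo ds x : all (fun d => 0 <= d) ds ->
  {homo (fun e => mixed_diff (fun y => kern (size ds) (e - y)) ds x) : e e' / e <= e'}.
Proof.
elim: ds x => [|d [|c ds] IH] x.
- move=> _ e e' ee' /=; rewrite ler_nat !subr_ge0.
  by case: leP => //= xe; rewrite (le_trans xe ee').
- move=> /= /andP[d0 _] e e' ee'; rewrite /pospow divr1 !divr1 !expr1.
  by rewrite /Num.max; do ! case: ifPn; rewrite -?leNgt; lra.
- move=> /andP[d0 ds0].
  have hs (x0 : R) := has_slope_kern (size ds) x0.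
  pose k e y := kern (size ds).+1 (e - y) : R.
  apply: (has_slope_homoT (df := fun e => mixed_diff (k e) (d :: c :: ds) x)) => e.
    exact: (has_slope_mixed_diff _ _ _ hs).
  change (0 <= mixed_diff (k e) (c :: ds) x - mixed_diff (k e) (c :: ds) (x + d)).
  rewrite subr_ge0 mixed_diff_shiftr; apply: IH => //; lra.
Qed.

(** In e this is, up to translation, the convolution of the indicators of intervals of lengths ds.
    The outermost step is an increment in e of an increasing function. *)
Lemma mixed_diff_kern_ge0 ds x e : all (fun d => 0 <= d) ds -> (0 < size ds)%N ->
  0 <= mixed_diff (fun y => kern (size ds).-1 (e - y)) ds x.
Proof.
case: ds => //= d ds /andP[d0 ds0] _; rewrite subr_ge0 mixed_diff_shiftr.
by apply: mixed_diff_kern_homo => //; lra.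
Qed.

(** Without the outermost step the derivative in e vanishes by induction, so that mixed difference
    is constant in e; the outermost step, read as a change of e, then gives 0. *)
Lemma mixed_diff_exp0 k ds x e : (k < size ds)%N ->
  mixed_diff (fun y => (e - y) ^+ k) ds x = 0.
Proof.
elim: k ds x e => [|k IH] [//|d ds] x e.
  have cst_diff ds' y z :
      mixed_diff (fun y => (e - y) ^+ 0) ds' y = mixed_diff (fun y => (e - y) ^+ 0) ds' z.
    elim: ds' y z => [|c ds' IH] y z /=; first by rewrite !expr0.
    by rewrite (IH y z) (IH (y + c) (z + c)).
  by move=> _ /=; rewrite (cst_diff _ x (x + d)) subrr.
move=> kds.
have D (z : R) : has_slope setT (fun e => mixed_diff (fun y => (e - y) ^+ k.+1) ds x) z 0.
  have := has_slope_mixed_diff (F := fun y => y ^+ k.+1) ds x z (@has_slope_exp k).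
  by rewrite mixed_diffZ IH// mulr0.
rewrite /= (mixed_diff_shiftr (fun y => y ^+ k.+1)); apply/eqP; rewrite subr_eq0.
have D' (z : R) : has_slope setT (fun e => - mixed_diff (fun y => (e - y) ^+ k.+1) ds x) z 0.
  have := has_slopeZ (-1) (D z); rewrite mulr0.
  by apply: has_slope_eq => y; rewrite mulN1r.
have h1 := has_slope_homoT D (fun=> lexx 0).
have h2 := has_slope_homoT D' (fun=> lexx 0).
have [ed|de] := leP e (e - d).
  by rewrite eq_le (h1 _ _ ed) -lerN2 (h2 _ _ ed).
by rewrite eq_le (h1 _ _ (ltW de)) -lerN2 (h2 _ _ (ltW de)).
Qed.

End MixedDifferencesOfKernels.

Section DifferencePoints.
Context {R : realType}.
Implicit Types (ds : seq R) (f : R -> R).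

(** The points entering with sign + and those entering with sign -, with multiplicity: they serve as
    the atoms of the two uniform laws whose difference is the mixed difference. *)
Fixpoint diff_points ds (x : R) : seq R * seq R :=
  if ds is d :: ds' then
    let: (p, q) := diff_points ds' x in
    let: (p', q') := diff_points ds' (x + d) in
    (p ++ q', q ++ p')
  else ([:: x], [::]).

Lemma mixed_diff_points f ds x : mixed_diff f ds x =
  \sum_(y <- (diff_points ds x).1) f y - \sum_(y <- (diff_points ds x).2) f y.
Proof.
elim: ds x => [|d ds IH] x /=; first by rewrite big_seq1 big_nil subr0.
rewrite !IH; case: (diff_points ds x) => p q; case: (diff_points ds (x + d)) => p' q' /=.
by rewrite !big_cat /=; ring.
Qed.

Lemma size_diff_points ds x : (0 < size ds)%N ->
  size (diff_points ds x).1 = size (diff_points ds x).2.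
Proof.
case: ds => [//|d ds] _.
elim: ds x d => [|c ds IH] x d /=; first by [].
have := IH x c; have := IH (x + d) c; rewrite /=.
case: (diff_points ds x) => p q; case: (diff_points ds (x + c)) => p' q'.
case: (diff_points ds (x + d)) => r s; case: (diff_points ds (x + d + c)) => r' s' /=.
by rewrite !size_cat; lia.
Qed.

Lemma diff_points_itv ds x : all (fun d => 0 <= d) ds ->
  all (fun y => x <= y <= x + \sum_(d <- ds) d)
    ((diff_points ds x).1 ++ (diff_points ds x).2).
Proof.
elim: ds x => [|d ds IH] x /=; first by rewrite big_nil addr0 lexx.
move=> /andP[d0 ds0]; have := IH x ds0; have := IH (x + d) ds0.
have s0 := sum_steps_ge0 ds0.
case: (diff_points ds x) => p q; case: (diff_points ds (x + d)) => p' q' /=.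
rewrite big_cons !all_cat => /andP[h1 h2] /andP[h3 h4].
by rewrite -!andbA; apply/and4P; split; [move: h3|move: h2|move: h4|move: h1];
  apply: sub_all => y /andP[]; lra.
Qed.

End DifferencePoints.

(** * Atomless probability spaces *)

Section Sierpinski.
Context d (T : measurableType d) (R : realType) (P : probability T R).
Implicit Types A B C : set T.

Let p A : R := fine (P A).

Let PE A : measurable A -> P A = (p A)%:E.
Proof. by move=> mA; rewrite fineK// fin_num_measure. Qed.

Let p_ge0 A : 0 <= p A.
Proof. by rewrite /p fine_ge0. Qed.

Let p_le A B : measurable A -> measurable B -> A `<=` B -> p A <= p B.
Proof.
by move=> mA mB AB; rewrite -lee_fin -!PE// le_measure// inE.
Qed.

Let pU A B : measurable A -> measurable B -> A `&` B = set0 ->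
  p (A `|` B) = p A + p B.
Proof.
move=> mA mB AB; apply: EFin_inj.
by rewrite EFinD -!PE// ?measureU//; exact: measurableU.
Qed.

Let pD A B : measurable A -> measurable B -> B `<=` A ->
  p (A `\` B) = p A - p B.
Proof.
move=> mA mB BA.
have mD := measurableD mA mB.
rewrite -{2}(setDUK BA) setUC pU//; last by rewrite setDE setIC setICA setICr setI0.
by rewrite addrK.
Qed.

(** Of the two parts of positive mass into which a set splits, one has at most half the mass;
    iterating goes below any e. *)
Lemma atomless_small_subset A (e : R) : atomless P -> measurable A ->
  0 < p A -> 0 < e -> exists B, [/\ measurable B, B `<=` A, 0 < p B & p B <= e].
Proof.
move=> noatom mA A0 e0.
have halving N : exists B, [/\ measurable B, B `<=` A, 0 < p B &
    p B * N%:R <= p A].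
  elim: N => [|N [B [mB BA B0 BN]]]; first by exists A; split; rewrite ?mulr0.
  have B0' : (0 < P B)%E by rewrite PE// lte_fin.
  have [C [mC CB]] := noatom _ mB B0'.
  rewrite !PE// !lte_fin => C0 CltB.
  have mBC := measurableD mB mC.
  case: N BN => [|N] BN.
    exists B; split => //; rewrite mulr1; exact: p_le.
  have dbl (q : R) : q + q <= p B -> 0 <= q -> q * N.+2%:R <= p A.
    move=> qq q0; apply: le_trans BN; apply: (@le_trans _ _ ((q + q) * N.+1%:R)).
      by rewrite mulrDl -mulrDr -natrD ler_wpM2l// ler_nat; lia.
    by rewrite ler_wpM2r.
  have [h|h] := leP (p C + p C) (p B).
    by exists C; split => //; [exact: subset_trans BA | exact: dbl].
  exists (B `\` C); split => //.
  - by move=> t [/BA].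
  - by rewrite pD// subr_gt0.
  - apply: dbl => //; rewrite pD//; lra.
have [N Ne] : exists N : nat, p A / e < N%:R.
  exists (Num.bound (p A / e)).
  by apply: le_lt_trans (archi_boundP _); rewrite ?divr_ge0 ?ler_norm// ltW.
have [B [mB BA B0 BN]] := halving N.
exists B; split => //.
rewrite leNgt; apply/negP => eB.
have : p A < p A; last by rewrite ltxx.
apply: lt_le_trans BN; rewrite -ltr_pdivrMl//; apply: le_lt_trans Ne.
by rewrite mulrC ler_wpM2l// lef_pV2 ?posrE// ltW.
Qed.

(** Greedy exhaustion: each step adds a set of at least half the largest mass still admissible below
    c. If the union missed c, some C of positive mass would remain admissible at every step, so
    every step would add at least half its mass, which is impossible. *)
Lemma atomless_subset A (c : R) : atomless P -> measurable A ->
  0 <= c <= p A -> exists B, [/\ measurable B, B `<=` A & p B = c].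
Proof.
move=> noatom mA /andP[c0 cA].
pose ok B := [/\ measurable B, B `<=` A & p B <= c].
pose admissible B C := [/\ measurable C, C `<=` A `\` B & p B + p C <= c].
pose step (X Y : {B | ok B}) :=
  sval X `<=` sval Y /\
  forall C, admissible (sval X) C -> p C <= 2 * (p (sval Y) - p (sval X)).
have next X : {Y | step X Y}.
  apply: cid; case: X => B [mB BA Bc]; rewrite /step /=.
  pose S := [set p C | C in admissible B].
  have S0 : S (p set0).
    by exists set0 => //; split => //; rewrite /p measure0 /= addr0.
  have Sub : has_ubound S.
    by exists c => _ [C [mC CAB CC]] <-; move: (p_ge0 B); lra.
  have hS : has_sup S by split; [exists (p set0)|].
  have [C [admC Cbest]] : exists C, admissible B C /\
      forall C', admissible B C' -> p C' <= 2 * p C.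
    have [s0|s0] := ltP 0 (sup S).
      have [_ [C admC <-] Csup] := sup_adherent (divr_gt0 s0 (ltr0n R 2)) hS.
      exists C; split => // C' admC'.
      have : p C' <= sup S by apply: sup_upper_bound => //; exists C'.
      lra.
    exists set0; split; first by split => //; rewrite /p measure0 /= addr0.
    move=> C' admC'.
    have : p C' <= sup S by apply: sup_upper_bound => //; exists C'.
    by rewrite /p measure0 /=; lra.
  have [mC CAB CC] := admC.
  have dBC : B `&` C = set0.
    by apply/seteqP; split => // t [Bt /CAB []].
  have okBC : ok (B `|` C).
    split; [exact: measurableU| | by rewrite pU].
    by rewrite subUset; split => // t /CAB [].
  exists (exist _ _ okBC) => /=; split; first exact: subsetUl.
  by move=> C' /Cbest; rewrite pU//; lra.
have ok0 : ok set0 by split => //; rewrite /p measure0.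
have [f [_ fstep]] := dependent_choice next (exist _ _ ok0).
pose F n := sval (f n).
have mF n : measurable (F n) by have [] := svalP (f n).
have FA n : F n `<=` A by have [] := svalP (f n).
have Fc n : p (F n) <= c by have [] := svalP (f n).
pose U := \bigcup_n F n.
have mU : measurable U by exact: bigcup_measurable.
have UA : U `<=` A by move=> t [n _ /FA].
have ndF : {homo F : n m / (n <= m)%N >-> (n <= m)%O}.
  apply: homo_leq => [//|x y z|n]; first exact: le_trans.
  by apply/subsetPset; have [] := fstep n.
have Uc : p U <= c.
  rewrite -lee_fin -PE//.
  have cF := @nondecreasing_cvg_mu _ _ _ P _ mF mU ndF.
  rewrite -(cvg_lim _ cF)//; apply: lime_le; first by apply/cvg_ex; eexists; exact: cF.
  by near=> n; rewrite /= PE// lee_fin.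
exists U; split => //; apply/eqP; rewrite eq_le Uc leNgt /=; apply/negP => Ultc.
have mAU := measurableD mA mU.
have [C [mC CAU C0 Cc]] : exists C, [/\ measurable C, C `<=` A `\` U,
    0 < p C & p C <= c - p U].
  by apply: atomless_small_subset => //; rewrite ?pD//; lra.
have admC n : admissible (F n) C.
  split => //.
    by move=> t /CAU [At nU]; split => // Ft; apply: nU; exists n.
  have : p (F n) <= p U by apply: p_le => // t Ft; exists n.
  lra.
have lin n : p C * n%:R <= 2 * p (F n).
  elim: n => [|n IH]; first by rewrite mulr0 mulr_ge0.
  rewrite -natr1 mulrDr mulr1.
  by have [_ /(_ _ (admC n))] := fstep n; rewrite -/(F n) -/(F n.+1); lra.
have := lin (Num.bound (2 * c / p C)).
apply/negP; rewrite -ltNge.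
apply: (@le_lt_trans _ _ (2 * c)); first by have := Fc (Num.bound (2 * c / p C)); lra.
rewrite -ltr_pdivrMl// mulrC; apply: archi_boundP.
by rewrite divr_ge0 ?mulr_ge0// ltW.
Unshelve. all: by end_near.
Qed.

Lemma uniform_index (N : nat) : atomless P -> (0 < N)%N ->
  exists idx : T -> nat, [/\ measurable_fun setT idx,
    forall t, (idx t < N)%N &
    forall i, (i < N)%N -> P (idx @^-1` [set i]) = (N%:R^-1)%:E].
Proof.
move=> noatom N0.
have N0' : N%:R != 0 :> R by rewrite pnatr_eq0 -lt0n.
(* Invariant: parts 0, ..., k - 1 have mass 1 / N and part k holds the remaining (N - k) / N, to be
   cut in two next. At k = N - 1 the remainder is itself 1 / N. *)
suff : forall k, (k < N)%N -> exists idx : T -> nat, [/\ measurable_fun setT idx,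
    forall t, (idx t <= k)%N,
    forall i, (i < k)%N -> P (idx @^-1` [set i]) = (N%:R^-1)%:E &
    P (idx @^-1` [set k]) = ((N - k)%:R / N%:R)%:E].
  case: N N0 N0' => // N _ N0' /(_ N (ltnSn N))[idx [mi ilt pi pN]].
  exists idx; split => // i; rewrite ltnS leq_eqVlt => /predU1P[->|]; last exact: pi.
  by rewrite pN subSnn mul1r.
elim=> [_|k IH kN].
  exists (fun=> 0%N); split => //.
  by rewrite preimage_cst ifT ?inE// probability_setT subn0 divff.
have [idx [mi ilt pi pk]] := IH (ltnW kN).
pose A := idx @^-1` [set k].
have mA : measurable A by rewrite -[A]setTI; exact: mi.
have [B [mB BA pB]] : exists B, [/\ measurable B, B `<=` A & p B = N%:R^-1].
  apply: atomless_subset => //; rewrite invr_ge0 ler0n /= /p pk /=.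
  by rewrite ler_peMl ?invr_ge0 ?ler0n// ler1n; lia.
pose g t := if (idx t == k) && (t \notin B) then k.+1 else idx t.
have preE i : (i < k)%N -> g @^-1` [set i] = idx @^-1` [set i].
  move=> ik; apply/seteqP; split => t; rewrite /g /=.
    by case: ifPn => // _ ki; move: ik; rewrite -ki; lia.
  by case: ifPn => // /andP[/eqP -> _] ki; move: ik; rewrite -ki; lia.
have prek : g @^-1` [set k] = B.
  apply/seteqP; split => t; rewrite /g /=.
    case: ifPn => [_ /eqP|]; first by rewrite (gtn_eqF (ltnSn k)).
    by rewrite negb_and negbK => /orP[/eqP//|/set_mem].
  by move=> Bt; rewrite mem_set// andbF; exact: BA.
have preS : g @^-1` [set k.+1] = A `\` B.
  apply/seteqP; split => t; rewrite /g /=.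
    case: ifPn => [/andP[/eqP ? nB] _|_ ik]; last by have := ilt t; rewrite ik; lia.
    by split => // /mem_set; apply/negP.
  by move=> [-> nB]; rewrite eqxx memNset.
have mAB := measurableD mA mB.
have glt t : (g t <= k.+1)%N by rewrite /g; case: ifPn => // _; exact: leqW.
exists g; split => //.
- move=> _ Y _; rewrite setTI.
  rewrite (_ : g @^-1` Y = \bigcup_(i in Y) (g @^-1` [set i])); last first.
    by apply/seteqP; split => [t Yt|t [i Yi gi]]; [exists (g t)|rewrite /preimage /= gi].
  apply: bigcup_measurable => i _.
  have [ik|] := ltnP i k; first by rewrite preE// -[_ @^-1` _]setTI; exact: mi.
  rewrite leq_eqVlt => /predU1P[<-|]; first by rewrite prek.
  rewrite leq_eqVlt => /predU1P[<-|ki]; first by rewrite preS.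
  rewrite (_ : _ @^-1` _ = set0)//; apply/seteqP; split => // t /= gi.
  by have := glt t; rewrite gi; lia.
- move=> i; rewrite ltnS leq_eqVlt => /predU1P[->|ik].
    by rewrite prek PE// pB.
  by rewrite preE// pi.
- rewrite preS PE// pD// pB /p pk /= subnS.
  have -> : ((N - k).-1%:R : R) = (N - k)%:R - 1.
    by rewrite -[in RHS](@prednK (N - k)) ?subn_gt0 ?(ltnW kN)// -natr1 addrK.
  by rewrite mulrBl mul1r.
Qed.

End Sierpinski.

(** * Rank-dependent utility *)

Section BoundedIntegrals.
Context d (T : measurableType d) (R : realType) (mu : {measure set T -> \bar R}).

Lemma bounded_integrable (D : set T) (f : T -> R) (C : R) : measurable D ->
  (mu D < +oo)%E -> measurable_fun D f -> (forall x, D x -> `|f x| <= C) ->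
  mu.-integrable D (EFin \o f).
Proof.
move=> mD Dfin mf fC; apply: measurable_bounded_integrable => //.
exists C; split; first exact: num_real.
by move=> c Cc x Dx; apply: le_trans (fC x Dx) (ltW Cc).
Qed.

Lemma Rintegral_bigsum (D : set T) (I : Type) (s : seq I) (f : I -> T -> R) :
  measurable D -> (forall i, mu.-integrable D (EFin \o f i)) ->
  \int[mu]_(x in D) (\sum_(i <- s) f i x) = \sum_(i <- s) \int[mu]_(x in D) f i x.
Proof.
move=> mD fint.
have sint r : mu.-integrable D (EFin \o (fun x => \sum_(i <- r) f i x)).
  have -> : EFin \o (fun x => \sum_(i <- r) f i x) =
      (fun x => \sum_(i <- r) (EFin \o f i) x)%E.
    by apply/funext => x; rewrite /= sumEFin.
  exact: integrable_sum.
elim: s => [|i s IH].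
  under eq_Rintegral do rewrite big_nil.
  by rewrite big_nil Rintegral_cst// mul0r.
under eq_Rintegral do rewrite big_cons.
by rewrite big_cons RintegralD// IH.
Qed.

End BoundedIntegrals.

Section TailIntegral.
Context {R : realType}.
Notation mu := (@lebesgue_measure R).

Lemma lebesgue_itv_lty (a b : R) : (lebesgue_measure ([set` `[a, b]] : set R) < +oo)%E.
Proof.
rewrite /= lebesgue_measure_itv /=.
by case: ifP; rewrite -?EFinB ltry.
Qed.

Lemma Rintegral_itv_cst (a b c : R) : a <= b ->
  \int[mu]_(x in `[a, b]) c = c * (b - a).
Proof.
move=> ab; rewrite Rintegral_cst//; congr (_ * _).
rewrite [X in fine X](lebesgue_measure_itv `[a, b]) /= lte_fin.
by case: ltP => // ba; rewrite (le_anti (_ : a <= b <= a)) ?subrr// ab.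
Qed.

(** H stands for a distorted tail P(Z > x) with Z in [-M, M]. Strictness makes the tail vanish
    already at x = M, while it is sure to be 1 only for x < -M; hence the two different bounds. *)
Lemma tail_integralE (H : R -> R) (M : R) : 0 < M -> measurable_fun setT H ->
  (forall x, 0 <= H x <= 1) -> (forall x, x < - M -> H x = 1) ->
  (forall x, M <= x -> H x = 0) ->
  \int[mu]_(x in `[0%R, +oo[) H x + \int[mu]_(x in `]-oo, 0%R]) (H x - 1) =
  \int[mu]_(x in `[- M, M]) H x - M.
Proof.
move=> M0 mH H01 H1 H0.
have iH (l r : R) : mu.-integrable `[l, r] (EFin \o H).
  apply: (@bounded_integrable _ _ _ _ _ _ 1) => //.
  - exact: lebesgue_itv_lty.
  - exact: measurable_funS mH.
  - by move=> x _; have /andP[h0 h1] := H01 x; rewrite ger0_norm.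
have -> : \int[mu]_(x in `[0%R, +oo[) H x = \int[mu]_(x in `[0%R, M]) H x.
  rewrite Rintegral_mkcond [RHS]Rintegral_mkcond; congr Rintegral.
  apply/funext => x; rewrite /patch !mem_setE !in_itv /= andbT.
  by case: (leP 0 x) => //= x0; case: (leP x M) => //= /ltW/H0.
have -> : \int[mu]_(x in `]-oo, 0%R]) (H x - 1) = \int[mu]_(x in `[- M, 0%R]) (H x - 1).
  rewrite Rintegral_mkcond [RHS]Rintegral_mkcond; congr Rintegral.
  apply/funext => x; rewrite /patch !mem_setE !in_itv /=.
  by case: (leP x 0) => //= x0; case: (leP (- M) x) => //= /H1 ->; rewrite ?subrr// andbF.
rewrite RintegralB//; last first.
  apply: (@bounded_integrable _ _ _ _ _ _ 1) => //; first exact: lebesgue_itv_lty.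
  by move=> x _; rewrite normr1.
rewrite Rintegral_itv_cst ?oppr_le0 ?ltW// sub0r opprK mul1r.
have := @Rintegral_itvB R H (BLeft (- M)) (BRight M) 0 (iH _ _).
rewrite !bnd_simp => /(_ _ _).
rewrite (@Rintegral_itv_obnd_cbnd _ 0) //; last first.
  by apply: integrableS (iH 0 M) => //; apply: subset_itvr; rewrite bnd_simp.
move=> E; have {}E := E _ _; rewrite -E ?oppr_le0 ?ltW//; ring.
Qed.

Lemma Rintegral_step (M c : R) : - M <= c <= M ->
  \int[mu]_(x in `[- M, M]) (x < c)%R%:R = c + M.
Proof.
move=> /andP[Mc cM].
have E : \int[mu]_(x in `[- M, M]) (x < c)%R%:R = \int[mu]_(x in `[- M, c[) 1.
  rewrite Rintegral_mkcond [RHS]Rintegral_mkcond; congr Rintegral.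
  apply/funext => x; rewrite /patch !mem_setE !in_itv /=.
  case: (leP (- M) x) => //= Mx; case: (ltP x c) => xc.
    by rewrite (le_trans (ltW xc) cM).
  by case: ifP.
rewrite E Rintegral_cst// mul1r.
rewrite [X in fine X](lebesgue_measure_itv `[- M, c[) /= lte_fin.
case: ltP => [_|h]; first by rewrite -EFinB /= opprK.
by have -> : c = - M; [apply/le_anti; rewrite h Mc|rewrite addNr].
Qed.

End TailIntegral.

Section UniformMean.
Context d (T : measurableType d) (R : realType) (P : probability T R).

Lemma RV_probability_lty : (P setT < +oo)%E.
Proof. by rewrite probability_setT ltry. Qed.

Lemma probability_Rintegral_cst (c : R) : \int[P]_t c = c.
Proof.
by rewrite Rintegral_cst// [X in fine X](probability_setT P) mulr1.
Qed.

Lemma Rintegral_bool (A : T -> bool) : measurable [set t | A t] ->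
  \int[P]_t (A t)%:R = fine (P [set t | A t]).
Proof.
move=> mA; rewrite /Rintegral -[in RHS](setIT [set t | A t]) -integral_indic//.
congr fine; apply: eq_integral => t _; by rewrite indicE mem_setE.
Qed.

Lemma probability_tail (Z : {RV P >-> R}) (x : R) :
  1 - fine (cdf Z x) = fine (P [set t | x < Z t]).
Proof.
have /= := ccdf_1_cdf Z x => E.
have -> : P [set t | x < Z t] = ccdf Z x.
  rewrite /ccdf /distribution /pushforward; congr (P _).
  by apply/seteqP; split => t /=; rewrite in_itv /= andbT.
by rewrite E fineB// fin_num_measure.
Qed.

Context (N : nat) (idx : T -> nat).
Hypotheses (midx : measurable_fun setT idx) (idx_lt : forall t, (idx t < N)%N)
  (Pidx : forall i, (i < N)%N -> P (idx @^-1` [set i]) = (N%:R^-1)%:E).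

Lemma uniform_mean (g : nat -> R) :
  \int[P]_t g (idx t) = (\sum_(i < N) g i) / N%:R.
Proof.
pose A i t := (idx t == i)%N.
have mA i : measurable [set t | A i t].
  have -> : [set t | A i t] = idx @^-1` [set i] by apply/seteqP; split => t /eqP.
  by rewrite -[_ @^-1` _]setTI; exact: midx.
have iA i : P.-integrable setT (EFin \o (fun t => (A i t)%:R : R)).
  apply: (@bounded_integrable _ _ _ _ _ _ 1) => //.
  - exact: RV_probability_lty.
  - have -> : (fun t => (A i t)%:R : R) = \1_[set t | A i t].
      by apply/funext => t; rewrite indicE mem_setE.
    exact: measurable_indic.
  - by move=> t _; case: (A i t); rewrite ?normr1 ?normr0.
have -> : \int[P]_t g (idx t) = \int[P]_t \sum_(i < N) g i * (A i t)%:R.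
  apply: eq_Rintegral => t _; rewrite (bigD1 (Ordinal (idx_lt t)))//= /A eqxx mulr1.
  rewrite big1 ?addr0// => i; rewrite -val_eqE /= => /negPf ni.
  by rewrite eq_sym ni mulr0.
rewrite Rintegral_bigsum//; last first.
  move=> i; have -> : EFin \o (fun t => g i * (A i t)%:R) =
      (fun t => (g i)%:E * (EFin \o (fun t => (A i t)%:R : R)) t)%E.
    by apply/funext => t; rewrite /= EFinM.
  exact: integrableZl.
rewrite mulr_suml; apply: eq_bigr => i _.
rewrite RintegralZl// Rintegral_bool//; congr (_ * _).
have -> : [set t | A i t] = idx @^-1` [set val i] by apply/seteqP; split => t /eqP.
by rewrite [X in fine X](Pidx (ltn_ord i)).
Qed.

Lemma uniform_prob (Q : pred nat) :
  fine (P [set t | Q (idx t)]) = (\sum_(i < N) (Q i)%:R) / N%:R.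
Proof.
rewrite -(uniform_mean (fun i => (Q i)%:R)) Rintegral_bool//.
rewrite (_ : [set t | Q (idx t)] = idx @^-1` [set i | Q i])//.
by rewrite -[_ @^-1` _]setTI; exact: midx.
Qed.

End UniformMean.

Section TailExpectation.
Context d (T : measurableType d) (R : realType) (P : probability T R).

Lemma tonelli (f : T -> R -> \bar R) (D : set R) : measurable D ->
  measurable_fun setT (fun z : T * R => f z.1 z.2) ->
  (forall t x, 0 <= f t x)%E ->
  (\int[lebesgue_measure]_(x in D) \int[P]_t f t x =
   \int[P]_t \int[lebesgue_measure]_(x in D) f t x)%E.
Proof.
move=> mD mf f0.
pose g (z : T * R) := (f z.1 z.2 * (\1_D z.2)%:E)%E.
have mg : measurable_fun setT g.
  apply: emeasurable_funM => //; apply/measurable_EFinP.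
  by apply: (measurableT_comp (measurable_indic mD)); exact: measurable_snd.
have g0 z : (0 <= g z)%E by rewrite mule_ge0// lee_fin indicE ler0n.
have E : (\int[P]_t \int[lebesgue_measure]_x g (t, x) =
    \int[lebesgue_measure]_x \int[P]_t g (t, x))%E by exact: fubini_tonelli.
transitivity (\int[lebesgue_measure]_x \int[P]_t g (t, x))%E.
  rewrite integral_mkcond; apply: eq_integral => x _; rewrite /patch /g /= indicE.
  case: ifPn => xD; first by under [RHS]eq_integral do rewrite mule1.
  by under [RHS]eq_integral do rewrite mule0; rewrite integral0.
rewrite -E; apply: eq_integral => t _; rewrite [RHS]integral_mkcond.
apply: eq_integral => x _; rewrite /patch /g /= indicE.
by case: ifPn => xD; rewrite ?mule1 ?mule0.
Qed.

Lemma Rintegral_tail (Z : {RV P >-> R}) (M : R) :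
  (forall t, - M <= Z t <= M) ->
  \int[lebesgue_measure]_(x in `[- M, M]) (1 - fine (cdf Z x)) =
  \int[P]_t Z t + M.
Proof.
move=> ZM.
have mZ x : measurable [set t | x < Z t].
  have -> : [set t | x < Z t] = Z @^-1` [set` `]x, +oo[].
    by apply/seteqP; split => t /=; rewrite in_itv /= andbT.
  by rewrite -[_ @^-1` _]setTI; exact: measurable_funP.
transitivity (fine (\int[lebesgue_measure]_(x in `[(- M)%R, M%R]) \int[P]_t ((x < Z t)%R%:R)%:E)%E).
  congr fine; apply: eq_integral => x _.
  rewrite probability_tail fineK ?fin_num_measure//.
  rewrite -[X in P X]setIT -integral_indic//; apply: eq_integral => t _.
  by rewrite indicE mem_setE.
rewrite tonelli//; last first.
  apply/measurable_EFinP.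
  rewrite (_ : (fun _ => _) = \1_[set z : T * R | z.2 < Z z.1]); last first.
    by apply/funext => z; rewrite indicE mem_setE.
  apply: measurable_indic; rewrite -[X in measurable X]setTI.
  apply: (measurable_fun_ltr _ _ measurableT (Y := [set true])) => //.
  by apply: measurableT_comp => //; exact: measurable_fst.
have E t : (\int[lebesgue_measure]_(x in `[(- M)%R, M%R]) ((x < Z t)%R%:R)%:E = (Z t + M)%:E)%E.
  have ist : lebesgue_measure.-integrable `[- M, M]
      (EFin \o (fun x : R => (x < Z t)%R%:R : R)).
    apply: (@bounded_integrable _ _ _ _ _ _ 1) => //.
    - exact: lebesgue_itv_lty.
    - rewrite (_ : (fun _ => _) = \1_[set` `]-oo, Z t[]); last first.
        by apply/funext => x; rewrite indicE mem_setE in_itv.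
      exact: measurable_indic.
    - by move=> x _; case: (x < Z t)%R; rewrite ?normr1 ?normr0.
  rewrite -(Rintegral_step (ZM t)) /Rintegral fineK//.
  exact: integrable_fin_num ist.
under eq_integral do rewrite E.
rewrite -[LHS]/(\int[P]_t (Z t + M)) RintegralD//; first by rewrite probability_Rintegral_cst.
- apply: (@bounded_integrable _ _ _ _ _ Z M) => //; first exact: RV_probability_lty.
  by move=> t _; rewrite ler_norml.
- apply: (@bounded_integrable _ _ _ _ _ (fun=> M) `|M|) => //.
  exact: RV_probability_lty.
Qed.

End TailExpectation.

Section RankDependentUtility.
Context d (T : measurableType d) (R : realType) (P : probability T R).
Context (a b : R) (u : R -> R) (hu : increasing_on `[a, b] u).
Implicit Types (X : rv_on P a b) (h : R -> R).

Lemma util_bound : exists2 M, 0 < M & forall x, x \in `[a, b] -> - M <= u x <= M.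
Proof.
exists (`|u a| + `|u b| + 1); first by rewrite ltr_wpDl// addr_ge0.
move=> x; rewrite in_itv /= => /andP[ax xb].
have ab := le_trans ax xb.
have h1 : u a <= u x by apply: hu; rewrite // in_itv /= ?lexx ?ax.
have h2 : u x <= u b by apply: hu; rewrite // in_itv /= ?lexx ?ax ?ab.
have := ler_norm (u b); have := ler_norm (- u a); rewrite normrN.
have := normr_ge0 (u a); have := normr_ge0 (u b).
lra.
Qed.

Definition util_tail X (x : R) := fine (P [set t | x < u (rv X t)]).

Lemma util_tail_itv X x : util_tail X x \in `[0, 1].
Proof.
have E := probability_tail (util hu X) x; rewrite /util_tail.
rewrite in_itv /= fine_ge0//= -E.
by rewrite gerBl fine_ge0.
Qed.

Lemma util_tail_le X x y : x <= y -> util_tail X y <= util_tail X x.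
Proof.
move=> xy; rewrite /util_tail -!(probability_tail (util hu X)).
by rewrite lerB// fine_le// ?fin_num_measure// cdf_nondecreasing.
Qed.

Lemma util_tail_comp_measurable h X : distortion h ->
  measurable_fun setT (fun x => h (util_tail X x)).
Proof.
move=> [_ hmono _ _]; apply: nonincreasing_measurable => // x y xy.
by apply: hmono; rewrite ?util_tail_itv// util_tail_le.
Qed.

Lemma distortion_tail_itv h X x : distortion h -> 0 <= h (util_tail X x) <= 1.
Proof.
by move=> [h01 _ _ _]; have := h01 _ (util_tail_itv X x); rewrite in_itv.
Qed.

Lemma rduE h X (M : R) : distortion h -> 0 < M ->
  (forall x, x \in `[a, b] -> - M <= u x <= M) ->
  rdu hu h X = \int[lebesgue_measure]_(x in `[- M, M]) h (util_tail X x) - M.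
Proof.
move=> dh M0 uM; rewrite -(@tail_integralE _ _ M)//.
- rewrite /rdu; congr (_ + _); apply: eq_Rintegral => x _;
    by rewrite (probability_tail (util hu X)).
- exact: util_tail_comp_measurable.
- by move=> x; exact: distortion_tail_itv.
- have [_ _ _ h1] := dh; move=> x xM; rewrite /util_tail.
  rewrite (_ : [set t | _] = setT) ?probability_setT//.
  apply/seteqP; split => // t _ /=; apply: lt_le_trans xM _.
  by have /andP[] := uM _ (rv_itv X t).
- have [_ _ h0 _] := dh; move=> x xM; rewrite /util_tail.
  rewrite (_ : [set t | _] = set0) ?measure0//.
  apply/seteqP; split => // t /=; apply/negP; rewrite -leNgt.
  by have /andP[_ /le_trans] := uM _ (rv_itv X t); apply.
Qed.

Lemma distortion_tail_integrable h X (M : R) : distortion h ->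
  lebesgue_measure.-integrable `[- M, M] (EFin \o (fun x => h (util_tail X x))).
Proof.
move=> dh.
apply: (@bounded_integrable _ _ _ _ _ _ 1) => //.
- exact: lebesgue_itv_lty.
- by apply: measurable_funTS; exact: util_tail_comp_measurable.
- by move=> x _; have /andP[h0 h1] := distortion_tail_itv X x dh; rewrite ger0_norm.
Qed.

Lemma rdu_affine h1 h2 h (l : R) X : distortion h1 -> distortion h2 -> distortion h ->
  (forall s, s \in `[0, 1] -> h s = l * h1 s + (1 - l) * h2 s) ->
  rdu hu h X = l * rdu hu h1 X + (1 - l) * rdu hu h2 X.
Proof.
move=> d1 d2 dh hE; have [M M0 uM] := util_bound.
rewrite !(rduE _ _ M0 uM)//.
have -> : \int[lebesgue_measure]_(x in `[- M, M]) h (util_tail X x) =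
    \int[lebesgue_measure]_(x in `[- M, M])
      (l * h1 (util_tail X x) + (1 - l) * h2 (util_tail X x)).
  by apply: eq_Rintegral => x _; rewrite hE// util_tail_itv.
have i1 := distortion_tail_integrable X M d1.
have i2 := distortion_tail_integrable X M d2.
rewrite RintegralD//; last 2 first.
- exact: (integrableZl _ _ i1).
- exact: (integrableZl _ _ i2).
by rewrite !RintegralZl//; ring.
Qed.

Lemma rdu_id X : rdu hu id X = \int[P]_t u (rv X t).
Proof.
have [M M0 uM] := util_bound.
have did : distortion (id : R -> R).
  by split => // x y _ _.
rewrite (rduE _ did M0 uM); apply/eqP; rewrite subr_eq; apply/eqP.
rewrite -(Rintegral_tail (Z := util hu X))//; last by move=> t; exact: uM (rv_itv X t).
by apply: eq_Rintegral => x _; rewrite probability_tail.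
Qed.

End RankDependentUtility.

Section RankDependentUtilityFormulas.
Context d (T : measurableType d) (R : realType) (P : probability T R).
Context (a b : R) (u : R -> R) (hu : increasing_on `[a, b] u).
Implicit Types (X : rv_on P a b) (h : R -> R).

Lemma distortion_id : distortion (id : R -> R).
Proof. by split => // x y. Qed.

Lemma distortion_one : distortion (fun s : R => (s == 1)%R%:R : R).
Proof.
split; rewrite ?eqxx//=; last by rewrite eq_sym oner_eq0.
  by move=> s _; rewrite in_itv /=; case: eqP => _; rewrite ?lexx ?ler01.
move=> x y; rewrite !in_itv /= => /andP[_ x1] /andP[_ y1] xy.
rewrite ler_nat; case: (eqVneq x 1) => // xE.
by rewrite (_ : y == 1)// eq_le y1 -xE.
Qed.

Lemma Rintegral_step_le (M c : R) : - M <= c <= M ->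
  \int[lebesgue_measure]_(x in `[- M, M]) (x <= c)%R%:R = c + M.
Proof.
move=> /andP[Mc cM].
transitivity (\int[lebesgue_measure]_(x in `[- M, c]) (cst 1 x : R)).
  rewrite Rintegral_mkcond [RHS]Rintegral_mkcond; congr Rintegral.
  apply/funext => x; rewrite /patch !mem_setE !in_itv /=.
  case: (leP (- M) x) => //= Mx; case: (leP x c) => xc.
    by rewrite (le_trans xc cM).
  by case: ifP.
by rewrite Rintegral_itv_cst// mul1r opprK.
Qed.

Lemma step_integrable (M c : R) : lebesgue_measure.-integrable `[- M, M]
  (EFin \o (fun x : R => (x < c)%R%:R : R)).
Proof.
apply: (@bounded_integrable _ _ _ _ _ _ 1) => //.
- exact: lebesgue_itv_lty.
- rewrite (_ : (fun _ => _) = \1_[set` `]-oo, c[]); last first.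
    by apply/funext => x; rewrite indicE mem_setE in_itv.
  exact: measurable_indic.
- by move=> x _; case: (x < c)%R; rewrite ?normr1 ?normr0.
Qed.

Lemma step_le_integrable (M c : R) : lebesgue_measure.-integrable `[- M, M]
  (EFin \o (fun x : R => (x <= c)%R%:R : R)).
Proof.
apply: (@bounded_integrable _ _ _ _ _ _ 1) => //.
- exact: lebesgue_itv_lty.
- rewrite (_ : (fun _ => _) = \1_[set` `]-oo, c]]); last first.
    by apply/funext => x; rewrite indicE mem_setE in_itv.
  exact: measurable_indic.
- by move=> x _; case: (x <= c)%R; rewrite ?normr1 ?normr0.
Qed.

Lemma cdf_util_eq0 X x : (cdf (util hu X) x == 0%E) = (util_tail u X x == 1).
Proof.
rewrite /util_tail -(probability_tail (util hu X)).
rewrite -[RHS]subr_eq0 addrAC subrr sub0r oppr_eq0 fine_eq0//.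
exact: fin_num_measure.
Qed.

(** The distorted tail lies between the indicators of x < m and of x <= m, with m the essential
    minimum. Both have the same integral, so its value at m does not matter. *)
Lemma rdu_one X : rdu hu (fun s => (s == 1)%R%:R) X = ess_min (util hu X).
Proof.
have [M M0 uM] := util_bound hu.
rewrite (rduE _ _ distortion_one M0 uM).
set S := [set x : R | (0 < cdf (util hu X) x)%E].
have SE x : S x <-> util_tail u X x != 1.
  by rewrite -cdf_util_eq0 /S /= lt_neqAle eq_sym measure_ge0 andbT.
have tail1 x : x < - M -> util_tail u X x = 1.
  move=> xM; rewrite /util_tail (_ : [set t | _] = setT) ?probability_setT//.
  apply/seteqP; split => // t _ /=; apply: lt_le_trans xM _.
  by have /andP[] := uM _ (rv_itv X t).
have tail0 x : M <= x -> util_tail u X x = 0.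
  move=> xM; rewrite /util_tail (_ : [set t | _] = set0) ?measure0//.
  apply/seteqP; split => // t /=; apply/negP; rewrite -leNgt.
  by have /andP[_ /le_trans] := uM _ (rv_itv X t); apply.
have SM : S M by apply/SE; rewrite tail0// eq_sym oner_eq0.
have Slb : lbound S (- M).
  by move=> x /SE; apply: contraR; rewrite -ltNge => /tail1 ->.
have hS : has_inf S by split; [exists M | exists (- M)].
have mM : - M <= inf S <= M.
  by apply/andP; split; [apply: lb_le_inf => //; exists M | apply: ge_inf => //; exists (- M)].
have below x : x < inf S -> util_tail u X x = 1.
  move=> xm; apply/eqP; apply: contraTT xm => /SE Sx; rewrite -leNgt.
  by apply: ge_inf => //; exists (- M).
have above x : inf S < x -> util_tail u X x != 1.
  move=> mx; have [s Ss sx] := inf_lt (ex_intro _ M SM) mx.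
  move/SE: Ss => s1; rewrite lt_eqF//.
  apply: le_lt_trans (util_tail_le hu X (ltW sx)) _.
  by rewrite lt_neqAle s1; have := util_tail_itv hu X s; rewrite in_itv => /andP[].
rewrite /ess_min -/S; apply/eqP; rewrite subr_eq; apply/eqP/le_anti/andP; split.
  rewrite -(Rintegral_step_le mM); apply: le_Rintegral => //.
  - exact: distortion_tail_integrable distortion_one.
  - exact: step_le_integrable.
  - move=> x _; rewrite ler_nat; case: (leP x (inf S)) => [_|/above/negPf ->]//.
    exact: leq_b1.
rewrite -(Rintegral_step mM); apply: le_Rintegral => //.
- exact: step_integrable.
- exact: distortion_tail_integrable distortion_one.
- by move=> x _; rewrite ler_nat; case: (ltP x (inf S)) => // /below ->; rewrite eqxx.
Qed.

Lemma eq_rdu h1 h2 X : {in `[0, 1], h1 =1 h2} ->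
  rdu hu h1 X = rdu hu h2 X.
Proof.
move=> hE; rewrite /rdu; congr (_ + _); apply: eq_Rintegral => x _;
  by rewrite (probability_tail (util hu X)) hE// (util_tail_itv hu).
Qed.

(** On [0, 1], h is l times the identity plus (1 - l) times the indicator of s = 1, and [rdu] is
    affine in h. *)
Lemma rdu_mixture h (l : R) X : distortion h ->
  (forall s, s \in `[0, 1] -> h s = l * s * (s < 1)%R%:R + (s == 1)%R%:R) ->
  rdu hu h X = l * \int[P]_t u (rv X t) + (1 - l) * ess_min (util hu X).
Proof.
move=> dh hE; rewrite -rdu_one -(rdu_id hu); apply: rdu_affine => //.
- exact: distortion_id.
- exact: distortion_one.
- move=> s s01; rewrite hE//; move: s01; rewrite in_itv /= => /andP[_].
  by rewrite le_eqVlt => /predU1P[->|s1]; rewrite ?eqxx ?ltxx ?s1 ?(lt_eqF s1) /=; ring.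
Qed.

End RankDependentUtilityFormulas.

Section UniformRV.
Context d (T : measurableType d) (R : realType) (P : probability T R).
Context (a b : R) (N : nat) (idx : T -> nat).
Hypotheses (midx : measurable_fun setT idx) (idx_lt : forall t, (idx t < N)%N).

Lemma measurable_uniform (y : nat -> R) : measurable_fun setT (y \o idx).
Proof. exact: measurableT_comp. Qed.

Lemma uniform_rv (y : nat -> R) : (forall i, (i < N)%N -> a <= y i <= b) ->
  {X : rv_on P a b | forall t, rv X t = y (idx t)}.
Proof.
move=> yab.
pose Z : {RV P >-> R} := mfun_Sub (mem_set (measurable_uniform y)).
have Zab t : Z t \in `[a, b] by rewrite in_itv /=; exact: yab.
by exists (RvOn Zab).
Qed.

Hypothesis Pidx : forall i, (i < N)%N -> P (idx @^-1` [set i]) = (N%:R^-1)%:E.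

(** As y is decreasing, the event u(X) > x is an initial segment of m indices ([cut]), of
    probability m / N, and h(m / N) telescopes into the first m weights. The distorted tail is thus
    a weighted sum of step functions. *)
Lemma rdu_uniform (u h : R -> R) (hu : increasing_on `[a, b] u) (X : rv_on P a b)
    (y : nat -> R) : distortion h -> (0 < N)%N ->
  (forall t, rv X t = y (idx t)) ->
  (forall i, (i < N)%N -> a <= y i <= b) ->
  (forall i j, (i <= j < N)%N -> y j <= y i) ->
  rdu hu h X = \sum_(i < N) (h (i.+1%:R / N%:R) - h (i%:R / N%:R)) * u (y i).
Proof.
move=> dh N0 XE yab ymono.
have [M M0 uM] := util_bound hu.
have uyM i : (i < N)%N -> - M <= u (y i) <= M.
  by move=> iN; apply: uM; rewrite in_itv /= yab.
pose w i := h (i.+1%:R / N%:R) - h (i%:R / N%:R).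
have [h01 hmono h0 h1] := dh.
have NN : N%:R / N%:R = 1 :> R by rewrite divff// pnatr_eq0 -lt0n.
have sumw m : \sum_(i < m) w i = h (m%:R / N%:R).
  rewrite -(big_mkord xpredT w) telescope_sumr//.
  by rewrite mul0r h0 subr0.
have cut x : exists2 m, (m <= N)%N & forall i, (i < N)%N -> (x < u (y i)) = (i < m)%N.
  have uymono i j : (i <= j < N)%N -> u (y j) <= u (y i).
    move=> ij; have /andP[ij' jN] := ij.
    by apply: hu; rewrite ?in_itv /= ?yab ?ymono// (leq_ltn_trans ij' jN).
  elim: (N) uymono => [_|n IH um]; first by exists 0%N.
  have [i j /andP[ij jn]|m mn mE] := IH.
    by apply: um; rewrite ij ltnW.
  have [mn'|] := ltnP m n.
    exists m; first exact: leqW.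
    move=> i; rewrite ltnS leq_eqVlt => /predU1P[->|]; last exact: mE.
    rewrite [RHS]ltnNge (ltnW mn')/=; apply/negP => xn.
    suff : x < u (y m) by rewrite mE// ltnn.
    by apply: lt_le_trans xn _; apply: um; rewrite (ltnW mn') /=.
  rewrite leq_eqVlt ltnNge mn orbF => /eqP nm; subst m.
  have [xn|xn] := ltP x (u (y n)).
    exists n.+1 => // i; rewrite ltnS leq_eqVlt => /predU1P[->|iltn].
      by rewrite xn eqxx.
    by rewrite mE// iltn orbT.
  exists n => // i; rewrite ltnS leq_eqVlt => /predU1P[->|]; last exact: mE.
  by rewrite ltnn ltNge xn.
rewrite (rduE _ _ dh M0 uM).
have -> : \int[lebesgue_measure]_(x in `[- M, M]) h (util_tail u X x) =
    \int[lebesgue_measure]_(x in `[- M, M]) (\sum_(i < N) w i * (x < u (y i))%R%:R).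
  apply: eq_Rintegral => x _; have [m mN mE] := cut x.
  rewrite /util_tail (_ : [set t | _] = [set t | (x < u (y (idx t)))%R]); last first.
    by apply/seteqP; split => t /=; rewrite XE.
  rewrite (uniform_prob midx idx_lt Pidx (fun i => x < u (y i))%R).
  have -> : \sum_(i < N) (x < u (y i))%R%:R = m%:R :> R.
    transitivity (\sum_(i < N | (i < m)%N) 1 : R).
      by rewrite [RHS]big_mkcond /=; apply: eq_bigr => i _; rewrite mE//; case: ifP.
    rewrite (big_ord_narrow mN) /=.
    by rewrite big_const_ord iter_addr_0.
  rewrite -sumw.
  transitivity (\sum_(i < N | (i < m)%N) w i : R).
    by rewrite (big_ord_narrow mN).
  rewrite [LHS]big_mkcond /=; apply: eq_bigr => i _; rewrite mE//.
  by case: ifP; rewrite ?mulr1 ?mulr0.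
have iint (i : 'I_N) : lebesgue_measure.-integrable `[- M, M]
    (EFin \o (fun x : R => w i * (x < u (y i))%R%:R : R)).
  exact: (integrableZl _ _ (step_integrable M (u (y i)))).
rewrite Rintegral_bigsum//.
under eq_bigr => i _.
  rewrite RintegralZl ?Rintegral_step ?uyM//; last exact: step_integrable.
  rewrite mulrDr; over.
by rewrite big_split /= -mulr_suml sumw NN h1 mul1r addrK.
Qed.

End UniformRV.

(** * Iterated distribution functions *)

Section IteratedDistribution.
Context {R : realType}.

Lemma horner_continuous (p : {poly R}) (x : R) : {for x, continuous (horner p)}.
Proof.
apply: differentiable_continuous; apply/derivable1_diffP.
by have [] := is_derive_poly p x.
Qed.

Lemma integral_poly (p : {poly R}) (x y : R) : x < y ->
  (\int[lebesgue_measure]_(z in `[x, y]) (p^`()%R.[z])%:E = (p.[y] - p.[x])%:E)%E.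
Proof.
move=> xy; rewrite (@continuous_FTC2 _ (horner p^`()) (horner p))//.
- by apply: continuous_subspaceT => z; exact: horner_continuous.
- split.
  + by move=> z _; have [] := is_derive_poly p z.
  + by apply: cvg_at_right_filter; exact: horner_continuous.
  + by apply: cvg_at_left_filter; exact: horner_continuous.
- by move=> z _; rewrite derive1E; have [_] := is_derive_poly p z.
Qed.

Lemma integral_kern k (x y : R) :
  (\int[lebesgue_measure]_(z in `]-oo, y]) (kern k (z - x))%:E =
   (kern k.+1 (y - x))%:E)%E.
Proof.
have [yx|] := ltP y x.
  rewrite integral0_eq; last first.
    move=> z /=; rewrite in_itv /= => zy; congr (_%:E).
    case: k => [|k] /=; first by rewrite leNgt (_ : z - x < 0)//; lra.
    by rewrite /pospow max_l ?expr0n ?mul0r//; lra.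
  by rewrite /= /pospow max_l ?expr0n ?mul0r//; lra.
pose p : {poly R} := k.+1`!%:R^-1 *: ('X - x%:P) ^+ k.+1.
have pE z : x <= z -> kern k (z - x) = (p^`()).[z].
  move=> xz; rewrite derivZ deriv_exp derivXsubC mul1r hornerZ hornerMn horner_exp !hornerE /=.
  have -> : k.+1`!%:R^-1 * ((z - x) ^+ k *+ k.+1) = (z - x) ^+ k / k`!%:R.
    rewrite factS natrM -[_ ^+ k *+ _]mulr_natr.
    have : k.+1%:R != 0 :> R by rewrite pnatr_eq0.
    have : k`!%:R != 0 :> R by rewrite pnatr_eq0 -lt0n fact_gt0.
    by move: (k.+1%:R : R) (k`!%:R : R) => r s s0 r0; field; rewrite ?r0 ?s0.
  case: (k) => [|m] /=; first by rewrite subr_ge0 xz expr0 divr1.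
  by rewrite /pospow max_r// subr_ge0.
rewrite le_eqVlt => /predU1P[<-|xy].
  rewrite subrr /kern /pospow max_l// expr0n mul0r.
  rewrite [LHS](_ : _ = \int[lebesgue_measure]_(z in [set x]) (kern k (z - x))%:E)%E.
    by rewrite integral_set1.
  rewrite integral_mkcond [RHS]integral_mkcond; apply: eq_integral => z _.
  rewrite /patch mem_setE in_itv /=; case: (leP z x) => zx; last first.
    by rewrite memNset//= => zE; rewrite zE ltxx in zx.
  case: ifPn; first by [].
  rewrite notin_setE /= => /eqP zx'.
  have {}zx : z < x by rewrite lt_neqAle zx'.
  case: k {p pE} => [|k] /=; first by rewrite leNgt (_ : z - x < 0)//; lra.
  by rewrite /pospow max_l ?expr0n ?mul0r//; lra.
transitivity (\int[lebesgue_measure]_(z in `[x, y]) (p^`()%R.[z])%:E)%E.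
  rewrite integral_mkcond [RHS]integral_mkcond; apply: eq_integral => z _.
  rewrite /patch !mem_setE !in_itv /=; case: (leP z y) => zy; rewrite ?andbF// andbT.
  case: (leP x z) => [xz|zx]; first by rewrite pE.
  case: k {p pE} => [|k] /=; first by rewrite leNgt (_ : z - x < 0)//; lra.
  by rewrite /pospow max_l ?expr0n ?mul0r//; lra.
rewrite integral_poly// /p !hornerZ !horner_exp !hornerE /= subrr expr0n /= mulr0 subr0.
by rewrite /pospow max_r ?subr_ge0 ?ltW// mulrC.
Qed.

Lemma pospow_measurable k : measurable_fun setT (@pospow R k).
Proof.
by apply: measurable_funX; exact: measurable_maxr.
Qed.

Lemma kern_measurable k : measurable_fun setT (@kern R k).
Proof.
case: k => [|k]; last by apply: measurable_funM => //; exact: pospow_measurable.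
rewrite (_ : kern 0 = \1_[set` `[0%R, +oo[]); last first.
  by apply/funext => x; rewrite indicE mem_setE in_itv /= andbT.
exact: measurable_indic.
Qed.

Context d (T : measurableType d) (P : probability T R).

(** Tonelli moves the iterated integrations under the expectation, which turns dominance into a
    comparison of expectations of kernels. Index k + 1 goes with the kernel of order k. *)
Lemma icdfE (X : {RV P >-> R}) k x :
  (icdf X k.+1 x = \int[P]_t (kern k (x - X t))%:E)%E.
Proof.
elim: k x => [|k IH] x.
  have mA : measurable (X @^-1` [set` `]-oo, x]]).
    by rewrite -[_ @^-1` _]setTI; exact: measurable_funP.
  transitivity (\int[P]_t (\1_(X @^-1` [set` `]-oo, x]]) t)%:E)%E.
    by rewrite integral_indic// setIT.
  apply: eq_integral => t _; congr (_%:E).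
  rewrite indicE /= subr_ge0 (_ : (t \in _) = (X t <= x))//.
  by apply/idP/idP; rewrite inE /= in_itv.
transitivity (\int[lebesgue_measure]_(z in `]-oo, x])
    \int[P]_t (kern k (z - X t))%:E)%E.
  by apply: eq_integral => z _; exact: IH.
rewrite tonelli//; last first.
- by move=> t z; rewrite lee_fin kern_ge0.
- apply/measurable_EFinP; apply: measurableT_comp; first exact: kern_measurable.
  apply: measurable_funB; first exact: measurable_snd.
  by apply: measurableT_comp => //; exact: measurable_fst.
by apply: eq_integral => t _; rewrite integral_kern.
Qed.

End IteratedDistribution.

(** * Necessity *)

Section KernelGap.
Context {R : realType}.

Lemma kern_homo k : {homo (@kern R k) : x y / x <= y}.
Proof.
case: k => [|k] x y xy /=; first by rewrite ler_nat; case: leP => //= x0; rewrite (le_trans x0 xy).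
have p (z : R) : 0 <= Num.max 0 z by rewrite le_max lexx.
rewrite ler_wpM2r ?invr_ge0// /pospow lerXn2r ?nnegrE ?p//.
by rewrite ge_max !le_max lexx xy orbT.
Qed.

Lemma kern_eq0 k (y : R) : y < 0 -> kern k y = 0.
Proof.
move=> y0; case: k => [|k] /=; first by rewrite leNgt y0.
by rewrite /pospow max_l ?ltW// expr0n mul0r.
Qed.

Lemma kern_exp k (y : R) : 0 <= y -> kern k y = y ^+ k / k`!%:R.
Proof.
move=> y0; case: k => [|k] /=; first by rewrite y0 expr0 divr1.
by rewrite /pospow max_r.
Qed.

Variables (N : nat) (x y : nat -> R).

(** N times the difference at e of the iterated distribution functions of index k + 1, for the
    uniform laws on the y i and on the x i; a nonnegative gap favours x. *)
Definition kern_gap k (e : R) := \sum_(i < N) (kern k (e - y i) - kern k (e - x i)).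

Lemma has_slope_kern_gap k e : has_slope setT (kern_gap k.+2) e (kern_gap k.+1 e).
Proof.
rewrite /kern_gap; elim: N => [|m IH].
  rewrite big_ord0; apply: has_slope_eq (has_slope_cst _ 0 e) => z.
  by rewrite big_ord0.
rewrite big_ord_recr /=.
apply: has_slope_eq (has_slopeD IH (has_slopeB (has_slope_shift (has_slope_kern k _))
  (has_slope_shift (has_slope_kern k _)))) => z.
by rewrite big_ord_recr.
Qed.

(** Each gap is the derivative of the next one and vanishes left of a, so nonnegativity on the whole
    line integrates upwards. The start is at order k + 1 >= 1 because [kern 1] has a corner. *)
Lemma kern_gap_ge0 (a : R) k m : (forall i, (i < N)%N -> a <= x i /\ a <= y i) ->
  (forall e, 0 <= kern_gap k.+1 e) -> (k < m)%N -> forall e, 0 <= kern_gap m e.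
Proof.
move=> axy gap0; case: m => // m; rewrite ltnS => km.
rewrite -(subnK km); elim: (m - k)%N => [|j IH] e //.
have gapl z : z < a -> kern_gap (j.+1 + k).+1 z = 0.
  move=> za; rewrite /kern_gap big1// => i _.
  have [ax ay] := axy i (ltn_ord i).
  by rewrite !kern_eq0 ?subrr//; lra.
have /(_ (Num.min e (a - 1)) e) := has_slope_homoT (has_slope_kern_gap (j + k)) IH.
by rewrite -addSn gapl ?ge_min ?lexx// ?gt_min ?ltrBlDr ?ltrDl ?ltr01 ?orbT//; apply.
Qed.

End KernelGap.

Section UniformDominance.
Context d (T : measurableType d) (R : realType) (P : probability T R).
Context (a b : R).

Lemma kern_rv_integrable (X : rv_on P a b) k e :
  P.-integrable setT (EFin \o (fun t => kern k (e - rv X t))).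
Proof.
apply: (@bounded_integrable _ _ _ _ _ _ (kern k (e - a))) => //.
- exact: RV_probability_lty.
- by apply: measurableT_comp; [exact: kern_measurable|exact: measurable_funB].
- move=> t _; rewrite ger0_norm ?kern_ge0// kern_homo//.
  by have := rv_itv X t; rewrite in_itv /= => /andP[? _]; lra.
Qed.

Lemma icdf_Rintegral (X : rv_on P a b) k e :
  icdf X k.+1 e = (\int[P]_t kern k (e - rv X t))%:E.
Proof.
rewrite icdfE /Rintegral fineK//.
exact: integrable_fin_num (kern_rv_integrable X k e).
Qed.

Context (N : nat) (idx : T -> nat).
Hypotheses (midx : measurable_fun setT idx) (idx_lt : forall t, (idx t < N)%N).
Hypothesis Pidx : forall i, (i < N)%N -> P (idx @^-1` [set i]) = (N%:R^-1)%:E.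

(** Vanishing gaps at b up to order k settle the boundary conditions of index at most k + 1; the
    others, and the comparison of index n, follow from order k + 1 by integration. A comparison of
    order k + 2 thus serves every larger n. *)
Lemma sd_uniform (X Y : rv_on P a b) (x y : nat -> R) (n k : nat) :
  (forall t, rv X t = x (idx t)) -> (forall t, rv Y t = y (idx t)) ->
  (forall i, (i < N)%N -> a <= x i <= b) ->
  (forall i, (i < N)%N -> a <= y i <= b) ->
  (forall e, 0 <= kern_gap N x y k.+1 e) ->
  (forall j, (j <= k)%N -> kern_gap N x y j b = 0) ->
  (k.+2 <= n)%N -> sd_ge n X Y.
Proof.
move=> XE YE xab yab gap0 gapb kn.
have key m e : 0 <= kern_gap N x y m e -> (icdf X m.+1 e <= icdf Y m.+1 e)%E.
  move=> g0; rewrite !icdf_Rintegral lee_fin.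
  under eq_Rintegral do rewrite XE.
  under [leRHS]eq_Rintegral do rewrite YE.
  rewrite (uniform_mean midx idx_lt Pidx (fun i => kern m (e - x i))).
  rewrite (uniform_mean midx idx_lt Pidx (fun i => kern m (e - y i))).
  by rewrite ler_wpM2r ?invr_ge0// -subr_ge0 -sumrB.
have ge0 m : (k < m)%N -> forall e, 0 <= kern_gap N x y m e.
  apply: (@kern_gap_ge0 _ _ _ _ a) => // i iN.
  by have /andP[? _] := xab i iN; have /andP[? _] := yab i iN.
split=> [e _|m /andP[m0 mn]].
  by case: n kn => // n; rewrite ltnS => kn; apply: key; exact: ge0.
case: m m0 mn => // m _ mn; apply: key.
have [km|mk] := ltnP k m; first exact: ge0.
by rewrite gapb.
Qed.

End UniformDominance.

(** * Comparisons confined to consecutive ranks *)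

Section BlockComparison.
Context d (T : measurableType d) (R : realType) (P : probability T R).
Context (a b : R) (u h : R -> R) (hu : increasing_on `[a, b] u) (n : nat).
Hypotheses (noatom : atomless P) (ab : a < b) (dh : distortion h).
Hypothesis cons : forall X Y : rv_on P a b, sd_ge n X Y -> rdu hu h Y <= rdu hu h X.

Lemma sum_block (c : nat -> R) N j m : (j + m <= N)%N ->
  (forall i, (i < j)%N || (j + m <= i)%N -> c i = 0) ->
  \sum_(i < N) c i = \sum_(i < m) c (j + i)%N.
Proof.
move=> jmN c0; rewrite -(big_mkord xpredT c) (@big_cat_nat _ _ _ j) ?(leq_trans (leq_addr m j))//=.
rewrite big_nat big1 ?add0r; last by move=> i /andP[_ ij]; rewrite c0// ij.
rewrite (@big_cat_nat _ _ _ (j + m)) ?leq_addr//=.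
rewrite [X in _ + X]big_nat [X in _ + X]big1 ?addr0; last first.
  by move=> i /andP[mi _]; rewrite c0// mi orbT.
rewrite -[X in \sum_(X <= _ < _) _]add0n big_addn addKn big_mkord.
by apply: eq_bigr => i _; rewrite addnC.
Qed.

Definition weight N i := h (i.+1%:R / N%:R) - h (i%:R / N%:R).

(** Ranks run from the best outcome down. The list s occupies the ranks from j on; better ranks get
    b and, through the default value of [nth], worse ranks get a. A decreasing s gives a decreasing
    family, and two lists of equal length give laws that differ on these ranks only. *)
Definition block (s : seq R) j i := if (i < j)%N then b else nth a s (i - j).

Lemma block_itv s j i : all (fun z => a <= z <= b) s -> a <= block s j i <= b.
Proof.
move=> /allP sab; rewrite /block; case: ltnP => _; first by rewrite lexx ltW.
have [is_|si] := ltnP (i - j) (size s); first exact/sab/mem_nth.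
by rewrite nth_default// lexx ltW.
Qed.

Lemma block_decr s j i i' : all (fun z => a <= z <= b) s ->
  sorted (fun z z' => z' <= z) s -> (i <= i')%N -> block s j i' <= block s j i.
Proof.
move=> sab ss ii'; rewrite /block; case: (ltnP i j) => ij.
  by have /andP[] := block_itv j i' sab.
rewrite ltnNge (leq_trans ij ii') /=.
have [is'|si] := ltnP (i' - j) (size s); last first.
  rewrite (nth_default _ si).
  by have /andP[] := block_itv j i sab; rewrite /block ltnNge ij.
have tr : transitive (fun z z' : R => z' <= z) by move=> x y z xy /le_trans; apply.
apply: (sorted_leq_nth tr) => //; rewrite ?inE ?leq_sub2r//.
exact: leq_ltn_trans (leq_sub2r _ ii') is'.
Qed.

Lemma block_compare s s' j N k : size s = size s' ->
  all (fun z => a <= z <= b) s -> all (fun z => a <= z <= b) s' ->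
  sorted (fun z z' => z' <= z) s -> sorted (fun z z' => z' <= z) s' ->
  (j + size s <= N)%N -> (0 < N)%N ->
  (forall e, 0 <= kern_gap (size s) (nth a s) (nth a s') k.+1 e) ->
  (forall i, (i <= k)%N -> kern_gap (size s) (nth a s) (nth a s') i b = 0) ->
  (k.+2 <= n)%N ->
  \sum_(i < size s) weight N (j + i) * u (nth a s' i) <=
  \sum_(i < size s) weight N (j + i) * u (nth a s i).
Proof.
move=> ss' sab s'ab srt srt' jN N0 g0 gb kn.
have [idx [midx idx_lt Pidx]] := uniform_index noatom N0.
have [X XE] := uniform_rv P midx idx_lt (fun i _ => block_itv j i sab).
have [Y YE] := uniform_rv P midx idx_lt (fun i _ => block_itv j i s'ab).
have out i : (i < j)%N || (j + size s <= i)%N -> block s j i = block s' j i.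
  rewrite /block; case: ltnP => //= ij si.
  by rewrite !nth_default// -?ss' leq_subRL.
have gapE m e : kern_gap N (block s j) (block s' j) m e =
    kern_gap (size s) (nth a s) (nth a s') m e.
  rewrite /kern_gap; pose c i := kern m (e - block s' j i) - kern m (e - block s j i).
  rewrite (@sum_block c _ j (size s))//; last by move=> i /out E; rewrite /c E subrr.
  by apply: eq_bigr => i _; rewrite /c /block ltnNge leq_addr /= addKn.
have XY : sd_ge n X Y.
  apply: (sd_uniform midx idx_lt Pidx XE YE (k := k)) => //.
  - by move=> i _; exact: block_itv.
  - by move=> i _; exact: block_itv.
  - by move=> e; rewrite gapE.
  - by move=> i ik; rewrite gapE gb.
have := cons XY.
have mono s0 : all (fun z => a <= z <= b) s0 -> sorted (fun z z' => z' <= z) s0 ->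
    forall i i', (i <= i' < N)%N -> block s0 j i' <= block s0 j i.
  by move=> s0ab srt0 i i1 /andP[ii1 _]; exact: block_decr.
rewrite (rdu_uniform midx idx_lt Pidx hu dh N0 XE (fun i _ => block_itv j i sab) (mono _ sab srt)).
rewrite (rdu_uniform midx idx_lt Pidx hu dh N0 YE (fun i _ => block_itv j i s'ab) (mono _ s'ab srt')).
rewrite -subr_ge0 -sumrB => le0; rewrite -subr_ge0 -sumrB; move: le0.
pose c i := weight N i * u (block s j i) - weight N i * u (block s' j i).
rewrite (@sum_block c _ j (size s))//; last by move=> i /out E; rewrite /c E subrr.
congr (0 <= _); apply: eq_bigr => i _.
by rewrite /c /block ltnNge leq_addr /= addKn.
Qed.

(** Pulling z1 and z2 together by e is a mean-preserving contraction, favoured by second-order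
    dominance; [z1 + e <= z2 - e] keeps the upper point at rank j and the lower one at rank j +
    1. *)
Lemma exchange N j z1 z2 e : (1 < n)%N -> (j.+1 < N)%N -> a <= z1 -> 0 <= e ->
  z1 + e <= z2 - e -> z2 <= b ->
  weight N j * (u z2 - u (z2 - e)) <= weight N j.+1 * (u (z1 + e) - u z1).
Proof.
move=> n1 jN az1 e0 z12 z2b.
have := @block_compare [:: z2 - e; z1 + e] [:: z2; z1] j N 0.
rewrite /= !big_ord_recl !big_ord0 /= !andbT !addr0 addn0 /bump /= addn1.
have -> : (a <= z2 - e <= b) && (a <= z1 + e <= b) by apply/andP; split; apply/andP; split; lra.
have -> : (a <= z2 <= b) && (a <= z1 <= b) by apply/andP; split; apply/andP; split; lra.
have -> : z1 <= z2 by lra.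
rewrite z12 addn2 => /(_ erefl isT isT isT isT jN (leq_ltn_trans (leq0n _) jN) _ _ n1).
have gap1 x : 0 <= kern_gap 2 (nth a [:: z2 - e; z1 + e]) (nth a [:: z2; z1]) 1 x.
  rewrite /kern_gap !big_ord_recl big_ord0 /= /pospow !expr1 !divr1 /Num.max.
  by do !case: ifPn; rewrite -?leNgt; lra.
have gap0 i : (i <= 0)%N -> kern_gap 2 (nth a [:: z2 - e; z1 + e]) (nth a [:: z2; z1]) i b = 0.
  rewrite leqn0 => /eqP ->; rewrite /kern_gap !big_ord_recl big_ord0 /= !subr_ge0.
  have -> : z2 - e <= b by lra.
  have -> : z1 + e <= b by lra.
  have -> : z1 <= b by lra.
  by rewrite z2b /=; ring.
by move=> /(_ gap1 gap0); lra.
Qed.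

End BlockComparison.

Lemma archimedean_le0_from {R : realType} (A C : R) N0 :
  (forall N : nat, (N0 <= N)%N -> N%:R * A <= C) -> A <= 0.
Proof.
move=> h; rewrite leNgt; apply/negP => A0.
suff : A <= 0 by rewrite leNgt A0.
apply: (@archimedean_le0 _ _ C) => N.
have := h (N0 + N)%N (leq_addr _ _); apply: le_trans.
by rewrite ler_wpM2r ?ler_nat ?leq_addl// ltW.
Qed.

Lemma geometric_lt {R : realType} (r c : R) : 0 <= r < 1 -> 0 < c ->
  exists m, r ^+ m < c.
Proof.
move=> /andP[r0 r1] c0.
have := @cvg_expr R r; rewrite ger0_norm// => /(_ r1) /cvgrPdist_lt /(_ _ c0)[m _ hm].
exists m; have := hm m (leqnn m); rewrite /= sub0r normrN.
by rewrite ger0_norm// exprn_ge0.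
Qed.

(** * Decision weights and concavity of the utility *)

Section Necessity.
Context d (T : measurableType d) (R : realType) (P : probability T R).
Context (a b : R) (u h : R -> R) (hu : increasing_on `[a, b] u) (n : nat).
Hypotheses (noatom : atomless P) (ab : a < b) (dh : distortion h) (n3 : (2 < n)%N).
Hypothesis cons : forall X Y : rv_on P a b, sd_ge n X Y -> rdu hu h Y <= rdu hu h X.

Let n2 : (1 < n)%N := ltnW n3.

Let u_le x y : a <= x -> x <= y -> y <= b -> u x <= u y.
Proof. by move=> ax xy yb; apply: hu => //; rewrite in_itv /=; apply/andP; split; lra. Qed.

Let grid_itv N i : (i <= N)%N -> (i%:R / N%:R : R) \in `[0, 1].
Proof.
case: N => [|N] iN; first by move: iN; rewrite leqn0 => /eqP ->; rewrite mul0r in_itv /= lexx ler01.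
by rewrite in_itv /= divr_ge0//= ler_pdivrMr// mul1r ler_nat.
Qed.

Lemma distortion_le (s t : R) : 0 <= s -> s <= t -> t <= 1 -> h s <= h t.
Proof.
have [_ hm _ _] := dh.
by move=> s0 st t1; apply: hm => //; rewrite in_itv /=; apply/andP; split; lra.
Qed.

Lemma weight_ge0 N i : (i < N)%N -> 0 <= weight h N i.
Proof.
move=> iN; have := grid_itv iN; have := grid_itv (ltnW iN).
rewrite /weight !in_itv /= => /andP[i0 _] /andP[_ i1].
rewrite subr_ge0; apply: distortion_le => //.
by rewrite ler_wpM2r ?invr_ge0// ler_nat.
Qed.

Lemma weight_le1 N i : (i < N)%N -> weight h N i <= 1.
Proof.
have [h01 _ _ _] := dh.
move=> iN; have := h01 _ (grid_itv iN); have := h01 _ (grid_itv (ltnW iN)).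
by rewrite /weight !in_itv /= => /andP[? _] /andP[_ ?]; lra.
Qed.

Lemma sum_weight N m : \sum_(i < m) weight h N i = h (m%:R / N%:R).
Proof.
have [_ _ h0 _] := dh.
by rewrite -(big_mkord xpredT (weight h N)) telescope_sumr// mul0r h0 subr0.
Qed.

(* If every weight were at most rho times the next one, the weights would grow
   geometrically and h would vanish on [0, 1[. *)
Lemma weight_ratio s0 rho : 0 <= s0 < 1 -> h s0 != 0 -> 0 <= rho < 1 ->
  exists N j, (j.+1 < N)%N /\ rho * weight h N j.+1 < weight h N j.
Proof.
move=> /andP[s00 s01] hs0 /andP[rho0 rho1].
have hs0_gt0 : 0 < h s0.
  have [h01 _ _ _] := dh; rewrite lt_neqAle eq_sym hs0 /=.
  by have := h01 s0; rewrite !in_itv /= s00 ltW// => /(_ isT)/andP[].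
have [m hm] : exists m, rho ^+ m < h s0 by apply: geometric_lt => //; rewrite rho0.
apply: contrapT => none.
have small N j : (j.+1 < N)%N -> weight h N j <= rho * weight h N j.+1.
  by move=> jN; rewrite leNgt; apply/negP => lt; apply: none; exists N, j.
have decay N j : (j < N)%N -> h (j%:R / N%:R) <= rho * h (j.+1%:R / N%:R).
  move=> jN; rewrite -!sum_weight big_ord_recl mulrDr mulr_sumr.
  apply: (@le_trans _ _ (\sum_(i < j) rho * weight h N i.+1)).
    by apply: ler_sum => i _; apply: small; rewrite (leq_trans _ jN)// !ltnS.
  by rewrite lerDr mulr_ge0// weight_ge0// (leq_trans _ jN).
have geom N k : (k <= N)%N -> h ((N - k)%:R / N%:R) <= rho ^+ k.
  have [h01 _ _ _] := dh.
  elim: k => [_|k IH kN].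
    by have := h01 _ (grid_itv (leq_subr 0 N)); rewrite in_itv => /andP[].
  rewrite exprS; apply: le_trans (decay _ _ _) _; first by lia.
  by rewrite ler_wpM2l// -subSn// subSS IH// ltnW.
(* N is large enough for m <= N (1 - s0), so that s0 <= (N - m) / N: the m geometric steps down from
   1 end above s0. *)
pose N := maxn m (Num.bound (m%:R / (1 - s0))).
have mN : (m <= N)%N by exact: leq_maxl.
have s1 : 0 < 1 - s0 by rewrite subr_gt0.
have N0 : (0 < N)%N.
  rewrite lt0n; apply/negP => /eqP NE; move: mN hm; rewrite NE leqn0 => /eqP ->.
  rewrite expr0; have [h01 _ _ _] := dh.
  have := h01 s0; rewrite !in_itv /= s00 ltW// => /(_ isT)/andP[_].
  by rewrite leNgt => /negP.
have : h s0 <= h ((N - m)%:R / N%:R).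
  apply: distortion_le => //.
    rewrite ler_pdivlMr ?ltr0n// natrB//.
    have : m%:R / (1 - s0) <= N%:R.
      apply: (@le_trans _ _ (Num.bound (m%:R / (1 - s0)))%:R).
        by apply/ltW/archi_boundP; rewrite divr_ge0// ltW.
      by rewrite ler_nat leq_maxr.
    by rewrite ler_pdivrMr//; lra.
  by have := grid_itv (leq_subr m N); rewrite in_itv => /andP[].
move=> /le_trans /(_ (geom _ _ mN)); lra.
Qed.

(** For disjoint intervals, [exchange] gives w_j q <= w_(j+1) p for the upper increment q and the
    lower increment p; weights with rho w_(j+1) < w_j yield rho q <= p, with rho as close to 1 as
    desired. *)
Lemma utility_wright s0 : 0 <= s0 < 1 -> h s0 != 0 ->
  forall s t e, a <= s -> s <= t -> 0 <= e -> t + e <= b ->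
  u (t + e) - u t <= u (s + e) - u s.
Proof.
move=> s01 hs0.
have disjoint z1 z2 e : a <= z1 -> 0 <= e -> z1 + e <= z2 - e -> z2 <= b ->
    u z2 - u (z2 - e) <= u (z1 + e) - u z1.
  move=> az1 e0 z12 z2b.
  have D1 : 0 <= u (z1 + e) - u z1 by rewrite subr_ge0 u_le//; lra.
  have D2 : 0 <= u z2 - u (z2 - e) by rewrite subr_ge0 u_le//; lra.
  set p := u (z1 + e) - u z1 in D1 *; set q := u z2 - u (z2 - e) in D2 *.
  rewrite -subr_le0; apply: (@archimedean_le0 _ _ p) => N.
  (* With this rho, rho q <= p reads N (q - p) <= p. *)
  pose rho : R := N%:R / N.+1%:R.
  have rho01 : 0 <= rho < 1 by rewrite divr_ge0//= ltr_pdivrMr// mul1r ltr_nat.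
  have [N' [j [jN wlt]]] := weight_ratio s01 hs0 rho01.
  have ex := exchange noatom ab dh cons n2 jN az1 e0 z12 z2b.
  rewrite -/p -/q in ex.
  have w1 := weight_ge0 jN; have w0 := weight_ge0 (ltnW jN).
  have rq : rho * q <= p.
    move: w1; rewrite le_eqVlt => /predU1P[w1E|w1].
      move: ex wlt; rewrite -w1E mul0r mulr0 => ex wlt.
      have q0 : q <= 0 by rewrite -(pmulr_rle0 _ wlt).
      have -> : q = 0 by apply/eqP; rewrite eq_le q0.
      by rewrite mulr0.
    rewrite -(ler_pM2l w1); apply: le_trans ex.
    by rewrite mulrA (mulrC _ rho) ler_wpM2r// ltW.
  have Nq : N%:R * q <= N.+1%:R * p.
    by move: rq; rewrite /rho mulrAC ler_pdivrMr// => rq; rewrite [leRHS]mulrC.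
  by move: Nq; rewrite -natr1; lra.
move=> s t e hs st e0 te.
have [ste|tse] := leP (s + e) t.
  by have := disjoint s (t + e) e hs e0; rewrite addrK; apply; lra.
(* When [s, s + e] and [t, t + e] overlap, cancelling the common part reduces the claim to the
   disjoint outer pieces [s, t] and [s + e, t + e]. *)
have := disjoint s (t + e) (t - s) hs.
have -> : s + (t - s) = t by ring.
have -> : t + e - (t - s) = s + e by ring.
have ts : 0 <= t - s by lra.
by move=> /(_ ts (ltW tse) te); lra.
Qed.

Section NonTrivial.
Variable s0 : R.
Hypotheses (s01 : 0 <= s0 < 1) (hs0 : h s0 != 0).

Lemma utility_slope x y z : a <= x -> x < y -> y < z -> z <= b ->
  (u z - u y) * (y - x) <= (u y - u x) * (z - y).
Proof.
move=> ax xy yz zb; apply: wright_concave_slope => //.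
  by move=> s t xs st tz; apply: u_le; lra.
by move=> s t e xs st e0 te; apply: (utility_wright s01 hs0) => //; lra.
Qed.

Hypothesis nonconst : nonconstant_on `]a, b] u.

(** By concavity the chord over [x0, y0], where u rises, bounds from below the slopes left of x0,
    and the chord over [a, p] bounds from above those right of p. Taking p midway between a and x0
    leaves room for the second chord; a jump at a only makes L larger. *)
Lemma utility_bilipschitz : exists p q c L, [/\ a < p, p < q, q <= b, 0 < c &
  forall x y, p <= x -> x <= y -> y <= q -> c * (y - x) <= u y - u x <= L * (y - x)].
Proof.
have [x0 [y0 [x0ab y0ab xy0 uxy]]] : exists x0 y0, [/\ a < x0, y0 <= b, x0 < y0 & u x0 < u y0].
  have [x [y [+ + ne]]] := nonconst; rewrite !in_itv /= => /andP[ax xb] /andP[ay yb].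
  have [xy|yx|E] := ltgtP x y; last by rewrite E eqxx in ne.
    by exists x, y; split => //; rewrite lt_neqAle ne u_le// ltW.
  by exists y, x; split => //; rewrite lt_neqAle eq_sym ne u_le// ltW.
pose p := (a + x0) / 2.
have [ap px0] : a < p /\ p < x0 by rewrite /p; lra.
pose c := (u y0 - u x0) / (y0 - x0); pose L := (u p - u a) / (p - a).
have c0 : 0 < c by rewrite divr_gt0// subr_gt0.
exists p, x0, c, L; split => //; first by lra.
move=> x y px; rewrite le_eqVlt => /predU1P[-> _|xy yx0]; first by rewrite !subrr !mulr0 lexx.
apply/andP; split.
  have cx : c * (x0 - x) <= u x0 - u x.
    have xx0 : x < x0 by lra.
    have := utility_slope (_ : a <= x) xx0 xy0 y0ab.
    rewrite /c mulrAC ler_pdivrMr ?subr_gt0//; apply; lra.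
  move: yx0; rewrite le_eqVlt => /predU1P[-> //|yx0].
  have c1 : c * (x0 - y) <= u x0 - u y.
    have := utility_slope (_ : a <= y) yx0 xy0 y0ab.
    rewrite /c mulrAC ler_pdivrMr ?subr_gt0//; apply; lra.
  have := utility_slope (_ : a <= x) xy yx0 (_ : x0 <= b).
  move=> /(_ _ _) H; have {}H := H _ _.
  have {}H : (u x0 - u y) * (y - x) <= (u y - u x) * (x0 - y) by apply: H; lra.
  have yx : 0 < y - x by lra.
  have yx0' : 0 < x0 - y by lra.
  rewrite -(ler_pM2r yx0'); apply: le_trans H.
  by have := ler_wpM2r (ltW yx) c1; lra.
have yb : y <= b by lra.
move: px xy; rewrite le_eqVlt => /predU1P[<- py|px xy].
  have := utility_slope (lexx a) ap py yb.
  by rewrite /L mulrAC ler_pdivlMr ?subr_gt0.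
have xb : x <= b by lra.
have L1 : u x - u p <= L * (x - p).
  have := utility_slope (lexx a) ap px xb.
  by rewrite /L mulrAC ler_pdivlMr ?subr_gt0.
have H := utility_slope (ltW ap) px xy yb.
have xp : 0 < x - p by lra.
have yx : 0 < y - x by lra.
rewrite -(ler_pM2r xp); apply: le_trans H _.
by have := ler_wpM2r (ltW yx) L1; lra.
Qed.

End NonTrivial.
End Necessity.

(** * Third-order comparisons on four ranks *)

Section ThirdOrderExchange.
Context {R : realType}.

Let sq (e z : R) := pospow 2 (e - z).

Lemma sq_spread_ge0 e z1 z2 r : z1 <= z2 -> 0 <= r ->
  sq e z1 + sq e z2 <= sq e (z1 - r) + sq e (z2 + r).
Proof.
move=> z12 r0; rewrite /sq /pospow /Num.max.
by do !case: ifPn; rewrite -?leNgt => *; nra.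
Qed.

Lemma sq_spread_eq e z1 z2 r : 0 <= r -> z1 <= z2 -> z2 + r <= e ->
  sq e (z1 - r) + sq e (z2 + r) - sq e z1 - sq e z2 = 2 * r * (z2 - z1) + 2 * r ^+ 2.
Proof.
move=> r0 z12 z2e; rewrite /sq /pospow !max_r; first by ring.
all: lra.
Qed.

Lemma sq_spread_le e z r : 0 <= r ->
  sq e (z + r) + sq e (z - r) - 2 * sq e z <= 2 * r ^+ 2.
Proof.
move=> r0; rewrite /sq /pospow /Num.max.
by do !case: ifPn; rewrite -?leNgt => *; nra.
Qed.

Lemma sq_spread_low e z r : 0 <= r -> e <= z - r ->
  sq e (z + r) + sq e (z - r) - 2 * sq e z = 0.
Proof.
move=> r0 ez; rewrite /sq /pospow !max_l; first by ring.
all: lra.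
Qed.

(* A spread of width eps around y is compensated by widening the gap between
   the lower points x1 and x2, whose effect on the second moment is linear
   in r, so that r of order eps ^ 2 suffices. *)
Lemma third_order_gap e x1 x2 y eps r : x1 <= x2 -> 0 <= r -> 0 <= eps ->
  x2 + r <= y - eps -> eps ^+ 2 <= r * (x2 - x1) ->
  0 <= 2 * sq e y + sq e (x2 + r) + sq e (x1 - r)
     - sq e (y + eps) - sq e (y - eps) - sq e x2 - sq e x1.
Proof.
move=> x12 r0 eps0 xy h.
have [le|lt] := leP e (y - eps).
  have := sq_spread_low eps0 le; have := sq_spread_ge0 e x12 r0; lra.
have := sq_spread_le e y eps0.
have := sq_spread_eq r0 x12 (le_trans xy (ltW lt)).
have := sqr_ge0 r; lra.
Qed.

End ThirdOrderExchange.

Section ThirdOrderBlocks.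
Context d (T : measurableType d) (R : realType) (P : probability T R).
Context (a b : R) (u h : R -> R) (hu : increasing_on `[a, b] u) (n : nat).
Hypotheses (noatom : atomless P) (ab : a < b) (dh : distortion h) (n3 : (2 < n)%N).
Hypothesis cons : forall X Y : rv_on P a b, sd_ge n X Y -> rdu hu h Y <= rdu hu h X.

(** The preferred list spreads the pair at y, the other one widens the pair x1, x2 instead. Their
    sums agree, so only the gap of order 2 is to be checked. Any excess of weight j + 1 over weight
    j penalises the spread and must be outweighed at the two lower ranks. *)
Lemma third_order_exchange N j x1 x2 y eps r : (j + 4 <= N)%N ->
  x1 <= x2 -> 0 <= r -> 0 <= eps -> a <= x1 - r -> x2 + r <= y - eps ->
  y + eps <= b -> eps ^+ 2 <= r * (x2 - x1) ->
  weight h N j.+1 * (u y - u (y - eps)) - weight h N j * (u (y + eps) - u y) <=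
  weight h N (j + 3) * (u x1 - u (x1 - r)) - weight h N (j + 2) * (u (x2 + r) - u x2).
Proof.
move=> jN x12 r0 eps0 ax xy yb er.
have := block_compare (s := [:: y + eps; y - eps; x2; x1])
  (s' := [:: y; y; x2 + r; x1 - r]) noatom ab dh cons (j := j) (N := N) (k := 1) erefl.
have -> : all (fun z => a <= z <= b) [:: y + eps; y - eps; x2; x1].
  by rewrite /=; do !(apply/andP; split); lra.
have -> : all (fun z => a <= z <= b) [:: y; y; x2 + r; x1 - r].
  by rewrite /=; do !(apply/andP; split); lra.
have -> : sorted (fun z z' => z' <= z) [:: y + eps; y - eps; x2; x1].
  by rewrite /=; do !(apply/andP; split); lra.
have -> : sorted (fun z z' => z' <= z) [:: y; y; x2 + r; x1 - r].
  by rewrite /=; do !(apply/andP; split); lra.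
move=> /(_ isT isT isT isT jN (leq_trans _ jN)); rewrite addnS => /(_ isT _ _ n3).
have gap2 e : 0 <= kern_gap 4 (nth a [:: y + eps; y - eps; x2; x1])
    (nth a [:: y; y; x2 + r; x1 - r]) 2 e.
  rewrite /kern_gap !big_ord_recl big_ord0 /= -!mulrBl !addr0 -!mulrDl.
  rewrite mulr_ge0 ?invr_ge0//.
  by have := third_order_gap e x12 r0 eps0 xy er; lra.
have gapb i : (i <= 1)%N -> kern_gap 4 (nth a [:: y + eps; y - eps; x2; x1])
    (nth a [:: y; y; x2 + r; x1 - r]) i b = 0.
  move=> i1; rewrite /kern_gap !big_ord_recl big_ord0 /= !kern_exp; try lra.
  by case: i i1 => [|[|//]] _; rewrite ?expr0 ?expr1; field.
move=> /(_ gap2 gapb).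
rewrite !big_ord_recl !big_ord0 /= /bump /= !addn0 !addr0 !addnS !addn0.
lra.
Qed.

End ThirdOrderBlocks.

(** v, v1, v2, v3 are the weights of four consecutive ranks. If v1 > v, concavity makes the spread
    cost at least (v1 - v) c eps, linear in eps, whereas the displacement by r repays at most L r,
    of order eps ^ 2. *)
Lemma third_order_weights {R : realType} (v v1 v2 v3 c L l eps r D1 D2 Dup Ddown : R) :
  0 <= v1 -> 0 <= v2 -> 0 <= v3 <= 1 -> 0 <= L -> 0 < l -> 0 < eps ->
  0 <= c -> r * (l / 4) = eps ^+ 2 ->
  c * eps <= Dup -> Dup <= Ddown -> 0 <= D1 <= L * r -> 0 <= D2 ->
  v1 * Ddown - v * Dup <= v3 * D1 - v2 * D2 ->
  (v1 - v) * c * (l / 4) <= L * eps.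
Proof.
move=> v10 v20 /andP[v30 v31] L0 l0 eps0 c0 rl lo updown /andP[D10 D1L] D20 ex.
have [wle|wlt] := leP v1 v.
  apply: (@le_trans _ _ 0); last by rewrite mulr_ge0// ltW.
  by rewrite -mulrA mulr_le0_ge0 ?subr_le0// mulr_ge0// divr_ge0// ltW.
have D0 : 0 < v1 - v by rewrite subr_gt0.
have s1 := ler_wpM2l (ltW D0) lo.
have s2 := ler_wpM2l v10 updown.
have s3 := ler_piMl D10 v31.
have s4 := mulr_ge0 v20 D20.
have s5 : (v1 - v) * (c * eps) <= L * r by lra.
have l4 : 0 <= l / 4 by rewrite divr_ge0// ltW.
have s6 := ler_wpM2r l4 s5.
rewrite -(ler_pM2r eps0) -[leRHS]mulrA -expr2 -rl (mulrA L).
by have -> : (v1 - v) * c * (l / 4) * eps = (v1 - v) * (c * eps) * (l / 4) by ring.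
Qed.

Lemma third_order_points {R : realType} (p l eps r : R) : 0 < l -> 0 < eps ->
  eps <= l / 8 -> 0 <= r -> r <= eps / 2 ->
  let x1 := p + l / 4 in let x2 := p + l / 2 in let y := p + 3 * l / 4 in
  [/\ p <= x1 - r, x1 - r <= x1, x1 <= x2, x2 <= x2 + r &
   [/\ x2 + r <= y - eps, y - eps <= y, y <= y + eps, y + eps <= p + l &
    p <= x2 /\ p <= y - eps]].
Proof. by move=> l0 e0 el r0 re x1 x2 y; rewrite /x1 /x2 /y; split; [..|split; [..|split]]; lra. Qed.

(** * Linearity of the distortion below 1 *)

Section DistortionShape.
Context d (T : measurableType d) (R : realType) (P : probability T R).
Context (a b : R) (u h : R -> R) (hu : increasing_on `[a, b] u) (n : nat).
Hypotheses (noatom : atomless P) (ab : a < b) (dh : distortion h) (n3 : (2 < n)%N).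
Hypothesis cons : forall X Y : rv_on P a b, sd_ge n X Y -> rdu hu h Y <= rdu hu h X.
Variable s0 : R.
Hypotheses (s01 : 0 <= s0 < 1) (hs0 : h s0 != 0).
Hypothesis nonconst : nonconstant_on `]a, b] u.

Let n2 : (1 < n)%N := ltnW n3.

(** If the weight dropped from v to w < v, exchanges on consecutive cells of length e would shrink
    the increments of u by the factor rho = w / v from each cell to the next. With rho ^ K < c / L
    this contradicts a first increment of at most L e and a last one of at least c e. *)
Lemma weight_nondecreasing N j : (j.+1 < N)%N -> weight h N j <= weight h N j.+1.
Proof.
move=> jN.
have [p [q [c [L [ap pq qb c0 bilip]]]]] :=
  utility_bilipschitz noatom ab dh n3 cons s01 hs0 nonconst.
have w0 := weight_ge0 dh (ltnW jN); have w1 := weight_ge0 dh jN.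
set v := weight h N j in w0 *; set w := weight h N j.+1 in w1 *.
rewrite leNgt; apply/negP => wv.
have v0 : 0 < v by lra.
pose rho := w / v.
have rho01 : 0 <= rho < 1 by rewrite divr_ge0//= ltr_pdivrMr// mul1r.
have L0 : 0 < L.
  have /andP[h1 h2] := bilip p q (lexx p) (ltW pq) (lexx q).
  have qp : 0 < q - p by lra.
  have := mulr_gt0 c0 qp => h3; rewrite -(pmulr_lgt0 _ qp); lra.
have [K hK] := geometric_lt rho01 (divr_gt0 c0 L0).
pose e := (q - p) / K.+1%:R.
have e0 : 0 < e by rewrite divr_gt0// subr_gt0.
have Ke : K.+1%:R * e = q - p by rewrite /e mulrC divfK// pnatr_eq0.
pose z i := p + i%:R * e.
have zS i : z i.+1 = z i + e by rewrite /z -natr1; ring.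
have pz i : p <= z i by rewrite /z lerDl mulr_ge0// ltW.
have zq i : (i <= K.+1)%N -> z i <= q.
  move=> iK; have : i%:R * e <= K.+1%:R * e by rewrite ler_wpM2r ?ler_nat// ltW.
  by rewrite Ke /z; lra.
pose f i := u (z i.+1) - u (z i).
have fS i : (i < K)%N -> f i.+1 <= rho * f i.
  move=> iK; rewrite /rho mulrAC ler_pdivlMr// mulrC /f.
  have := exchange noatom ab dh cons n2 jN (z1 := z i) (z2 := z i.+2) (e := e).
  rewrite !zS addrK; apply => //.
  - by have := pz i; lra.
  - exact: ltW.
  - by have := zq i.+2; rewrite ltnS => /(_ iK); rewrite !zS; lra.
have fgeom i : (i <= K)%N -> f i <= rho ^+ i * f 0%N.
  elim: i => [_|i IH iK]; first by rewrite expr0 mul1r.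
  apply: le_trans (fS i iK) _; rewrite exprS -mulrA ler_wpM2l//.
    by case/andP: rho01.
  exact: IH (ltnW iK).
have lip i : (i <= K)%N -> c * e <= f i <= L * e.
  move=> iK; have := bilip (z i) (z i.+1) (pz i).
  have -> : z i.+1 - z i = e by rewrite zS; ring.
  by apply; [rewrite zS lerDl ltW | exact: zq].
have /andP[lo _] := lip K (leqnn K).
have /andP[_ hi] := lip 0%N (leq0n K).
have rK0 : 0 <= rho ^+ K by rewrite exprn_ge0//; case/andP: rho01.
have : c * e <= rho ^+ K * L * e.
  apply: (le_trans lo); apply: (le_trans (fgeom K (leqnn K))).
  by rewrite -mulrA ler_wpM2l.
rewrite ler_pM2r// -ler_pdivrMr//; lra.
Qed.

Lemma weight_nonincreasing N j : (j + 4 <= N)%N -> weight h N j.+1 <= weight h N j.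
Proof.
move=> jN.
have [p [q [c [L [ap pq qb c0 bilip]]]]] :=
  utility_bilipschitz noatom ab dh n3 cons s01 hs0 nonconst.
have wr := utility_wright noatom ab dh n3 cons s01 hs0.
have jN3 : (j + 3 < N)%N by lia.
have jN2 : (j + 2 < N)%N by lia.
have jN1 : (j + 1 < N)%N by lia.
have v0 : 0 <= weight h N j by apply: (weight_ge0 dh); lia.
have v1 : 0 <= weight h N j.+1 by apply: (weight_ge0 dh); lia.
have v2 := weight_ge0 dh jN2.
have v3 := weight_ge0 dh jN3.
have v3' := weight_le1 dh jN3.
have L0 : 0 < L.
  have /andP[h1 h2] := bilip p q (lexx p) (ltW pq) (lexx q).
  have qp : 0 < q - p by lra.
  have := mulr_gt0 c0 qp => h3; rewrite -(pmulr_lgt0 _ qp); lra.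
pose l := q - p; have l0 : 0 < l by rewrite /l; lra.
suff : (weight h N j.+1 - weight h N j) * c <= 0.
  by rewrite pmulr_lle0// subr_le0.
apply: (@archimedean_le0_from _ _ (4 * L) 1) => -[//|M] _.
have M0 : 0 < M.+1%:R :> R by [].
have M1 : 1 <= M.+1%:R :> R by rewrite ler1n.
pose eps := l / (8 * M.+1%:R).
have epsM : M.+1%:R * eps = l / 8 by rewrite /eps; field; rewrite gt_eqF.
have eps0 : 0 < eps by rewrite divr_gt0// mulr_gt0.
have epsl : eps <= l / 8 by rewrite -epsM ler_peMl// ltW.
(* The points x1 and x2 will be l / 4 apart, so this r gives r (x2 - x1) = eps ^ 2, the least value
   that pays for the spread in [third_order_gap]. *)
pose r := 4 * eps ^+ 2 / l.
have rl : r * (l / 4) = eps ^+ 2 by rewrite /r; field; rewrite gt_eqF.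
have r0 : 0 <= r by apply: divr_ge0; [rewrite mulr_ge0// sqr_ge0|exact: ltW].
have r_eps : r <= eps / 2.
  rewrite -(ler_pM2r (_ : 0 < l / 4)) ?divr_gt0// rl expr2.
  have : eps * eps <= eps * (l / 8) by rewrite ler_wpM2l// ltW.
  lra.
have [] := third_order_points p l0 eps0 epsl r0 r_eps.
set x1 := p + l / 4; set x2 := p + l / 2; set y := p + 3 * l / 4.
move=> px1 x1r x12 x2r [x2y yeps yy yq [px2 py]].
have qE : p + l = q by rewrite /l addrC subrK.
rewrite qE in yq.
have x21 : x2 - x1 = l / 4 by rewrite /x2 /x1; field.
have ax1 : a <= x1 - r := le_trans (ltW ap) px1.
have yb : y + eps <= b := le_trans yq qb.
have x1q : x1 <= q by apply: le_trans yq; apply: le_trans yy; apply: le_trans yeps;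
  apply: le_trans x2y; exact: le_trans x2r.
have x2q : x2 + r <= q by apply: le_trans yq; apply: le_trans yy; exact: le_trans yeps.
have er : eps ^+ 2 <= r * (x2 - x1) by rewrite x21 rl.
have ex := third_order_exchange noatom ab dh n3 cons jN x12 r0 (ltW eps0) ax1 x2y yb er.
have /andP[lip0 lip1] := bilip (x1 - r) x1 px1 x1r x1q.
have /andP[lip2 _] := bilip x2 (x2 + r) px2 x2r x2q.
have /andP[lip3 _] := bilip y (y + eps) (le_trans py yeps) yy yq.
have := wr (y - eps) y eps (le_trans (ltW ap) py) yeps (ltW eps0) yb.
rewrite subrK => wy.
have E1 : x1 - (x1 - r) = r by rewrite opprB addrC subrK.
have E2 : x2 + r - x2 = r by rewrite addrAC subrr add0r.
have E3 : y + eps - y = eps by rewrite addrAC subrr add0r.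
rewrite E1 in lip0 lip1; rewrite E2 in lip2; rewrite E3 in lip3.
have cr0 : 0 <= c * r by rewrite mulr_ge0// ltW.
have s7 : (weight h N j.+1 - weight h N j) * c * (l / 4) <= L * eps.
  apply: (third_order_weights v1 v2 _ (ltW L0) l0 eps0 (ltW c0) rl lip3 wy _ _ ex).
  - by rewrite v3.
  - by rewrite lip1 (le_trans cr0).
  - exact: le_trans lip2.
move: (weight h N j.+1 - weight h N j) s7 => D s7.
have l4 : 0 < l / 4 by rewrite divr_gt0.
have := ler_wpM2l (ltW M0) s7; rewrite (mulrCA _ L) epsM => s8.
rewrite -(ler_pM2r l4) -!mulrA; rewrite -!mulrA in s8; apply: le_trans s8 _.
by move: (mulr_gt0 L0 l0); lra.
Qed.

(** An even grid contains 1/2, which makes the slope 2 h(1/2) independent of M. Third-order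
    comparisons need two further ranks below j and j + 1, so equality stops before the last two
    weights; hence the bound on k. *)
Lemma distortion_grid M k : (1 < M)%N -> (k <= (2 * M) - 2)%N ->
  h (k%:R / (2 * M)%:R) = k%:R / (2 * M)%:R * (2 * h (1 / 2)).
Proof.
move=> M1 kM; set N := (2 * M)%N.
have weq i : (i <= N - 3)%N -> weight h N i = weight h N 0.
  elim: i => [//|i IH] iN; rewrite -IH; last by lia.
  apply/le_anti; rewrite weight_nonincreasing; last by lia.
  by rewrite weight_nondecreasing//; lia.
have lin m : (m <= N - 2)%N -> h (m%:R / N%:R) = m%:R * weight h N 0.
  move=> mN; rewrite -(sum_weight dh).
  rewrite (eq_bigr (fun=> weight h N 0)).
    by rewrite big_const_ord iter_addr_0 mulr_natl.
  by move=> i _; apply: weq; have := ltn_ord i; lia.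
have half : h (1 / 2) = M%:R * weight h N 0.
  rewrite -lin; last by lia.
  congr h; rewrite /N natrM; field.
  by rewrite pnatr_eq0; lia.
rewrite lin// half /N natrM; field.
by rewrite pnatr_eq0; lia.
Qed.

(** Off the grid, monotonicity squeezes h s between two neighbouring grid values, which differ by 2
    h(1/2) / (2M). *)
Lemma distortion_linear s : 0 <= s < 1 -> h s = 2 * h (1 / 2) * s.
Proof.
move=> /andP[s00 s1]; set l := 2 * h (1 / 2).
have s1' : 0 < 1 - s by rewrite subr_gt0.
(* For M >= M0 one has 2M (1 - s) > 3, which keeps the right end k + 1 of the cell of s within 2M -
   2, where [distortion_grid] applies. *)
have [M0 [M01 M0b]] : exists M0 : nat, (1 < M0)%N /\ 3 / (1 - s) < M0%:R.
  exists (Num.bound (3 / (1 - s))).+2; split => //.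
  apply: lt_le_trans (archi_boundP _) _; first by rewrite divr_ge0// ltW.
  by rewrite ler_nat ltnW// ltnW.
have Mpos M : (M0 <= M)%N -> (0 : R) < (2 * M)%:R.
  by move=> MM; rewrite ltr0n muln_gt0 /=; apply: leq_trans MM; exact: ltnW.
have h2 : 0 <= h (1 / 2).
  have [h01 _ _ _] := dh; have := h01 (1 / 2); rewrite !in_itv /=.
  have -> : (0 : R) <= 1 / 2 by lra.
  have -> : (1 / 2 : R) <= 1 by lra.
  by move=> /(_ isT)/andP[].
have close M : (M0 <= M)%N -> exists k : nat,
    [/\ k%:R <= s * (2 * M)%:R, s * (2 * M)%:R < k%:R + 1,
     h (k%:R / (2 * M)%:R) <= h s, h s <= h (k.+1%:R / (2 * M)%:R) & (k.+1 <= (2 * M) - 2)%N].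
  move=> MM; have N0 := Mpos M MM.
  exists (Num.truncn (s * (2 * M)%:R)).
  have /andP[t1 t2] : (Num.truncn (s * (2 * M)%:R))%:R <= s * (2 * M)%:R <
      (Num.truncn (s * (2 * M)%:R)).+1%:R.
    by apply: truncn_itv; rewrite mulr_ge0// ltW.
  set k := Num.truncn _ in t1 t2 *.
  have kM : (k.+1 <= 2 * M - 2)%N.
    rewrite leq_subRL; last by rewrite leq_pmulr// (leq_trans _ MM)// ltnW.
    rewrite -(ler_nat R) add2n -!natr1.
    have : 3 / (1 - s) < (2 * M)%:R.
      by apply: (lt_le_trans M0b); rewrite ler_nat (leq_trans MM)// leq_pmull.
    by rewrite ltr_pdivrMr//; move: t1; lra.
  split => //.
  - by rewrite natr1.
  - by apply: (distortion_le dh); rewrite ?divr_ge0// ?ler_pdivrMr// ltW.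
  - apply: (distortion_le dh) => //; first by rewrite ler_pdivlMr// ltW.
    by rewrite ler_pdivrMr// mul1r ler_nat (leq_trans kM)// leq_subr.
have bound M : (M0 <= M)%N ->
    (2 * M)%:R * (h s - l * s) <= l /\ (2 * M)%:R * (l * s - h s) <= l.
  move=> MM; have [k [k1 k2 k3 k4 kM]] := close M MM.
  have M1 : (1 < M)%N := leq_trans M01 MM.
  have N0 := Mpos M MM.
  rewrite distortion_grid// in k4; rewrite distortion_grid// in k3; last exact: ltnW.
  rewrite -/l in k3 k4.
  rewrite mulrAC ler_pdivrMr// in k3; rewrite mulrAC ler_pdivlMr// -natr1 in k4.
  have l0 : 0 <= l by rewrite mulr_ge0.
  have := ler_wpM2r l0 k1; have := ler_wpM2r l0 (ltW k2).
  by split; lra.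
have Nle (A C : R) (M : nat) : 0 <= C -> (2 * M)%:R * A <= C -> M%:R * A <= C.
  move=> C0 h1; have [A0|A0] := leP A 0.
    by apply: (@le_trans _ _ 0) => //; rewrite mulr_ge0_le0.
  by apply: le_trans h1; rewrite ler_wpM2r ?ler_nat ?leq_pmull//; exact: ltW.
have l0 : 0 <= l by rewrite mulr_ge0.
apply/eqP; rewrite eq_le -subr_le0 -[X in _ && X]subr_le0; apply/andP; split.
  by apply: (@archimedean_le0_from _ _ l M0) => M /bound[h1 _]; exact: Nle h1.
by apply: (@archimedean_le0_from _ _ l M0) => M /bound[_ h1]; exact: Nle h1.
Qed.

Lemma distortion_shape : exists l, [/\ 0 < l, l <= 1 &
  forall s : R, s \in `[0, 1] -> h s = l * s * (s < 1)%R%:R + (s == 1)%R%:R].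
Proof.
have lin := distortion_linear; set l := 2 * h (1 / 2) in lin.
have [h01 _ h0 h1] := dh.
exists l; split.
- case/andP: (s01) => s00 s1.
  have hp : 0 < h s0.
    rewrite lt_neqAle eq_sym hs0 /=; have := h01 s0; rewrite !in_itv /= s00 ltW//.
    by move=> /(_ isT)/andP[].
  rewrite (lin _ s01) in hp.
  have s0p : 0 < s0.
    by rewrite lt_neqAle s00 andbT; apply: contraTneq hp => <-; rewrite mulr0 ltxx.
  by rewrite pmulr_lgt0 in hp.
(* The bound l s = h s <= 1 is used along s = N / (N + 1), which tends to 1. *)
- rewrite -subr_le0; apply: (@archimedean_le0_from _ _ l 1) => -[//|N] _.
  have s1 : 0 <= (N%:R / N.+1%:R : R) < 1 by rewrite divr_ge0//= ltr_pdivrMr// mul1r ltr_nat.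
  have := lin _ s1.
  have := h01 (N%:R / N.+1%:R); rewrite !in_itv /=; case/andP: s1 => -> /ltW -> /(_ isT).
  move=> /andP[_ +] E; rewrite E mulrA ler_pdivrMr// -natr1; lra.
- move=> s; rewrite in_itv /= => /andP[s00]; rewrite le_eqVlt => /predU1P[->|s1].
    by rewrite h1 ltxx eqxx mulr0 add0r.
  by rewrite s1 (lt_eqF s1) mulr1 addr0 lin// s00.
Qed.

End DistortionShape.

(** * Signs of the mixed differences of the utility *)

Section UtilityShape.
Context d (T : measurableType d) (R : realType) (P : probability T R).
Context (a b : R) (u h : R -> R) (hu : increasing_on `[a, b] u) (n : nat).
Hypotheses (noatom : atomless P) (ab : a < b) (dh : distortion h) (n3 : (2 < n)%N).
Hypothesis cons : forall X Y : rv_on P a b, sd_ge n X Y -> rdu hu h Y <= rdu hu h X.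
Variable l : R.
Hypotheses (l0 : 0 < l)
  (hE : forall s : R, s \in `[0, 1] -> h s = l * s * (s < 1)%R%:R + (s == 1)%R%:R).

Lemma ess_min_atom (X : rv_on P a b) : (0 < P [set t | rv X t = a])%E ->
  ess_min (util hu X) = u a.
Proof.
move=> Pa; rewrite /ess_min; set S := [set x | _].
have aab : a \in `[a, b] by rewrite in_itv /= lexx ltW.
have uaX t : u a <= u (rv X t).
  by apply: hu (rv_itv X t) _ => //; have := rv_itv X t; rewrite in_itv => /andP[].
have Sa : S (u a).
  rewrite /S /=; apply: lt_le_trans Pa _; rewrite /cdf /distribution /pushforward.
  have mX A : measurable A -> measurable (rv X @^-1` A).
    by move=> mA; rewrite -[_ @^-1` _]setTI; exact: measurable_funP.
  have mU A : measurable A -> measurable (util hu X @^-1` A).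
    by move=> mA; rewrite -[_ @^-1` _]setTI; exact: measurable_funP.
  apply: le_measure; rewrite ?inE; first exact: (mX [set a]).
    exact: mU.
  by move=> t /= Xa; rewrite in_itv /= /util_fun Xa.
have lb : lbound S (u a).
  move=> x; rewrite /S /= leNgt; apply: contraL => xa; rewrite -leNgt.
  rewrite /cdf /distribution /pushforward (_ : _ @^-1` _ = set0) ?measure0//.
  apply/seteqP; split=> // t /=; rewrite in_itv /= => uX.
  by have := le_lt_trans (uaX t) (le_lt_trans uX xa); rewrite ltxx.
apply/le_anti/andP; split; first by apply: ge_inf => //; exists (u a).
by apply: lb_le_inf => //; exists (u a).
Qed.

(* Adding one atom at a to both lists makes the essential minima equal, so that
   only the expectations are compared. *)
Lemma uniform_expectation_le N (x y : nat -> R) k :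
  (forall i, (i < N)%N -> a <= x i <= b) -> (forall i, (i < N)%N -> a <= y i <= b) ->
  (forall e, 0 <= kern_gap N x y k.+1 e) ->
  (forall j, (j <= k)%N -> kern_gap N x y j b = 0) -> (k.+2 <= n)%N ->
  \sum_(i < N) u (y i) <= \sum_(i < N) u (x i).
Proof.
move=> xab yab g0 gb kn.
(* The smallest value may sit at index 0 and z need not be sorted: with h known, the mixture formula
   replaces the formula by ranks. *)
pose ext (z : nat -> R) i := if i is i'.+1 then z i' else a.
have extab z : (forall i, (i < N)%N -> a <= z i <= b) ->
    forall i, (i < N.+1)%N -> a <= ext z i <= b.
  by move=> zab [|i] iN /=; [rewrite lexx ltW | exact: zab].
have [idx [midx idx_lt Pidx]] := uniform_index noatom (ltn0Sn N).
have [X XE] := uniform_rv P midx idx_lt (extab x xab).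
have [Y YE] := uniform_rv P midx idx_lt (extab y yab).
have gapE m e : kern_gap N.+1 (ext x) (ext y) m e = kern_gap N x y m e.
  by rewrite /kern_gap big_ord_recl /= subrr add0r.
have XY : sd_ge n X Y.
  apply: (sd_uniform midx idx_lt Pidx XE YE (k := k)) => //.
  - exact: extab.
  - exact: extab.
  - by move=> e; rewrite gapE.
  - by move=> i ik; rewrite gapE gb.
have atom (Z : rv_on P a b) z : (forall t, rv Z t = ext z (idx t)) ->
    (0 < P [set t | rv Z t = a])%E.
  move=> ZE; apply: (@lt_le_trans _ _ (P (idx @^-1` [set 0%N]))).
    by rewrite Pidx// lte_fin invr_gt0.
  have mi : measurable (idx @^-1` [set 0%N]) by rewrite -[_ @^-1` _]setTI; exact: midx.
  have mZ : measurable (rv Z @^-1` [set a]).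
    by rewrite -[_ @^-1` _]setTI; exact: measurable_funP.
  apply: le_measure; rewrite ?inE//.
  by move=> t /= t0; rewrite ZE t0.
have mean (Z : rv_on P a b) z : (forall t, rv Z t = ext z (idx t)) ->
    \int[P]_t u (rv Z t) = (u a + \sum_(i < N) u (z i)) / N.+1%:R.
  move=> ZE; under eq_Rintegral do rewrite ZE.
  rewrite (uniform_mean midx idx_lt Pidx (fun i => u (ext z i))).
  by rewrite big_ord_recl.
have := cons XY; rewrite !(rdu_mixture hu _ dh hE) !(ess_min_atom (atom _ _ XE)).
rewrite (ess_min_atom (atom _ _ YE)) (mean _ _ XE) (mean _ _ YE).
by rewrite lerD2r ler_pM2l// ler_pM2r ?invr_gt0// lerD2l.
Qed.

(** With two steps or more, the law on the points of sign - dominates the law on those of sign +: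
    the gaps are mixed differences of kernels, nonnegative in the order one below the number of
    steps and, at b, zero in all lower orders because the kernels are polynomials there. A single
    step is the monotonicity of u. *)
Lemma utility_alternating : alternating a b n u.
Proof.
move=> ds x /andP[ds1 dsn] ds0 ax xb.
have s0 := sum_steps_ge0 ds0.
case: ds ds1 dsn ds0 xb s0 => // d0 [|d1 ds] _ dsn ds0 xb s0.
  rewrite /= subr_le0; move: s0 xb; rewrite big_seq1 => s0 xb.
  by apply: hu; rewrite ?in_itv /=; first [apply/andP; split; lra | lra].
set ds' := [:: d0, d1 & ds] in dsn ds0 xb s0 *.
have szE := size_diff_points x (isT : (0 < size ds')%N).
have := diff_points_itv x ds0; rewrite all_cat => /andP[/allP evab /allP odab].
set ev := (diff_points ds' x).1 in szE evab.
set od := (diff_points ds' x).2 in szE odab.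
have mdE f : mixed_diff f ds' x = \sum_(i < size ev) (f (nth a ev i) - f (nth a od i)).
  rewrite mixed_diff_points -/ev -/od sumrB (big_nth a) big_mkord.
  by rewrite [X in _ - X](big_nth a) -szE big_mkord.
have gapE m e : kern_gap (size ev) (nth a od) (nth a ev) m e =
    mixed_diff (fun z => kern m (e - z)) ds' x.
  by rewrite mdE.
rewrite mdE sumrB subr_le0.
apply: (@uniform_expectation_le _ _ _ (size ds)).
- move=> i iN; have := odab (nth a od i); rewrite mem_nth -?szE// => /(_ isT) /andP[h1 h2].
  by apply/andP; split; lra.
- move=> i iN; have := evab (nth a ev i); rewrite mem_nth// => /(_ isT) /andP[h1 h2].
  by apply/andP; split; lra.
- by move=> e; rewrite gapE; exact: (mixed_diff_kern_ge0 x e ds0).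
- move=> j jk; rewrite gapE.
  rewrite (@eq_mixed_diff _ a b _ (fun z => j`!%:R^-1 * (b - z) ^+ j))//.
    by rewrite mixed_diffZ mixed_diff_exp0 ?mulr0//= ltnS (leq_trans jk).
  move=> z; rewrite in_itv /= => /andP[_ zb].
  by rewrite kern_exp ?subr_ge0// mulrC.
- exact: dsn.
Qed.

End UtilityShape.

Section NecessityTheorem.
Context d (T : measurableType d) (R : realType) (P : probability T R).
Context (a b : R) (u h : R -> R) (hu : increasing_on `[a, b] u) (n : nat).

Lemma rdu_consistent_shape : atomless P -> a < b -> (2 < n)%N -> distortion h ->
  nonconstant_on `]a, b] u ->
  (forall X Y : rv_on P a b, sd_ge n X Y -> rdu hu h Y <= rdu hu h X) ->
  (forall s : R, s \in `[0, 1] -> h s = (s == 1)%R%:R) \/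
  exists l, [/\ n_monotone a b n u, 0 < l, l <= 1 &
    forall s : R, s \in `[0, 1] -> h s = l * s * (s < 1)%R%:R + (s == 1)%R%:R].
Proof.
move=> noatom ab n3 dh nonconst cons.
have [[s0 [s01 hs0]]|none] := pselect (exists s0, 0 <= s0 < 1 /\ h s0 != 0).
  right; have [l [l0 l1 hE]] := distortion_shape noatom ab dh n3 cons s01 hs0 nonconst.
  exists l; split => //; apply: alternating_n_monotone => //.
  exact: (utility_alternating noatom ab dh cons l0 hE).
left=> s; rewrite in_itv /= => /andP[s0]; rewrite le_eqVlt => /predU1P[->|s1].
  by have [_ _ _ ->] := dh; rewrite eqxx.
rewrite (lt_eqF s1); apply/eqP; apply: contrapT => hs; apply: none.
by exists s; rewrite s0 s1; split => //; apply/negP.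
Qed.

End NecessityTheorem.

(** * Sufficiency *)

Section DominanceAtMinimum.
Context d (T : measurableType d) (R : realType) (P : probability T R).
Context (a b : R).
Implicit Types X Y : rv_on P a b.

Lemma rv_preimage_measurable X (A : set R) : measurable A ->
  measurable (rv X @^-1` A).
Proof. by move=> mA; rewrite -[_ @^-1` _]setTI; exact: measurable_funP. Qed.

Lemma cdf_rvE X s : cdf X s = P [set t | rv X t <= s].
Proof.
by rewrite /cdf /distribution /pushforward; congr (P _).
Qed.

Lemma le_rv_measurable X s : measurable [set t | rv X t <= s].
Proof.
have -> : [set t | rv X t <= s] = rv X @^-1` [set` `]-oo, s]].
  by apply/seteqP; split => t /=; rewrite in_itv.
exact: rv_preimage_measurable.
Qed.

Lemma lt_rv_measurable X s : measurable [set t | rv X t < s].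
Proof.
have -> : [set t | rv X t < s] = rv X @^-1` [set` `]-oo, s[].
  by apply/seteqP; split => t /=; rewrite in_itv.
exact: rv_preimage_measurable.
Qed.

Lemma Zbool_integrable (A : T -> bool) (c : R) : measurable [set t | A t] ->
  P.-integrable setT (EFin \o (fun t => c * (A t)%:R)).
Proof.
move=> mA; apply: (@bounded_integrable _ _ _ _ _ _ `|c|) => //.
- exact: RV_probability_lty.
- have -> : (fun t => c * (A t)%:R) = (fun t => c * \1_[set t | A t] t).
    by apply/funext => t; rewrite indicE mem_setE.
  by apply: measurable_funM => //; exact: measurable_indic.
- by move=> t _; rewrite normrM ler_piMr//; case: (A t); rewrite ?normr1 ?normr0.
Qed.

Lemma RintegralZbool (A : T -> bool) (c : R) : measurable [set t | A t] ->
  \int[P]_t (c * (A t)%:R) = c * fine (P [set t | A t]).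
Proof.
move=> mA; rewrite RintegralZl//; first by rewrite Rintegral_bool.
by have := Zbool_integrable 1 mA; under eq_fun do rewrite mul1r.
Qed.

(* Just above s, the (k+1)-st iterated distribution function is of exact order
   (x - s) ^ k times the mass at s. *)
Lemma sd_mass_at_min X Y (n : nat) s : (1 < n)%N -> sd_ge n X Y -> a <= s < b ->
  P [set t | rv Y t < s] = 0%E -> (cdf X s <= cdf Y s)%E.
Proof.
case: n => [//|[//|n]] _ [sdn _] /andP[sa sb] Y0.
have near_le x : s < x -> x <= b -> (cdf X s <= cdf Y x)%E.
  move=> sx xb.
  have xab : x \in `[a, b] by rewrite in_itv /=; apply/andP; split; lra.
  have := sdn _ xab; rewrite !icdf_Rintegral lee_fin => le.
  have k0 : 0 < kern n.+1 (x - s).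
    rewrite kern_exp; last by rewrite subr_ge0 ltW.
    by apply: divr_gt0; [rewrite exprn_gt0// subr_gt0 | rewrite ltr0n fact_gt0].
  have lower : kern n.+1 (x - s) * fine (cdf X s) <= \int[P]_t kern n.+1 (x - rv X t).
    rewrite cdf_rvE -(RintegralZbool _ (le_rv_measurable X s)).
    apply: le_Rintegral => //.
    - exact: Zbool_integrable (le_rv_measurable X s).
    - exact: kern_rv_integrable.
    - move=> t _; case: (leP (rv X t) s) => Xs; rewrite ?mulr1 ?mulr0 ?kern_ge0//.
      by apply: kern_homo; lra.
  have upper : \int[P]_t kern n.+1 (x - rv Y t) <= kern n.+1 (x - s) * fine (cdf Y x).
    have i1 := Zbool_integrable (kern n.+1 (x - s)) (le_rv_measurable Y x).
    have i2 := Zbool_integrable (kern n.+1 (x - a)) (lt_rv_measurable Y s).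
    (* The second summand only majorises the kernel on the event Y < s, which is null. *)
    apply: (@le_trans _ _ (\int[P]_t (kern n.+1 (x - s) * (rv Y t <= x)%R%:R +
        kern n.+1 (x - a) * (rv Y t < s)%R%:R))).
      apply: le_Rintegral => //.
      - exact: kern_rv_integrable.
      - exact: integrableD i1 i2.
      - move=> t _; have /andP[aY _] : a <= rv Y t <= b by have := rv_itv Y t; rewrite in_itv.
        have [Ys|sY] := ltP (rv Y t) s.
          rewrite mulr1; apply: ler_wpDl.
            by rewrite mulr_ge0 ?kern_ge0 ?ler0n.
          by apply: kern_homo; lra.
        rewrite mulr0 addr0; case: (leP (rv Y t) x) => Yx.
          by rewrite mulr1; apply: kern_homo; lra.
        by rewrite mulr0 kern_eq0//; lra.
    rewrite RintegralD// (RintegralZbool _ (le_rv_measurable Y x)).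
    rewrite (RintegralZbool _ (lt_rv_measurable Y s)) Y0 /= mulr0 addr0.
    by rewrite cdf_rvE.
  have : kern n.+1 (x - s) * fine (cdf X s) <= kern n.+1 (x - s) * fine (cdf Y x).
    by apply: le_trans lower _; exact: le_trans upper.
  rewrite ler_pM2l// => ?; rewrite -[X in (X <= _)%E]fineK ?fin_num_measure//.
  by rewrite -[X in (_ <= X)%E]fineK ?fin_num_measure.
(* Dividing by the kernel has left F_X(s) <= F_Y(x) for every x > s in [a, b]; x now decreases to
   s. *)
have cvgY := @cdf_right_continuous _ _ _ _ Y s.
rewrite -(cvg_lim _ cvgY)//; apply: lime_ge; first by apply/cvg_ex; eexists; exact: cvgY.
near=> x; apply: near_le.
- by near: x; exact: nbhs_right_gt.
- by near: x; exact: nbhs_right_le.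
Unshelve. all: by end_near.
Qed.

Lemma sd_null_below X Y (n : nat) s : (1 < n)%N -> sd_ge n X Y -> a <= s < b ->
  P [set t | rv Y t <= s] = 0%E -> P [set t | rv X t <= s] = 0%E.
Proof.
move=> n1 sd sab Y0; apply/eqP; rewrite eq_le measure_ge0 andbT -cdf_rvE -Y0 -cdf_rvE.
apply: sd_mass_at_min n1 sd sab _.
apply/eqP; rewrite eq_le measure_ge0 andbT -Y0; apply: le_measure; rewrite ?inE.
- exact: lt_rv_measurable.
- exact: le_rv_measurable.
- by move=> t /= /ltW.
Qed.

Context (u : R -> R) (hu : increasing_on `[a, b] u).

Lemma cdf_utilE X c : cdf (util hu X) c = P [set t | u (rv X t) <= c].
Proof.
by rewrite /cdf /distribution /pushforward; congr (P _).
Qed.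

Lemma le_util_measurable X c : measurable [set t | u (rv X t) <= c].
Proof.
have -> : [set t | u (rv X t) <= c] = util hu X @^-1` [set` `]-oo, c]].
  by apply/seteqP; split => t /=; rewrite in_itv.
by rewrite -[_ @^-1` _]setTI; exact: measurable_funP.
Qed.

(** Since u increases, u <= c defines an initial interval D of [a, b]. If D contains its supremum, a
    single null event X <= s covers; otherwise u(X) <= c forces X < sup D, and countably many null
    events exhaust it. *)
Lemma sd_util_null X Y (n : nat) c : (1 < n)%N -> sd_ge n X Y ->
  P [set t | u (rv Y t) <= c] = 0%E -> P [set t | u (rv X t) <= c] = 0%E.
Proof.
move=> n1 sd Y0.
pose D := [set x | a <= x <= b /\ u x <= c].
have nullD s : D s -> P [set t | rv X t <= s] = 0%E.
  move=> [/andP[sa sb] us].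
  have Ys : P [set t | rv Y t <= s] = 0%E.
    apply/eqP; rewrite eq_le measure_ge0 andbT -Y0; apply: le_measure; rewrite ?inE.
    - exact: le_rv_measurable.
    - exact: le_util_measurable.
    - move=> t /= Ys; apply: le_trans us; apply: hu => //; first exact: rv_itv.
      by rewrite in_itv /= sa.
  (* At s = b the event Y <= s is sure, so it cannot be null; this leaves s < b, as [sd_null_below]
     requires. *)
  move: sb; rewrite le_eqVlt => /predU1P[sE|sb].
    have : P [set t | rv Y t <= s] = 1%E.
      rewrite (_ : [set t | _] = setT) ?probability_setT//.
      apply/seteqP; split => // t _ /=; rewrite sE.
      by have := rv_itv Y t; rewrite in_itv => /andP[].
    by rewrite Ys => /eqP; rewrite eq_sym onee_eq0.
  by apply: sd_null_below n1 sd _ Ys; rewrite sa.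
have DX t : u (rv X t) <= c -> D (rv X t).
  by move=> uc; split => //; have := rv_itv X t; rewrite in_itv.
have subnull s A : measurable A -> D s -> (forall t, A t -> rv X t <= s) -> P A = 0%E.
  move=> mA Ds As; apply/eqP; rewrite eq_le measure_ge0 andbT -(nullD s Ds).
  by apply: le_measure; rewrite ?inE//; exact: le_rv_measurable.
have [[x0 Dx0]|noD] := pselect (exists x, D x); last first.
  rewrite (_ : [set t | _] = set0) ?measure0//.
  by apply/seteqP; split => // t /DX Dt; apply: noD; exists (rv X t).
have Dub : has_ubound D by exists b => x [/andP[]].
have hD : has_sup D by split; [exists x0|].
have [Dsup|nDsup] := pselect (D (sup D)).
  apply: (subnull _ _ (le_util_measurable X c) Dsup) => t /= /DX.
  exact: ub_le_sup.
pose A k := [set t | u (rv X t) <= c] `&` [set t | rv X t <= sup D - k.+1%:R^-1].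
have mA k : measurable (A k).
  by apply: measurableI; [exact: le_util_measurable|exact: le_rv_measurable].
have A0 k : P (A k) = 0%E.
  have k0 : 0 < k.+1%:R^-1 :> R by rewrite invr_gt0.
  have [s Ds ltD] := sup_adherent k0 hD.
  apply: (subnull s _ (mA k) Ds) => t [_ /= ht].
  exact: le_trans ht (ltW ltD).
have -> : [set t | u (rv X t) <= c] = \bigcup_k A k.
  apply/seteqP; split => [t /= uc|t [k _ []]//].
  have Xsup : rv X t < sup D.
    rewrite lt_neqAle ub_le_sup ?andbT//; last exact: DX.
    by apply: contra_notN nDsup => /eqP <-; exact: DX.
  exists (Num.bound (sup D - rv X t)^-1) => //; split => //=.
  rewrite lerBrDr -lerBrDl invf_ple ?posrE ?subr_gt0//.
  apply: (@le_trans _ _ (Num.bound (sup D - rv X t)^-1)%:R).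
    by apply/ltW/archi_boundP; rewrite invr_ge0 subr_ge0 ltW.
  by rewrite ler_nat.
apply/eqP; rewrite eq_le measure_ge0 andbT.
apply: (@le_trans _ _ (\sum_(0 <= k <oo) P (A k))%E).
  by apply: measure_sigma_subadditive => //; exact: bigcup_measurable.
by rewrite (eq_eseriesr (fun k _ => A0 k)) eseries0.
Qed.

Lemma sd_ess_min_le X Y (n : nat) : a < b -> (1 < n)%N -> sd_ge n X Y ->
  ess_min (util hu Y) <= ess_min (util hu X).
Proof.
move=> ab n1 sd; rewrite /ess_min; apply: lb_le_inf.
  exists (u b); rewrite /= cdf_utilE.
  rewrite (_ : [set t | _] = setT) ?probability_setT//.
  apply/seteqP; split => // t _ /=; have := rv_itv X t; rewrite in_itv /= => /andP[aX Xb].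
  by apply: hu => //; rewrite ?rv_itv// in_itv /= lexx ltW.
move=> c /=; rewrite cdf_utilE => Xc; apply: ge_inf; last first.
  rewrite /= cdf_utilE lt_neqAle measure_ge0 andbT eq_sym.
  by apply: contraTneq Xc => /(sd_util_null n1 sd) ->; rewrite ltxx.
exists (u a) => x /=; rewrite cdf_utilE => Yx; rewrite leNgt; apply: contraL Yx => xa.
rewrite -leNgt (_ : [set t | _] = set0) ?measure0//.
apply/seteqP; split=> // t /= uY; have := rv_itv Y t; rewrite in_itv /= => /andP[aY Yb].
have : u a <= u (rv Y t) by apply: hu; rewrite ?rv_itv// in_itv /= lexx ltW.
by move=> /le_lt_trans /(_ (le_lt_trans uY xa)); rewrite ltxx.
Qed.

End DominanceAtMinimum.

(** * Spline cones and their expectations under dominance *)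

Section SplineCone.
Context {R : realType} (p b : R).

(* Nonnegative combinations of powers of b - x and of truncated powers with
   knots in [p, b]: the functions whose expectation [sd_ge] compares. *)
Inductive spline_cone (m : nat) : (R -> R) -> Prop :=
| spline_pow k c : 0 <= c -> (k <= m.+1)%N -> spline_cone m (fun x => c * (b - x) ^+ k)
| spline_trunc z c : 0 <= c -> p <= z <= b ->
    spline_cone m (fun x => c * pospow m.+1 (z - x))
| spline_add f g : spline_cone m f -> spline_cone m g ->
    spline_cone m (fun x => f x + g x).

(** F is the integral of f from x to b: integrating in this direction keeps the coefficients
    nonnegative and the knots in place, and raises the degrees by one. *)
Lemma spline_primitive m f : spline_cone m f -> exists F,
  [/\ spline_cone m.+1 F, F b = 0 & forall x, has_slope setT F x (- f x)].
Proof.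
elim=> [k c c0 km|z c c0 /andP[pz zb]|g h _ [G [cG Gb sG]] _ [H [cH Hb sH]]].
- exists (fun x => c / k.+1%:R * (b - x) ^+ k.+1); split.
  + by apply: spline_pow => //; rewrite divr_ge0.
  + by rewrite subrr expr0n mulr0.
  + move=> x; have := has_slopeZ (c / k.+1%:R) (has_slope_reflect (has_slope_exp k (b - x))).
    by congr has_slope; rewrite mulrN mulrA divfK.
- exists (fun x => c / m.+2%:R * pospow m.+2 (z - x)); split.
  + by apply: spline_trunc => //; rewrite ?divr_ge0// pz.
  + by rewrite /pospow max_l ?subr_le0// expr0n mulr0.
  + move=> x; have := has_slopeZ (c / m.+2%:R) (has_slope_reflect (has_slope_pospow m (z - x))).
    by congr has_slope; rewrite mulrN mulrA divfK.
- exists (fun x => G x + H x); split; first exact: spline_add.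
  + by rewrite Gb Hb addr0.
  + by move=> x; rewrite opprD; exact: has_slopeD.
Qed.

End SplineCone.

Section SplineExpectation.
Context d (T : measurableType d) (R : realType) (P : probability T R).
Context (a b : R).
Implicit Types X Y : rv_on P a b.

Lemma rv_comp_integrable X (g : R -> R) (C : R) : measurable_fun setT g ->
  (forall x, a <= x <= b -> `|g x| <= C) ->
  P.-integrable setT (EFin \o (fun t => g (rv X t))).
Proof.
move=> mg gC; apply: (@bounded_integrable _ _ _ _ _ _ C) => //.
- exact: RV_probability_lty.
- exact: measurableT_comp.
- by move=> t _; apply: gC; have := rv_itv X t; rewrite in_itv.
Qed.

(* Contracting towards b moves away from a, where u may have an infinite
   derivative. *)
Definition contract (r : R) (x : R) := x + r * (b - x).

Lemma contract_itv r x : 0 <= r <= 1 -> a <= x <= b -> contract r a <= contract r x <= b.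
Proof.
move=> /andP[r0 r1] /andP[ax xb]; rewrite /contract; apply/andP; split.
  have : 0 <= (1 - r) * (x - a) by rewrite mulr_ge0// subr_ge0.
  lra.
have : 0 <= (1 - r) * (b - x) by rewrite mulr_ge0// subr_ge0.
lra.
Qed.

Lemma contract_ge r x : 0 <= r -> x <= b -> x <= contract r x.
Proof. by move=> r0 xb; rewrite /contract lerDl mulr_ge0// subr_ge0. Qed.

Lemma contract_measurable r : measurable_fun setT (contract r).
Proof.
apply: measurable_funD => //; apply: measurable_funM => //.
exact: measurable_funB.
Qed.

Lemma pow_expectation_le X Y n k : sd_ge n X Y -> (k < n)%N ->
  \int[P]_t (b - rv X t) ^+ k <= \int[P]_t (b - rv Y t) ^+ k.
Proof.
move=> [_ sd] kn; have := sd k.+1 kn; rewrite !icdf_Rintegral lee_fin.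
have E (Z : rv_on P a b) : \int[P]_t kern k (b - rv Z t) = \int[P]_t (b - rv Z t) ^+ k / k`!%:R.
  rewrite -RintegralZr//; last first.
    have c0 := kern_rv_integrable Z k b.
    have := integrableZl (measurableT) (k`!%:R) c0.
    apply: eq_integrable => // t _ /=; rewrite -EFinM; congr (_%:E).
    rewrite kern_exp; last by have := rv_itv Z t; rewrite in_itv subr_ge0 => /andP[].
    by rewrite mulrC divfK// pnatr_eq0 -lt0n fact_gt0.
  apply: eq_Rintegral => t _; rewrite kern_exp//.
  by have := rv_itv Z t; rewrite in_itv subr_ge0 => /andP[].
by rewrite !E ler_pM2r// invr_gt0 ltr0n fact_gt0.
Qed.

Lemma trunc_expectation_le X Y m z : sd_ge m.+2 X Y -> a <= z <= b ->
  \int[P]_t pospow m.+1 (z - rv X t) <= \int[P]_t pospow m.+1 (z - rv Y t).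
Proof.
move=> [sd _] zab; have := sd z; rewrite in_itv => /(_ zab).
rewrite !icdf_Rintegral lee_fin.
have E (Z : rv_on P a b) : \int[P]_t kern m.+1 (z - rv Z t) =
    \int[P]_t pospow m.+1 (z - rv Z t) / m.+1`!%:R.
  rewrite -RintegralZr//.
  have := integrableZl (measurableT) (m.+1`!%:R) (kern_rv_integrable Z m.+1 z).
  apply: eq_integrable => // t _ /=; rewrite -EFinM; congr (_%:E).
  by rewrite mulrC divfK// pnatr_eq0 -lt0n fact_gt0.
by rewrite !E ler_pM2r// invr_gt0 ltr0n fact_gt0.
Qed.

Lemma spline_bounded q m f : a <= q -> spline_cone q b m f ->
  measurable_fun setT f /\ exists C, forall x, a <= x <= b -> `|f x| <= C.
Proof.
move=> aq; elim=> [k c c0 km|z c c0 /andP[qz zb]|g h _ [mg [C gC]] _ [mh [D hD]]].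
- split.
    by apply: measurable_funM => //; apply: measurable_funX; exact: measurable_funB.
  exists (c * (b - a) ^+ k) => x /andP[ax xb].
  have bx : 0 <= b - x by rewrite subr_ge0.
  rewrite ger0_norm ?mulr_ge0 ?exprn_ge0// ler_wpM2l// lerXn2r ?nnegrE//; lra.
- split.
    apply: measurable_funM => //; apply: measurableT_comp; first exact: pospow_measurable.
    exact: measurable_funB.
  exists (c * pospow m.+1 (z - a)) => x /andP[ax xb].
  rewrite ger0_norm ?mulr_ge0 ?pospow_ge0// ler_wpM2l//.
  rewrite /pospow [in leRHS]max_r; last by lra.
  rewrite lerXn2r ?nnegrE ?le_max ?lexx//; first by lra.
  by rewrite ge_max; apply/andP; split; lra.
- split; first exact: measurable_funD.
  exists (C + D) => x xab; apply: le_trans (ler_normD _ _) _.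
  by rewrite lerD ?gC ?hD.
Qed.

Lemma spline_integrable X m r f : a <= b -> 0 <= r < 1 ->
  spline_cone (contract r a) b m f ->
  P.-integrable setT (EFin \o (fun t => f (contract r (rv X t)))).
Proof.
move=> ab /andP[r0 r1] cf.
have aca : a <= contract r a by exact: contract_ge.
have [mf [C fC]] := spline_bounded aca cf.
apply: (@rv_comp_integrable X (f \o contract r) C) => [|x xab].
  by apply: measurableT_comp => //; exact: contract_measurable.
have r01 : 0 <= r <= 1 by rewrite r0 ltW.
have /andP[h1 h2] := contract_itv r01 xab.
by apply: fC; rewrite h2 andbT (le_trans aca).
Qed.

Lemma spline_expectation_le X Y m r f : sd_ge m.+2 X Y -> a <= b -> 0 <= r < 1 ->
  spline_cone (contract r a) b m f ->
  \int[P]_t f (contract r (rv X t)) <= \int[P]_t f (contract r (rv Y t)).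
Proof.
move=> sd ab r01 cf; have /andP[r0 r1] := r01.
have r1' : 0 < 1 - r by rewrite subr_gt0.
have int_f g (Z : rv_on P a b) : spline_cone (contract r a) b m g ->
    P.-integrable setT (EFin \o (fun t => g (contract r (rv Z t)))).
  exact: spline_integrable.
elim: cf => [k c c0 km|z c c0 /andP[qz zb]|g h cg IHg ch IHh]; last first.
- by rewrite !RintegralD ?lerD//; exact: int_f.
(* z' is the point that the contraction sends to z. A knot z not below the image of a pulls back
   into [a, b], where dominance compares; the truncated power only picks up a power of 1 - r. *)
- pose z' := (z - r * b) / (1 - r).
  have z'ab : a <= z' <= b.
    by rewrite /z' ler_pdivlMr// ler_pdivrMr//; rewrite /contract in qz; apply/andP; split; lra.
  have E x : c * pospow m.+1 (z - contract r x) = c * (1 - r) ^+ m.+1 * pospow m.+1 (z' - x).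
    have -> : z - contract r x = (1 - r) * (z' - x).
      by rewrite /z' /contract; field; rewrite gt_eqF.
    rewrite /pospow -mulrA -exprMn; congr (_ * _ ^+ _).
    by rewrite maxr_pMr ?mulr0// ltW.
  have I (Z : rv_on P a b) : P.-integrable setT (EFin \o (fun t => pospow m.+1 (z' - rv Z t))).
    have := integrableZl (measurableT) (m.+1`!%:R) (kern_rv_integrable Z m.+1 z').
    apply: eq_integrable => // t _ /=; rewrite -EFinM; congr (_%:E).
    by rewrite mulrC divfK// pnatr_eq0 -lt0n fact_gt0.
  under eq_Rintegral do rewrite E.
  under [leRHS]eq_Rintegral do rewrite E.
  rewrite !RintegralZl// ler_wpM2l ?trunc_expectation_le//.
  by rewrite mulr_ge0// exprn_ge0// ltW.
- have E x : c * (b - contract r x) ^+ k = c * (1 - r) ^+ k * (b - x) ^+ k.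
    rewrite -mulrA -exprMn; congr (_ * _ ^+ _).
    by rewrite /contract; ring.
  have I (Z : rv_on P a b) : P.-integrable setT (EFin \o (fun t => (b - rv Z t) ^+ k)).
    apply: (@rv_comp_integrable Z (fun x => (b - x) ^+ k) ((b - a) ^+ k)).
      by apply: measurable_funX; exact: measurable_funB.
    move=> x /andP[ax xb]; have bx : 0 <= b - x by rewrite subr_ge0.
    by rewrite ger0_norm ?exprn_ge0// lerXn2r ?nnegrE//; lra.
  under eq_Rintegral do rewrite E.
  under [leRHS]eq_Rintegral do rewrite E.
  rewrite !RintegralZl// ler_wpM2l ?(pow_expectation_le sd)//.
  by rewrite mulr_ge0// exprn_ge0// ltW.
Qed.

End SplineExpectation.

(** * Uniform approximation by splines *)

Section SplineApproximation.
Context {R : realType} (p b : R).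

Definition spline_approx m (f : R -> R) := forall e, 0 < e ->
  exists2 s, spline_cone p b m s & forall x, p <= x <= b -> `|f x - s x| <= e.

(** If s is within r of f, then F - S + r x increases and F - S - r x decreases, so the error grows
    from 0 at b to at most r (b - p). The + 1 in the choice of r covers p = b. *)
Lemma spline_approx_primitive m f F : p <= b -> spline_approx m f ->
  (forall x, p <= x <= b -> has_slope [set` `[p, b]] F x (- f x)) ->
  spline_approx m.+1 (fun x => F x - F b).
Proof.
move=> pb apf hF e e0.
have w0 : 0 < b - p + 1 by rewrite ltr_wpDl// subr_ge0.
have [s cs hs] := apf _ (divr_gt0 e0 w0).
have [S [cS Sb hS]] := spline_primitive cs.
exists S => // x /andP[px xb].
set r := e / (b - p + 1) in hs.
have r0 : 0 < r by rewrite divr_gt0.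
have D y (c : R) : p <= y <= b ->
    has_slope [set` `[p, b]] (fun y => F y - S y + c * y) y (- f y - - s y + c * 1).
  move=> pyb; apply: has_slopeD.
    apply: has_slopeB; [exact: hF | exact: sub_has_slope (hS y)].
  exact: has_slopeZ (has_slope_id _ _).
have sub y : x <= y <= b -> p <= y <= b by case/andP=> h1 ->; rewrite (le_trans px).
have subI : [set` `[x, b]] `<=` [set` `[p, b]].
  by move=> y /=; rewrite !in_itv; exact: sub.
have up := has_slope_homo (f := fun y => F y - S y + r * y) xb
  (fun y xy => sub_has_slope subI (D y r (sub y xy))).
have dn := has_slope_homo (f := fun y => - 1 * (F y - S y + - r * y)) xb
  (fun y xy => has_slopeZ (- 1) (sub_has_slope subI (D y (- r) (sub y xy)))).
have ub : F x - S x + r * x <= F b - S b + r * b.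
  by apply: up => y xy; have := hs y (sub y xy); rewrite ler_norml => /andP[]; lra.
have db : - 1 * (F x - S x + - r * x) <= - 1 * (F b - S b + - r * b).
  by apply: dn => y xy; have := hs y (sub y xy); rewrite ler_norml => /andP[]; lra.
rewrite Sb in ub db.
have rx : r * (b - x) <= e.
  apply: (@le_trans _ _ (r * (b - p + 1))); first by rewrite ler_wpM2l ?ltW//; lra.
  by rewrite /r divfK// gt_eqF.
by rewrite ler_norml; apply/andP; split; lra.
Qed.

Lemma spline_approx_cst m f c : 0 <= c -> spline_approx m f ->
  spline_approx m (fun x => c + f x).
Proof.
move=> c0 apf e /apf[s cs hs]; exists (fun x => c * (b - x) ^+ 0 + s x).
  by apply: spline_add => //; exact: spline_pow.
by move=> x /hs; rewrite expr0 mulr1 opprD addrACA subrr add0r.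
Qed.

Lemma eq_spline_approx m f g : (forall x, p <= x <= b -> f x = g x) ->
  spline_approx m f -> spline_approx m g.
Proof.
move=> fg apf e /apf[s cs hs]; exists s => // x xpb.
by rewrite -fg//; exact: hs.
Qed.

Variable q : R.
Hypotheses (qp : q < p) (pb : p < b).

Variable f : R -> R.
Hypotheses (f0 : 0 <= f b)
  (fdecr : forall x y, q <= x -> x <= y -> y <= b -> f y <= f x)
  (fconv : forall x y z, q <= x -> x < y -> y < z -> z <= b ->
    (f y - f x) * (z - y) <= (f z - f y) * (y - x)).

Let K := (f q - f p) / (p - q).

Let lipschitz x y : p <= x -> x <= y -> y <= b -> f x - f y <= K * (y - x).
Proof.
move=> px; rewrite le_eqVlt => /predU1P[<- _|xy yb]; first by rewrite !subrr mulr0.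
have first_slope z : p < z -> z <= b -> f p - f z <= K * (z - p).
  move=> pz zb; have := fconv (lexx q) qp pz zb.
  by rewrite /K mulrAC ler_pdivlMr ?subr_gt0//; lra.
move: px; rewrite le_eqVlt => /predU1P[E|px].
  by rewrite -E; rewrite -E in xy; exact: first_slope.
have h1 := first_slope x px (le_trans (ltW xy) yb).
have h2 := fconv (ltW qp) px xy yb.
have xp : 0 < x - p by rewrite subr_gt0.
rewrite -(ler_pM2r xp).
have := ler_wpM2r (ltW (_ : 0 < y - x)) h1; rewrite subr_gt0 => /(_ xy); lra.
Qed.

(** The approximation is the broken line through f on N equal cells, built from b towards p out of
    the constant f b >= 0. Each knot changes the slope by an amount that convexity makes an
    admissible coefficient. On a cell, f and its chord lie between the same end values, at most K w
    <= e apart; K is the descent rate over [q, p], whence the margin left of p. *)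
Lemma spline_approx_convex : spline_approx 0 f.
Proof.
move=> e e0.
have K0 : 0 <= K.
  by rewrite divr_ge0// subr_ge0 ?(ltW qp)//; apply: fdecr; rewrite ?lexx// ltW.
have Kb0 : 0 <= K * (b - p) by rewrite mulr_ge0// subr_ge0 ltW.
have [N [N1 Nb]] : exists N : nat, (0 < N)%N /\ K * (b - p) < N%:R * e.
  exists (Num.bound (K * (b - p) / e)).+1; split => //.
  rewrite -ltr_pdivrMr//; apply: lt_trans (archi_boundP _) _.
    by rewrite divr_ge0// ltW.
  by rewrite ltr_nat.
pose w := (b - p) / N%:R.
have N0 : (0 : R) < N%:R by rewrite ltr0n.
have w0 : 0 < w by rewrite divr_gt0// subr_gt0.
have Nw : N%:R * w = b - p by rewrite /w mulrC divfK// gt_eqF.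
have Kw : K * w <= e.
  rewrite -(ler_pM2l N0) mulrCA Nw; exact: ltW.
have [t [t0 tN tS t_b p_t]] : exists t : nat -> R, [/\ t 0%N = b, t N = p,
    forall j, t j.+1 = t j - w, forall j, t j <= b &
    forall j, (j <= N)%N -> p <= t j].
  exists (fun j => b - j%:R * w); split.
  - by rewrite mul0r subr0.
  - by rewrite Nw opprB addrC subrK.
  - by move=> j; rewrite -natr1; ring.
  - by move=> j; rewrite gerBl mulr_ge0// ltW.
  - move=> j jN; have : j%:R * w <= N%:R * w by rewrite ler_wpM2r ?ler_nat// ltW.
    by rewrite Nw; lra.
(* Left of the last knot s is affine with slope sg, and the slope of the next chord is at most sg:
   the difference is the coefficient of the truncated power to be added. *)
suff main j : (j <= N)%N -> exists s sg, [/\ spline_cone p b 0 s,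
    forall x, t j <= x <= b -> `|f x - s x| <= e,
    forall x, x <= t j -> s x = f (t j) + sg * (x - t j) &
    (j < N)%N -> (f (t j) - f (t j.+1)) / w <= sg].
  have [s [sg [cs hs _ _]]] := main N (leqnn N).
  by exists s => // x xpb; apply: hs; rewrite tN.
elim: j => [_|j IH jN].
  exists (fun x => f b * (b - x) ^+ 0), 0; split.
  - exact: spline_pow.
  - rewrite t0 => x /le_anti <-.
    by rewrite expr0 mulr1 subrr normr0 ltW.
  - by move=> x _; rewrite t0 expr0 mulr1 mul0r addr0.
  - move=> _; rewrite ler_pdivrMr// mul0r subr_le0; apply: fdecr => //.
    + exact: le_trans (ltW qp) (p_t 1%N N1).
    + by rewrite (tS 0%N) lerBlDr lerDl ltW.
have [s [sg [cs hs lin slope_le]]] := IH (ltnW jN).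
have {}slope_le := slope_le jN; rewrite tS in slope_le.
have tj1 := p_t _ jN; rewrite tS in tj1.
have tjb := t_b j.
have tj2 : (j.+1 < N)%N -> p <= t j - w - w by move=> /p_t; rewrite !tS.
rewrite !tS; move: (t j) hs lin slope_le tj1 tjb tj2 => y hs lin slope_le tj1 tjb tj2.
set sg' := (f y - f (y - w)) / w in slope_le.
have sgw : sg' * w = f y - f (y - w) by rewrite /sg' divfK// gt_eqF.
have lin' x : x <= y -> s x + (sg - sg') * pospow 1 (y - x) = f y + sg' * (x - y).
  by move=> xt; rewrite lin// /pospow expr1 max_r; [ring | lra].
have qy : q <= y - w := le_trans (ltW qp) tj1.
have yw : y - w <= y by rewrite gerBl ltW.
exists (fun x => s x + (sg - sg') * pospow 1 (y - x)), sg'; split.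
- apply: spline_add => //; apply: spline_trunc; first by rewrite subr_ge0.
  by rewrite tjb (le_trans tj1).
- move=> x /andP[tx xb]; have [tjx|xtj] := leP y x.
    rewrite /pospow expr1 max_l ?mulr0 ?addr0; last by rewrite subr_le0.
    by apply: hs; rewrite tjx.
  rewrite lin'; last exact: ltW.
  have h1 : f y <= f x by apply: fdecr => //; [exact: le_trans tx | exact: ltW].
  have h2 : f x <= f (y - w) by apply: fdecr.
  have h3 := lipschitz tj1 yw tjb.
  have sg'0 : sg' <= 0.
    have : sg' * w <= 0 by rewrite sgw subr_le0; exact: le_trans h1 h2.
    by rewrite pmulr_lle0.
  have h4 : 0 <= sg' * (x - y) by rewrite mulr_le0// subr_le0 ltW.
  have h5 : sg' * (x - y) <= - (sg' * w).
    have : 0 <= - sg' * (x - (y - w)) by rewrite mulr_ge0 ?oppr_ge0 ?subr_ge0.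
    by lra.
  rewrite sgw in h5.
  have h6 : K * (y - (y - w)) <= e by rewrite opprB addrC subrK.
  by rewrite ler_norml; apply/andP; split; lra.
- move=> x xt; rewrite lin'; last exact: le_trans xt yw.
  have -> : f (y - w) = f y - sg' * w by rewrite sgw; ring.
  by ring.
- move=> /tj2 tj2'.
  rewrite /sg' ler_pM2r ?invr_gt0//.
  have := @fconv (y - w - w) (y - w) y (le_trans (ltW qp) tj2').
  rewrite !gtrBl w0 => /(_ isT isT tjb).
  have -> : y - (y - w) = w by ring.
  have -> : y - w - (y - w - w) = w by ring.
  by rewrite ler_pM2r.
Qed.

End SplineApproximation.

Section MonotoneApproximation.
Context {R : realType} (a b : R) (u : R -> R) (n : nat).
Hypotheses (ab : a < b) (n3 : (2 < n)%N) (mono : n_monotone a b n u).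

Let D : set R := [set` `]a, b]].
Let f k x := (-1) ^+ k * nderiv_on D k.+1 u x.

Lemma n_monotone_slope k x : (k < n - 2)%N -> a < x -> x <= b ->
  has_slope D (nderiv_on D k u) x (nderiv_on D k.+1 u x).
Proof.
move=> kn ax xb; have [_ /(_ (ltnW n3))[der _ _ _]] := mono.
apply: has_slope_within; apply: der => //.
by rewrite in_itv /= ax.
Qed.

(** The function (-1)^(n-3) u^(n-2) is nonnegative, decreasing and convex, hence near broken lines
    of the cone. Each of n - 2 integrations towards b raises the degree and adds the value at b,
    nonnegative by the sign conditions; the last one, with constant 0, gives u b - u. The truncated
    powers end at degree n - 1, the kernel order of dominance of order n. *)
Lemma n_monotone_spline_approx p : a < p -> p < b ->
  spline_approx p b (n - 2) (fun x => u b - u x).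
Proof.
move=> ap pb; have [_ /(_ (ltnW n3))[_ sgn decr conv]] := mono.
have subD : [set` `[p, b]] `<=` D.
  by move=> x; rewrite /D /= !in_itv /= => /andP[px ->]; rewrite andbT; lra.
have f_ge0 k x : (k < n - 2)%N -> a < x -> x <= b -> 0 <= f k x.
  move=> kn ax xb; have := sgn k.+1 x; rewrite subn1 /=; apply; first exact: kn.
  by rewrite in_itv /= ax.
have fE x : f (n - 3)%N x = (-1) ^+ (n - 1) * nderiv_on D (n - 2) u x.
  rewrite /f (_ : (n - 3).+1 = (n - 2)%N); last by lia.
  rewrite (_ : (n - 1 = (n - 3).+2)%N); last by lia.
  by rewrite !exprS mulrA mulN1r opprK mul1r.
have step j : (j <= n - 3)%N -> spline_approx p b j (f (n - 3 - j)%N).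
  elim: j => [_|j IH jn].
    rewrite subn0.
    have aq : a < (a + p) / 2 by lra.
    apply: (@spline_approx_convex _ p b ((a + p) / 2)) => //; first by lra.
    - by apply: f_ge0 => //; lia.
    - move=> x y qx xy yb; rewrite !fE; apply: decr => //; rewrite in_itv /=;
        apply/andP; split; lra.
    - move=> x y z qx xy yz zb; rewrite !fE.
      by apply: (convex_function_slope conv) => //; lra.
  have E : (n - 3 - j = (n - 3 - j.+1).+1)%N by lia.
  have {}IH := IH (ltnW jn); rewrite E in IH.
  set k := (n - 3 - j.+1)%N in IH *.
  have kn : (k.+1 < n - 2)%N by rewrite /k; lia.
  apply: (@eq_spline_approx _ p b _ (fun x => f k b + (f k x - f k b))).
    by move=> x _; rewrite addrC subrK.
  apply: spline_approx_cst; first by apply: f_ge0 => //; exact: ltnW.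
  apply: spline_approx_primitive IH _; first exact: ltW.
  move=> x /andP[px xb]; rewrite /f exprS mulN1r mulNr opprK.
  apply: has_slopeZ; apply: sub_has_slope subD _.
  by apply: n_monotone_slope => //; lra.
have := step (n - 3)%N (leqnn _); rewrite subnn => ap0.
have -> : (n - 2)%N = (n - 3).+1 by lia.
apply: (@eq_spline_approx _ p b _ (fun x => - 1 * u x - - 1 * u b)).
  by move=> x _; ring.
apply: (@spline_approx_primitive _ p b _ _ (fun x => - 1 * u x)) ap0 _; first exact: ltW.
move=> x /andP[px xb].
have sl : has_slope D u x (nderiv_on D 1 u x).
  by apply: (@n_monotone_slope 0) => //; [lia|lra].
by rewrite /f expr0 mul1r -[- nderiv_on _ _ _ _]mulN1r; exact: has_slopeZ (sub_has_slope subD sl).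
Qed.

End MonotoneApproximation.

(** * Expectations along contractions tending to the identity *)

Section Sufficiency.
Context d (T : measurableType d) (R : realType) (P : probability T R).
Context (a b : R) (u : R -> R) (hu : increasing_on `[a, b] u) (n : nat).
Hypotheses (ab : a < b) (n3 : (2 < n)%N) (mono : n_monotone a b n u).
Implicit Types X Y : rv_on P a b.

Lemma contract_rv X r : 0 <= r <= 1 ->
  {X' : rv_on P a b | forall t, rv X' t = contract b r (rv X t)}.
Proof.
move=> r01.
have mc : measurable_fun setT (contract b r \o rv X).
  by apply: measurableT_comp => //; exact: contract_measurable.
pose Z : {RV P >-> R} := mfun_Sub (mem_set mc).
have Zab t : Z t \in `[a, b].
  have := rv_itv X t; rewrite !in_itv /= => Xab.
  have /andP[h1 ->] := contract_itv r01 Xab; rewrite andbT.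
  by apply: le_trans h1; apply: contract_ge; [case/andP: r01 | exact: ltW].
by exists (RvOn Zab).
Qed.

Lemma util_integrable X : P.-integrable setT (EFin \o (fun t => u (rv X t))).
Proof.
have [M M0 uM] := util_bound hu.
apply: (@bounded_integrable _ _ _ _ _ _ M) => //.
- exact: RV_probability_lty.
- exact: (measurable_util_fun hu X).
- by move=> t _; rewrite ler_norml; apply: uM; exact: rv_itv.
Qed.

(** Contracted values stay in [p, b] with p > a, where u b - u is within any e of the spline cone,
    and dominance lowers expectations over the cone; the two approximations cost 2 e. *)
Lemma contract_expectation_le X Y r : sd_ge n X Y -> 0 < r < 1 ->
  \int[P]_t u (contract b r (rv Y t)) <= \int[P]_t u (contract b r (rv X t)).
Proof.
move=> sd /andP[r0 r1].
have r01 : 0 <= r <= 1 by rewrite !ltW.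
have r01' : 0 <= r < 1 by rewrite ltW.
have ba : 0 < b - a by rewrite subr_gt0.
have ap : a < contract b r a by rewrite /contract ltrDl mulr_gt0.
have pb : contract b r a < b.
  have : 0 < (1 - r) * (b - a) by rewrite mulr_gt0// subr_gt0.
  by rewrite /contract; lra.
have uint (Z : rv_on P a b) : P.-integrable setT (EFin \o (fun t => u (contract b r (rv Z t)))).
  have [Z' Z'E] := contract_rv Z r01.
  have := util_integrable Z'; rewrite (_ : (fun t => u (rv Z' t)) = (fun t => u (contract b r (rv Z t))))//.
  by apply/funext => t; rewrite Z'E.
have sd' : sd_ge (n - 2).+2 X Y by rewrite -addn2 subnK// ltnW.
have close e : 0 < e -> \int[P]_t u (contract b r (rv Y t)) <=
    \int[P]_t u (contract b r (rv X t)) + (e + e).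
  move=> e0; have [s cs hs] := n_monotone_spline_approx ab n3 mono ap pb e0.
  have cint (Z : rv_on P a b) (c : R) : P.-integrable setT (EFin \o (fun t : T => c)).
    apply: (@bounded_integrable _ _ _ _ _ _ `|c|) => //.
    exact: RV_probability_lty.
  have sint (Z : rv_on P a b) := spline_integrable Z (ltW ab) r01' cs.
  have bound (Z : rv_on P a b) t : `|u b - u (contract b r (rv Z t)) - s (contract b r (rv Z t))| <= e.
    by apply: hs; apply: contract_itv => //; have := rv_itv Z t; rewrite in_itv.
  have lower : \int[P]_t u (contract b r (rv Y t)) <=
      u b + e - \int[P]_t s (contract b r (rv Y t)).
    rewrite -[u b + e](probability_Rintegral_cst P) -RintegralB//; last exact: cint.
    apply: le_Rintegral => //.
    - exact: integrableB (cint Y (u b + e)) (sint Y).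
    - by move=> t _; have := bound Y t; rewrite ler_norml => /andP[]; lra.
  have upper : u b - e - \int[P]_t s (contract b r (rv X t)) <=
      \int[P]_t u (contract b r (rv X t)).
    rewrite -[u b - e](probability_Rintegral_cst P) -RintegralB//; last exact: cint.
    apply: le_Rintegral => //.
    - exact: integrableB (cint X (u b - e)) (sint X).
    - by move=> t _; have := bound X t; rewrite ler_norml => /andP[]; lra.
  have := spline_expectation_le sd' (ltW ab) r01' cs; lra.
apply/ler_addgt0Pr => e e0; have := close (e / 2) (divr_gt0 e0 (ltr0n R 2)).
by rewrite -splitr.
Qed.

Definition radius k : R := k.+2%:R^-1.

Lemma radius_itv k : 0 < radius k < 1.
Proof. by rewrite /radius invr_gt0 ltr0n invf_lt1 ?ltr0n// ltr1n. Qed.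

Lemma radius_small e : 0 < e -> \forall k \near \oo, radius k < e.
Proof.
move=> e0; have := near_infty_natSinv_lt (PosNum e0); apply: filterS => k /=.
by apply: le_lt_trans; rewrite lef_pV2 ?posrE// ler_nat.
Qed.

Lemma utility_contract_cvg x : a < x -> x <= b ->
  u (contract b (radius k) x) @[k --> \oo] --> u x.
Proof.
move=> ax xb.
have n20 : (0 < n - 2)%N by rewrite subn_gt0.
have sl := n_monotone_slope n3 mono n20 ax xb.
set l := nderiv_on _ _ _ _ in sl.
have [r r0 hr] := sl 1 ltr01.
have l0 : 0 < `|l| + 1 by rewrite ltr_wpDl.
have bx0 : 0 < b - x + 1 by rewrite ltr_wpDl// subr_ge0.
apply/cvgrPdist_le => e e0; near=> k.
have k1 : radius k < r / (b - x + 1) by near: k; apply: radius_small; rewrite divr_gt0.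
have k2 : radius k < e / (`|l| + 1) / (b - x + 1).
  by near: k; apply: radius_small; rewrite !divr_gt0.
have /andP[rk0 rk1] := radius_itv k.
rewrite !ltr_pdivlMr// in k1 k2.
set y := contract b (radius k) x.
have yx : y - x = radius k * (b - x) by rewrite /y /contract addrC addKr.
have yx0 : 0 <= y - x by rewrite yx mulr_ge0 ?subr_ge0// ltW.
have yx1 : y - x <= radius k * (b - x + 1) by rewrite yx ler_wpM2l ?(ltW rk0)// lerDl.
have xab : a <= x <= b by rewrite (ltW ax).
have rk : 0 <= radius k <= 1 by rewrite !ltW.
have yb : y <= b by have /andP[] := contract_itv rk xab.
have Dy : [set` `]a, b]] y.
  by rewrite /= in_itv /= yb andbT; apply: lt_le_trans ax _; rewrite -subr_ge0.
have := hr y Dy; rewrite ger0_norm// => /(_ (le_lt_trans yx1 k1)).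
rewrite /nderiv_on /= mul1r => h.
rewrite distrC -[X in `|X|](subrK (l * (y - x))).
apply: le_trans (ler_normD _ _) _; rewrite normrM (ger0_norm yx0).
have : (`|l| + 1) * (y - x) <= e.
  apply: (@le_trans _ _ ((`|l| + 1) * (radius k * (b - x + 1)))); first by rewrite ler_wpM2l// ltW.
  by rewrite mulrC ltW.
lra.
Unshelve. all: by end_near.
Qed.

Lemma utility_contract_cvg_left : exists2 l, u a <= l &
  u (contract b (radius k) a) @[k --> \oo] --> l.
Proof.
pose w k := u (contract b (radius k) a).
have ca k : a <= contract b (radius k) a <= b.
  have /andP[rk0 rk1] := radius_itv k.
  have aab : a <= a <= b by rewrite lexx ltW.
  have rk : 0 <= radius k <= 1 by rewrite !ltW.
  have /andP[_ ->] := contract_itv rk aab; rewrite andbT.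
  by apply: contract_ge; exact: ltW.
have aI k : contract b (radius k) a \in `[a, b] by rewrite in_itv /= ca.
have wcv : cvgn w.
  apply: nonincreasing_is_cvgn; last first.
    exists (u a) => _ [k _ <-]; apply: hu => //; first by rewrite in_itv /= lexx ltW.
    by case/andP: (ca k).
  move=> k m km; apply: hu => //; rewrite /contract lerD2l ler_wpM2r ?subr_ge0 ?(ltW ab)//.
  by rewrite /radius lef_pV2 ?posrE// ler_nat.
exists (limn w) => //; apply: limr_ge => //; near=> k.
by apply: hu => //; [rewrite in_itv /= lexx ltW | case/andP: (ca k)].
Unshelve. all: by end_near.
Qed.

Lemma n_monotone_expectation_le X Y : sd_ge n X Y ->
  \int[P]_t u (rv Y t) <= \int[P]_t u (rv X t).
Proof.
move=> sd; have [l ul cvl] := utility_contract_cvg_left.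
have [M M0 uM] := util_bound hu.
(* At a the contractions lead to the right limit l of u, so the limiting expectations are those of u
   with its value at a raised to l. Removing the surplus, l - u a times the mass at a, preserves the
   inequality because X has the smaller mass there. *)
pose v (Z : rv_on P a b) t := u (rv Z t) + (l - u a) * (rv Z t <= a)%R%:R.
have vint Z : P.-integrable setT (EFin \o v Z).
  have i2 := Zbool_integrable P (l - u a) (le_rv_measurable Z a).
  exact: (integrableD _ (util_integrable Z) i2).
have vcvg (Z : rv_on P a b) t : u (contract b (radius k) (rv Z t)) @[k --> \oo] --> v Z t.
  rewrite /v; have := rv_itv Z t; rewrite in_itv /= => /andP[aZ Zb].
  case: leP => Za.
    have -> : rv Z t = a by apply/le_anti; rewrite Za.
    by rewrite mulr1 addrC subrK.
  by rewrite mulr0 addr0; exact: utility_contract_cvg.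
have crv (Z : rv_on P a b) k := contract_rv Z
  (ltac:(case/andP: (radius_itv k) => h1 h2; rewrite !ltW//) : 0 <= radius k <= 1).
have cE Z k : (fun t => u (contract b (radius k) (rv Z t))) = (fun t => u (rv (sval (crv Z k)) t)).
  by apply/funext => t; rewrite (svalP (crv Z k)).
have lim (Z : rv_on P a b) : (\int[P]_t (u (contract b (radius k) (rv Z t)))%:E)%E
    @[k --> \oo] --> (\int[P]_t (v Z t)%:E)%E.
  have [] := @dominated_convergence _ _ _ P setT measurableT
    (fun k t => (u (contract b (radius k) (rv Z t)))%:E) (EFin \o v Z) (fun=> M%:E).
  - move=> k; apply/measurable_EFinP; rewrite cE.
    exact: (measurable_util_fun hu (sval (crv Z k))).
  - by have /integrableP[] := vint Z.
  - apply/aeW => t _; apply: cvg_comp (vcvg Z t) _.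
    exact: cvg_id.
  - apply: (@bounded_integrable _ _ _ _ _ (fun=> M) `|M|) => //.
    exact: RV_probability_lty.
  - apply/aeW => t k _; rewrite lee_fin ler_norml; apply: uM.
    by rewrite -(svalP (crv Z k)); exact: rv_itv.
  by [].
have vle : \int[P]_t v Y t <= \int[P]_t v X t.
  apply: fine_le; rewrite ?(integrable_fin_num _ (vint _))//.
  rewrite -(cvg_lim _ (lim Y))// -(cvg_lim _ (lim X))//.
  apply: lee_lim.
  - by apply/cvg_ex; eexists; exact: lim Y.
  - by apply/cvg_ex; eexists; exact: lim X.
  - near=> k; have := contract_expectation_le sd (radius_itv k).
    rewrite !cE => le.
    have E Z : (\int[P]_t (u (rv (sval (crv Z k)) t))%:E =
        (\int[P]_t u (rv (sval (crv Z k)) t))%:E)%E.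
      by rewrite /Rintegral fineK// (integrable_fin_num _ (util_integrable _)).
    have E' Z : (\int[P]_t (u (contract b (radius k) (rv Z t)))%:E =
        (\int[P]_t u (rv (sval (crv Z k)) t))%:E)%E.
      by rewrite -E; apply: eq_integral => t _; rewrite (svalP (crv Z k)).
    by rewrite !E' lee_fin.
have vE Z : \int[P]_t v Z t = \int[P]_t u (rv Z t) + (l - u a) * fine (cdf Z a).
  rewrite RintegralD//; first by rewrite (RintegralZbool P _ (le_rv_measurable Z a)) cdf_rvE.
  - exact: util_integrable.
  - exact: (Zbool_integrable P (l - u a) (le_rv_measurable Z a)).
have atom : fine (cdf X a) <= fine (cdf Y a).
  apply: fine_le; rewrite ?fin_num_measure//.
  apply: (sd_mass_at_min (ltnW n3) sd); first by rewrite lexx.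
  rewrite (_ : [set t | _] = set0) ?measure0//.
  apply/seteqP; split => // t /=; apply/negP; rewrite -leNgt.
  by have := rv_itv Y t; rewrite in_itv => /andP[].
have : (l - u a) * fine (cdf X a) <= (l - u a) * fine (cdf Y a).
  by rewrite ler_wpM2l// subr_ge0.
by move: vle; rewrite !vE; lra.
Unshelve. all: by end_near.
Qed.

End Sufficiency.

Theorem theorem1 (R : realType) (d : measure_display) (T : measurableType d)
    (P : probability T R) (a b : R) (n : nat)
    (pref : rv_on P a b -> rv_on P a b -> Prop)
    (u h : R -> R) (hu : increasing_on `[a, b] u) :
  atomless P -> a < b -> (3 <= n)%N ->
  weak_order pref ->
  nonconstant_on `[a, b] u ->
  distortion h ->
  (forall X Y : rv_on P a b, pref X Y <-> rdu hu h X >= rdu hu h Y) ->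
  let case_i := forall s : R, s \in `[0, 1] -> h s = (s == 1)%R%:R in
  let case_ii (lambda : R) :=
    [/\ n_monotone a b n u, 0 < lambda, lambda <= 1 &
        forall s : R, s \in `[0, 1] ->
          h s = lambda * s * (s < 1)%R%:R + (s == 1)%R%:R] in
  [/\ nonconstant_on `]a, b] u -> sd_consistent n pref ->
        case_i \/ exists lambda, case_ii lambda,
      case_i \/ (exists lambda, case_ii lambda) -> sd_consistent n pref,
      case_i -> forall X : rv_on P a b, rdu hu h X = ess_min (util hu X) &
      forall lambda, case_ii lambda -> forall X : rv_on P a b,
        ((rdu hu h X)%:E =
         lambda%:E * 'E_P[util hu X] +
         ((1 - lambda) * ess_min (util hu X))%:E)%E].
Proof.
move=> noatom ab n3 _ _ dh prefE case_i case_ii.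
have rdu_i : case_i -> forall X : rv_on P a b, rdu hu h X = ess_min (util hu X).
  by move=> hE X; rewrite (eq_rdu hu X hE) rdu_one.
have rdu_ii l : case_ii l -> forall X : rv_on P a b,
    rdu hu h X = l * \int[P]_t u (rv X t) + (1 - l) * ess_min (util hu X).
  by move=> [_ _ _ hE] X; apply: rdu_mixture.
have n2 : (1 < n)%N := ltnW n3.
split => //.
- move=> nc cons; apply: (rdu_consistent_shape noatom ab n3 dh nc) => X Y /cons.
  by rewrite prefE.
- move=> [hi|[l hii]] X Y sd; apply/prefE.
    by rewrite !rdu_i//; exact: sd_ess_min_le sd.
  rewrite !(rdu_ii l)//; have [mono l0 l1 _] := hii.
  apply: lerD; rewrite ler_wpM2l ?subr_ge0 ?(ltW l0)//.
    exact: (n_monotone_expectation_le hu ab n3 mono).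
  exact: sd_ess_min_le sd.
- move=> l hii X; rewrite (rdu_ii l)// EFinD EFinM; congr (_ * _ + _)%E.
  rewrite expectation_def /Rintegral fineK//.
  exact: integrable_fin_num (util_integrable hu X).
Qed.
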